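(* Let $n\ge1$ and let $\mathfrak{g}=[\mathfrak{q}(n),\mathfrak{q}(n)]$ over $\mathbf{k}$. Then the maximal dimension of irreducible $\mathfrak{g}$-modules is $$p^{\frac{b_0}{2}}2^{\lceil\frac{b_1}{2}\rceil}=p^{\frac{n(n-1)}{2}}\,2^{\lceil\frac{n^2-1}{2}\rceil},$$ where by definition $p^{\frac{b_0}{2}}2^{\lceil\frac{b_1}{2}\rceil}=\max_{\theta\in \mathfrak{g}_{\bar 0}^*}p^{\frac{b^\theta_0}{2}}2^{\lceil\frac{b^\theta_1}{2}\rceil}$. Consequently, the first super Kac-Weisfeiler conjecture (that the maximal dimension of irreducible $\mathfrak{g}$-modules equals this maximum over $\theta$) is true for $\mathfrak{g}$.
   Context: $\mathbf{k}$ is an algebraically closed field of characteristic $p>2$. All vector spaces, modules and subalgebras are understood in the super ($\mathbb{Z}_2$-graded) sense, and all Lie superalgebras are finite-dimensional; $\dim V=\dim V_{\bar 0}+\dim V_{\bar 1}$. $\mathfrak{q}(n)$ is the Lie subsuperalgebra of $\mathfrak{gl}(n|n)$ of all matrices $\begin{pmatrix} A & B\\ B & A\end{pmatrix}$ with $A,B$ arbitrary $n\times n$ matrices; $[\mathfrak{q}(n),\mathfrak{q}(n)]$ is its derived subalgebra. It is a restricted Lie superalgebra with $p$-mapping on the even part given by the $p$-th power of matrices. For a restricted Lie superalgebra $\mathfrak{g}=\mathfrak{g}_{\bar 0}\oplus\mathfrak{g}_{\bar 1}$ and $\theta\in\mathfrak{g}_{\bar 0}^*$ (extended to $\mathfrak{g}$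 by $\theta(\mathfrak{g}_{\bar 1})=0$), let $\mathfrak{g}^\theta=\{X\in\mathfrak{g}\mid\theta([X,\mathfrak{g}])=0\}=\mathfrak{g}^\theta_{\bar 0}\oplus\mathfrak{g}^\theta_{\bar 1}$, and set $b_0^\theta=\dim\mathfrak{g}_{\bar 0}-\dim\mathfrak{g}_{\bar 0}^\theta$ (always even) and $b_1^\theta=\dim\mathfrak{g}_{\bar 1}-\dim\mathfrak{g}_{\bar 1}^\theta$. $\lceil a\rceil$ denotes the least integer $\geq a$. *)

(* Defs.v *)
From HB Require Import structures.
From mathcomp Require Import all_boot all_order all_algebra.
Set Implicit Arguments.
Unset Strict Implicit.
Unset Printing Implicit Defensive.
Import GRing.Theory.
Local Open Scope ring_scope.

(* Lie subsuperalgebras of gl(m|n) are encoded as subspaces of                *)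
(* 'M[k]_(m + n); parities are booleans (false is even, true is odd), so that *)
(* the parity of a product is (+) and the exponent of the sign is &&.         *)

Section GeneralLinear.
Context {k : fieldType} {m n : nat}.
Implicit Types (X Y Z : 'M[k]_(m + n)) (g h : {vspace 'M[k]_(m + n)}).

Definition hpart (i : bool) X : 'M[k]_(m + n) :=
  if i then block_mx 0 (ursubmx X) (dlsubmx X) 0
  else block_mx (ulsubmx X) 0 0 (drsubmx X).

Fact hpart_is_linear i : linear (hpart i).
Proof.
by case: i => a X Y; rewrite /hpart scale_block_mx add_block_mx !scaler0 !addr0;
  congr block_mx; apply/matrixP=> u v; rewrite !mxE.
Qed.
HB.instance Definition _ i :=
  GRing.isLinear.Build k 'M[k]_(m + n) 'M[k]_(m + n) _ (hpart i)
    (hpart_is_linear i).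

Lemma hpart_hpart i j X : hpart i (hpart j X) = if i == j then hpart i X else 0.
Proof.
by case: i j => -[]; rewrite /hpart /= ?block_mxKul ?block_mxKur ?block_mxKdl
  ?block_mxKdr ?block_mx0.
Qed.

Lemma hpart_sum X : X = hpart false X + hpart true X.
Proof. by rewrite /hpart add_block_mx !(addr0, add0r) submxK. Qed.

Definition gl_part (i : bool) : {vspace 'M[k]_(m + n)} :=
  limg (linfun (hpart i)).

Lemma gl_partP i X : reflect (hpart i X = X) (X \in gl_part i).
Proof.
apply: (iffP memv_imgP) => [[Y _ ->]|<-]; last first.
  by exists X; rewrite ?memvf ?lfunE.
by rewrite lfunE hpart_hpart eqxx.
Qed.

Definition gpart g (i : bool) : {vspace 'M[k]_(m + n)} := (g :&: gl_part i)%VS.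

(* Bilinear extension of [X, Y] = XY - (-1)^(|X||Y|) YX. *)
Definition sbr X Y : 'M[k]_(m + n) :=
  \sum_(i : bool) \sum_(j : bool)
    (hpart i X *m hpart j Y - (-1) ^+ (i && j) *: (hpart j Y *m hpart i X)).

Lemma sbr_homog i j X Y : X \in gl_part i -> Y \in gl_part j ->
  sbr X Y = X *m Y - (-1) ^+ (i && j) *: (Y *m X).
Proof.
have E l u Z : Z \in gl_part l -> hpart u Z = if u == l then Z else 0.
  by move=> /gl_partP hZ; rewrite -{1}hZ hpart_hpart; case: eqP => // ->.
move=> hX hY; rewrite /sbr (bigD1 i) //= (bigD1 j) //= [X in _ + X]big1.
  rewrite addr0 [X in _ + X]big1; first by rewrite addr0 !(E _ _ _ hX) !(E _ _ _ hY) !eqxx.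
  by move=> v /negPf nv; rewrite (E _ _ _ hY) nv mulmx0 mul0mx scaler0 subr0.
move=> u /negPf nu; rewrite big1 // => v _.
by rewrite (E _ _ _ hX) nu mulmx0 mul0mx scaler0 subr0.
Qed.

Fact sbr_linear_l Y : linear (sbr^~ Y).
Proof.
move=> a X X'; rewrite /sbr scaler_sumr -big_split; apply: eq_bigr => i _ /=.
rewrite scaler_sumr -big_split; apply: eq_bigr => j _ /=.
by rewrite !linearP /= mulmxDl -scalemxAl scalerDr addrACA.
Qed.

Fact sbr_linear_r X : linear (sbr X).
Proof.
move=> a Y Y'; rewrite /sbr scaler_sumr -big_split; apply: eq_bigr => i _ /=.
rewrite scaler_sumr -big_split; apply: eq_bigr => j _ /=.
rewrite !linearP /= mulmxDl -scalemxAl !scalerDr scalerN !scalerA.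
by rewrite [a * _]mulrC opprD addrACA.
Qed.
HB.instance Definition _ X :=
  GRing.isLinear.Build k 'M[k]_(m + n) 'M[k]_(m + n) _ (sbr X) (sbr_linear_r X).

Definition sbrr Y X := sbr X Y.
HB.instance Definition _ Y :=
  GRing.isLinear.Build k 'M[k]_(m + n) 'M[k]_(m + n) _ (sbrr Y) (sbr_linear_l Y).

Lemma hpart_sbr i X Y :
  hpart i (sbr X Y) =
    sbr (hpart false X) (hpart i Y) + sbr (hpart true X) (hpart (~~ i) Y).
Proof.
rewrite /sbr !big_bool !hpart_hpart.
case: i; rewrite /= !(mulmx0, mul0mx, scaler0, subr0, addr0, add0r) /hpart /=;
  rewrite !mulmx_block !(mulmx0, mul0mx, addr0, add0r);
  rewrite !scale_block_mx !opp_block_mx !add_block_mx;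
  rewrite !(block_mxKul, block_mxKur, block_mxKdl, block_mxKdr);
  rewrite !(scaler0, oppr0, addr0, add0r, block_mx0);
  rewrite add_block_mx !(addr0, add0r); congr block_mx; exact: addrC.
Qed.

(* [g, h] is the span of all brackets; by bilinearity a basis is enough, as   *)
(* the next two lemmas confirm.                                               *)
Definition commutator g h : {vspace 'M[k]_(m + n)} :=
  <<[seq sbr X Y | X <- vbasis g, Y <- vbasis h]>>%VS.

Lemma mem_commutator g h X Y :
  X \in g -> Y \in h -> sbr X Y \in commutator g h.
Proof.
move=> gX hY; rewrite (coord_vbasis gX) (coord_vbasis hY).
rewrite -[sbr _ _]/(sbrr _ _) linear_sum.
apply: memv_suml => i _; rewrite linearZ; apply: memvZ.
rewrite /= /sbrr [sbr _ _]linear_sum; apply: memv_suml => j _; rewrite linearZ /=; apply: memvZ; apply: memv_span.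
by apply: allpairs_f; apply: mem_nth; rewrite size_tuple.
Qed.

Lemma commutator_sub g h (U : {vspace 'M[k]_(m + n)}) :
  (forall X Y, X \in g -> Y \in h -> sbr X Y \in U) -> (commutator g h <= U)%VS.
Proof.
move=> sU; apply/span_subvP => _ /allpairsP[[X Y] [/= gX hY ->]].
by apply: sU; apply: vbasis_mem.
Qed.

(* Extension by 0 on the odd part of a linear form on the even part of g      *)
(* (meaningful on graded g; values outside g are irrelevant).                 *)
Definition theta_ext g (theta : 'Hom(subvs_of (gpart g false), k^o)) X : k^o :=
  theta (vsproj (gpart g false) (hpart false X)).

Fact theta_ext_is_linear g theta : linear (@theta_ext g theta).
Proof. by move=> a X Y; rewrite /theta_ext !linearP. Qed.
HB.instance Definition _ g theta :=
  GRing.isLinear.Build k 'M[k]_(m + n) k^o _ (@theta_ext g theta)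
    (@theta_ext_is_linear g theta).

(* g^theta; testing on a basis of g is enough, see theta_centP. *)
Definition theta_cent g theta : {vspace 'M[k]_(m + n)} :=
  (g :&: \bigcap_(Y <- vbasis g)
           lker (linfun (@theta_ext g theta \o sbrr Y)))%VS.

Lemma theta_centP g theta X :
  reflect (X \in g /\ forall Y, Y \in g -> @theta_ext g theta (sbr X Y) = 0)
          (X \in theta_cent theta).
Proof.
have capP (s : seq 'M[k]_(m + n)) :
    (X \in (\bigcap_(Y <- s)
      lker (linfun (@theta_ext g theta \o sbrr Y)))%VS) =
    all (fun Y => theta_ext theta (sbr X Y) == 0) s.
  by elim: s => [|Y s IH]; rewrite ?big_nil ?memvf // big_cons memv_cap IH
    memv_ker lfunE.
rewrite memv_cap capP; apply: (iffP andP) => -[gX H]; split=> //.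
  move=> Y gY; rewrite (coord_vbasis gY) [sbr X _]linear_sum linear_sum big1 // => i _.
  by rewrite /= 2!linearZ /= (eqP (allP H _ _)) ?scaler0 // mem_nth ?size_tuple.
by apply/allP => Y /vbasis_mem gY; rewrite H.
Qed.

Definition b_theta g theta (i : bool) : nat :=
  (\dim (gpart g i) - \dim (gpart (@theta_cent g theta) i))%N.

Definition kw_value (p : nat) g theta : nat :=
  (p ^ (@b_theta g theta false)./2 * 2 ^ uphalf (@b_theta g theta true))%N.

Definition is_max_kw_value p g (N : nat) : Prop :=
  (exists theta, @kw_value p g theta = N) /\
  (forall theta, (@kw_value p g theta <= N)%N).

(* The bracket on the type of elements of g, when g is closed under sbr. *)
Definition sbr_in g (x y : subvs_of g) : subvs_of g :=
  vsproj g (sbr (vsval x) (vsval y)).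

End GeneralLinear.

Section Modules.
Context {k : fieldType}.

Definition homog {V0 V1 : lmodType k} (i : bool) (v : V0 * V1) : Prop :=
  if i then v.1 = 0 else v.2 = 0.

(* Modules may be infinite-dimensional. *)
Record supermodule {m n : nat} (g : {vspace 'M[k]_(m + n)}) := Supermodule {
  sm_even : lmodType k;
  sm_odd : lmodType k;
  sm_act : subvs_of g -> (sm_even * sm_odd)%type -> (sm_even * sm_odd)%type;
  sm_act_linear_l : forall v, linear (sm_act^~ v);
  sm_act_linear_r : forall x, linear (sm_act x);
  sm_act_homog : forall (i j : bool) x v,
    vsval x \in gl_part i -> homog j v -> homog (i (+) j) (sm_act x v);
  sm_act_sbr : forall (i j : bool) x y v,
    vsval x \in gl_part i -> vsval y \in gl_part j ->
    sm_act (sbr_in x y) v =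
      sm_act x (sm_act y v) - (-1) ^+ (i && j) *: sm_act y (sm_act x v)
}.

Definition sm_space {m n} {g : {vspace 'M[k]_(m + n)}} (M : supermodule g) :
  lmodType k := (sm_even M * sm_odd M)%type.

Record is_subsupermodule {m n} {g : {vspace 'M[k]_(m + n)}}
    (M : supermodule g) (W : sm_space M -> Prop) : Prop := {
  sub_0 : W 0;
  sub_lin : forall (a : k) v w, W v -> W w -> W (a *: v + w);
  sub_graded : forall v, W v -> W (v.1, 0) /\ W (0, v.2);
  sub_act : forall x v, W v -> W (sm_act x v)
}.

Definition irreducible {m n} {g : {vspace 'M[k]_(m + n)}}
    (M : supermodule g) : Prop :=
  (exists v : sm_space M, v <> 0) /\
  (forall W, is_subsupermodule (M := M) W ->
    (forall v, W v -> v = 0) \/ (forall v, W v)).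

Definition has_dim (V : lmodType k) (d : nat) : Prop :=
  exists f : {linear 'rV[k]_d -> V}, bijective f.

Definition is_max_irr_dim {m n} (g : {vspace 'M[k]_(m + n)}) (N : nat) : Prop :=
  (exists M : supermodule g, irreducible M /\ has_dim (sm_space M) N) /\
  (forall M : supermodule g, irreducible M ->
     exists2 d, has_dim (sm_space M) d & (d <= N)%N).

Definition super_KW1 (p : nat) {m n} (g : {vspace 'M[k]_(m + n)}) : Prop :=
  exists N, is_max_irr_dim g N /\ is_max_kw_value p g N.

End Modules.

Section Queer.
Variables (k : fieldType) (n : nat).

Definition q_mx (AB : 'M[k]_n * 'M[k]_n) : 'M[k]_(n + n) :=
  block_mx AB.1 AB.2 AB.2 AB.1.

Fact q_mx_is_linear : linear q_mx.
Proof. by move=> a X Y; rewrite /q_mx scale_block_mx add_block_mx. Qed.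
HB.instance Definition _ :=
  GRing.isLinear.Build k ('M[k]_n * 'M[k]_n)%type 'M[k]_(n + n) _ q_mx
    q_mx_is_linear.

Definition queer : {vspace 'M[k]_(n + n)} := limg (linfun q_mx).

Lemma queerP X : reflect (exists A B, X = block_mx A B B A) (X \in queer).
Proof.
apply: (iffP memv_imgP) => [[[A B] _ ->]|[A [B ->]]].
  by exists A, B; rewrite lfunE.
by exists (A, B); rewrite ?memvf // lfunE.
Qed.

(* The derived subalgebra [q(n), q(n)]. *)
Definition queer' : {vspace 'M[k]_(n + n)} := commutator queer queer.

Lemma hpart_queer i X : X \in queer -> hpart i X \in queer.
Proof.
move=> /queerP[A [B ->]]; apply/queerP; rewrite /hpart block_mxKul block_mxKur
  block_mxKdl block_mxKdr.
by case: i; [exists 0, B | exists A, 0].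
Qed.

Lemma sbr_queer X Y : X \in queer -> Y \in queer -> sbr X Y \in queer.
Proof.
have mulq Z T : Z \in queer -> T \in queer -> Z *m T \in queer.
  move=> /queerP[A [B ->]] /queerP[C [D ->]]; rewrite mulmx_block.
  apply/queerP; exists (A *m C + B *m D), (A *m D + B *m C); congr block_mx.
    by rewrite addrC.
  by rewrite addrC.
move=> qX qY; apply: memv_suml => i _; apply: memv_suml => j _.
by apply: memvB; rewrite ?memvZ // mulq // hpart_queer.
Qed.

Lemma sbr_queer' X Y : X \in queer' -> Y \in queer' -> sbr X Y \in queer'.
Proof.
have /subvP s : (queer' <= queer)%VS by apply/commutator_sub/sbr_queer.
by move=> /s qX /s qY; apply: mem_commutator.
Qed.

Lemma hpart_queer' i X : X \in queer' -> hpart i X \in queer'.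
Proof.
have hq j Y : Y \in queer -> hpart j Y \in queer by apply: hpart_queer.
suff /subvP s : (queer' <= linfun (hpart i) @^-1: queer')%VS.
  by move=> /s; rewrite -memv_preim lfunE.
apply: commutator_sub => Y Z qY qZ; rewrite -memv_preim lfunE /= hpart_sbr.
by apply: memvD; apply: mem_commutator; apply: hq.
Qed.

End Queer.

(* Main.v *)
(* Let E_ij and E'_ij denote the even and odd elementary elements of          *)
(* g = [q(n), q(n)]. For A even, zeta(A) = A^p - A^[p] commutes with the      *)
(* action of g.                                                               *)
(*                                                                            *)
(* Upper bound. On an irreducible module, possibly infinite-dimensional, the  *)
(* operators commuting with g are 0 or surjective; as the module is finitely  *)
(* generated over the zeta(E_ij), Noether normalization makes it finite-      *)
(* dimensional. By Jacobson's formula zeta(A) = tr(CA)^p for a matrix C,      *)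
(* which may be taken triangular, so that the positive root elements act      *)
(* nilpotently. Hence there is a highest weight vector, which can moreover be *)
(* chosen to be killed by a maximal isotropic space of odd diagonal elements, *)
(* and the ordered monomials in the remaining elements span the module.       *)
(*                                                                            *)
(* Lower bound. Oscillators on a Fock space yield a representation such that  *)
(* E_ij^p = 0 for i != j and E_ii^p - E_ii = c_i with c generic. For such a   *)
(* p-character, the product of the E_rj^(p-1) E'_rj with j < r is injective   *)
(* on the vectors killed by the positive root elements of the columns >= r,   *)
(* by reduction to q(2). So each row contributes a factor (2p)^r to the       *)
(* dimension of any submodule, and the odd diagonal elements act on highest   *)
(* weight vectors as a nondegenerate Clifford algebra.                        *)
(*                                                                            *)
(* Kac-Weisfeiler value. If theta is A |-> tr(CA), the even part of g^theta   *)
(* is the centralizer of C, of dimension at least n, and the odd part is      *)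
(* {B | tr B = 0, CB + BC scalar}; for C diagonal and generic the former is   *)
(* the diagonal matrices and the latter is 0.                                 *)

Require Import Defs.
From mathcomp Require Import all_boot all_order all_algebra.
From HB Require Import structures.
From mathcomp Require Import boolp zify ring.
From mathcomp Require mpoly.
Set Implicit Arguments.
Unset Strict Implicit.
Unset Printing Implicit Defensive.
Import GRing.Theory.
Local Open Scope ring_scope.

(** * Endomorphisms and subspaces *)

(** The maximal dimension is squeezed between two bounds. On an irreducible module the central
    operators [zeta] are scalars ([central_scalar]); as the module is not assumed
    finite-dimensional, this rests on [irreducible_finite]. By Jacobson's formula [zeta] is the p-th
    power of a linear form A |-> tr(AC) ([p_character]). Conjugating C into triangular form makes
    the positive root elements nilpotent, so that there is a highest weight vector
    ([highest_weight]). A PBW argument ([word_span]) bounds the dimension by the number of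
    restricted monomials in the negative root elements, with p exponents for an even one and 2 for
    an odd one, and in the odd diagonal elements outside a maximal isotropic space. For matrices of
    size n there are n(n-1)/2 negative roots of each parity and at most the ceiling of (n-1)/2 such
    diagonal elements, whence [upper_bound].

    The bound is attained at a generic diagonal p-character, which an oscillator representation
    realises ([fock_exists], [fock_is_rep], [generic_parameters]). There every nonzero submodule is
    at least as large as the bound ([lower_bound]): highest weight vectors carry a nondegenerate
    Clifford action ([level0_dim]), and the restricted monomials of each row of negative root
    elements act freely because their top monomial is injective ([block_prod_inj]), a fact reduced
    to rank one ([block_neq0]). A minimal submodule is therefore irreducible of exactly the required
    dimension ([irreducible_exists]).

    The Kac-Weisfeiler side is linear algebra. Centralizers of n by n matrices have dimension at
    least n ([centralizer_dim]), which bounds b_0 by n(n-1), while b_1 is at most n^2-1, the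
    dimension of the odd part ([kw_value_le]); a generic diagonal form attains both
    ([kw_value_generic]). Both maxima are then the same number. *)

Record endo (k : fieldType) (M : lmodType k) (nz : exists v : M, v != 0) :=
  Endo { efun :> M -> M; efun_linear : linear efun }.

Section EndoRing.
Context {k : fieldType} {M : lmodType k} {nz : exists v : M, v != 0}.
Local Notation E := (endo nz).
Implicit Types (x y z : E) (u v : M) (a b : k).

HB.instance Definition _ := gen_eqMixin E.
HB.instance Definition _ := gen_choiceMixin E.

Lemma endoP x y : (forall v, x v = y v) -> x = y.
Proof.
case: x y => [f lf] [g lg] /= /funext fg.
by subst g; rewrite (Prop_irrelevance lf lg).
Qed.

Lemma eD x u v : x (u + v) = x u + x v.
Proof. by have := efun_linear x 1 u v; rewrite !scale1r. Qed.
Lemma e0 x : x 0 = 0.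
Proof. by apply: (addrI (x 0)); rewrite -eD !addr0. Qed.
Lemma eZ x a v : x (a *: v) = a *: x v.
Proof. by have := efun_linear x a v 0; rewrite e0 !addr0. Qed.
Lemma eN x v : x (- v) = - x v.
Proof. by rewrite -scaleN1r eZ scaleN1r. Qed.
Lemma eB x u v : x (u - v) = x u - x v.
Proof. by rewrite eD eN. Qed.
Lemma esum x I (r : seq I) (P : pred I) (F : I -> M) :
  x (\sum_(i <- r | P i) F i) = \sum_(i <- r | P i) x (F i).
Proof. by apply: (big_morph x (eD x) (e0 x)). Qed.

Definition endo_zero : E.
Proof. by exists (fun=> 0) => a u v; rewrite scaler0 addr0. Defined.
Definition endo_one : E.
Proof. by exists id. Defined.
Definition endo_opp x : E.
Proof. by exists (fun v => - x v) => a u v; rewrite eD eZ opprD scalerN. Defined.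
Definition endo_add x y : E.
Proof.
by exists (fun v => x v + y v) => a u v; rewrite !eD !eZ scalerDr addrACA.
Defined.
Definition endo_mul x y : E.
Proof. by exists (fun v => x (y v)) => a u v; rewrite !eD !eZ. Defined.
Definition endo_scale a x : E.
Proof.
exists (fun v => a *: x v) => b u v.
by rewrite !eD !eZ scalerDr !scalerA mulrC.
Defined.

Fact endo_addA : associative endo_add.
Proof. by move=> x y z; apply: endoP => v /=; rewrite addrA. Qed.
Fact endo_addC : commutative endo_add.
Proof. by move=> x y; apply: endoP => v /=; rewrite addrC. Qed.
Fact endo_add0 : left_id endo_zero endo_add.
Proof. by move=> x; apply: endoP => v /=; rewrite add0r. Qed.
Fact endo_addN : left_inverse endo_zero endo_opp endo_add.
Proof. by move=> x; apply: endoP => v /=; rewrite addNr. Qed.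
HB.instance Definition _ :=
  GRing.isZmodule.Build E endo_addA endo_addC endo_add0 endo_addN.

Fact endo_mulA : associative endo_mul.
Proof. by move=> x y z; apply: endoP. Qed.
Fact endo_mul1 : left_id endo_one endo_mul.
Proof. by move=> x; apply: endoP. Qed.
Fact endo_1mul : right_id endo_one endo_mul.
Proof. by move=> x; apply: endoP. Qed.
Fact endo_mulDl : left_distributive endo_mul +%R.
Proof. by move=> x y z; apply: endoP. Qed.
Fact endo_mulDr : right_distributive endo_mul +%R.
Proof. by move=> x y z; apply: endoP => v /=; rewrite eD. Qed.
(** The witness [nz] carried by the type [endo] serves here: it makes the endomorphisms a nonzero
    ring, to which the results on characteristic p and on polynomial evaluation apply. *)
Fact endo_1neq0 : endo_one != 0.
Proof.
apply/eqP => e; case: nz => v /eqP; apply.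
by rewrite -[LHS]/(endo_one v) e.
Qed.
HB.instance Definition _ := GRing.Zmodule_isNzRing.Build E
  endo_mulA endo_mul1 endo_1mul endo_mulDl endo_mulDr endo_1neq0.

Fact endo_scaleA a b x : endo_scale a (endo_scale b x) = endo_scale (a * b) x.
Proof. by apply: endoP => v /=; rewrite scalerA. Qed.
Fact endo_scale1 : left_id 1 endo_scale.
Proof. by move=> x; apply: endoP => v /=; rewrite scale1r. Qed.
Fact endo_scaleDr : right_distributive endo_scale +%R.
Proof. by move=> a x y; apply: endoP => v /=; rewrite scalerDr. Qed.
Fact endo_scaleDl x : {morph endo_scale^~ x : a b / a + b}.
Proof. by move=> a b; apply: endoP => v /=; rewrite scalerDl. Qed.
HB.instance Definition _ := GRing.Zmodule_isLmodule.Build k E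
  endo_scaleA endo_scale1 endo_scaleDr endo_scaleDl.
Fact endo_scaleAl a x y : a *: (x * y) = a *: x * y.
Proof. by apply: endoP. Qed.
HB.instance Definition _ := GRing.Lmodule_isLalgebra.Build k E endo_scaleAl.
Fact endo_scaleAr a x y : a *: (x * y) = x * (a *: y).
Proof. by apply: endoP => v /=; rewrite [RHS]eZ. Qed.
HB.instance Definition _ := GRing.Lalgebra_isAlgebra.Build k E endo_scaleAr.

Lemma emulE x y v : (x * y) v = x (y v). Proof. by []. Qed.
Lemma eaddE x y v : (x + y) v = x v + y v. Proof. by []. Qed.
Lemma eoppE x v : (- x) v = - x v. Proof. by []. Qed.
Lemma escaleE a x v : (a *: x) v = a *: x v. Proof. by []. Qed.
Lemma e1E v : (1 : E) v = v. Proof. by []. Qed.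
Lemma e0E v : (0 : E) v = 0. Proof. by []. Qed.
Lemma esumE I (r : seq I) (P : pred I) (F : I -> E) v :
  (\sum_(i <- r | P i) F i) v = \sum_(i <- r | P i) F i v.
Proof. exact: (big_morph (fun x : E => x v) (fun x y => erefl) erefl). Qed.
Definition endoE := (emulE, eaddE, eoppE, escaleE, e1E, e0E).

Lemma endo_pchar p : p \in [pchar k] -> p \in [pchar E].
Proof.
case/andP=> pr /eqP p0; apply/andP; split=> //; apply/eqP/endoP => v.
by rewrite -[p%:R]scaler_nat p0 scale0r.
Qed.
End EndoRing.

Section Subspaces.
Context {k : fieldType} {M : lmodType k}.
Implicit Types (W : M -> Prop).

Definition subspace W := W 0 /\ forall a u v, W u -> W v -> W (a *: u + v).

Lemma subD W : subspace W -> forall u v, W u -> W v -> W (u + v).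
Proof. by case=> _ h u v hu hv; rewrite -[u]scale1r; apply: h. Qed.
Lemma subZ W : subspace W -> forall a u, W u -> W (a *: u).
Proof. by case=> h0 h a u hu; rewrite -[_ *: _]addr0; apply: h. Qed.
Lemma subN W : subspace W -> forall u, W u -> W (- u).
Proof. by move=> h u hu; rewrite -scaleN1r; apply: subZ. Qed.
Lemma subB W : subspace W -> forall u v, W u -> W v -> W (u - v).
Proof. by move=> h u v hu hv; apply: subD => //; apply: subN. Qed.
Lemma subsum W : subspace W -> forall I (r : seq I) (P : pred I) (F : I -> M),
  (forall i, P i -> W (F i)) -> W (\sum_(i <- r | P i) F i).
Proof. by move=> h I r P F hF; elim/big_ind: _ => //; [case: h | apply: subD]. Qed.

(** The impredicative form gives an induction principle on spans that needs neither coordinates nor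
    finite dimension of [M]. *)
Definition spanned (S : seq M) v :=
  forall W, subspace W -> (forall s, s \in S -> W s) -> W v.

Lemma spanned_sub S : subspace (spanned S).
Proof.
split=> [W [] //|a u v hu hv W sW hS].
by apply: sW.2; [apply: hu | apply: hv].
Qed.

Lemma spanned_mem (S : seq M) v : v \in S -> spanned S v.
Proof. by move=> hv W _; apply. Qed.

Lemma spannedP S v :
  spanned S v -> exists c : nat -> k, v = \sum_(i < size S) c i *: S`_i.
Proof.
move=> h; apply: (h (fun v => exists c : nat -> k, v = \sum_(i < size S) c i *: S`_i)); first split.
- by exists (fun=> 0); rewrite big1 // => i _; rewrite scale0r.
- move=> a u w [c ->] [d ->]; exists (fun i => a * c i + d i).
  rewrite scaler_sumr -big_split; apply: eq_bigr => i _ /=.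
  by rewrite scalerA scalerDl.
- move=> s sS; exists (fun i => (i == index s S)%:R).
  have lt : (index s S < size S)%N by rewrite index_mem.
  rewrite (bigD1 (Ordinal lt)) //= eqxx scale1r nth_index // big1 ?addr0 // => i.
  by rewrite -val_eqE /= => /negPf ->; rewrite scale0r.
Qed.

(** A spanning sequence of least length is a basis, and its coordinate map is the bijection that
    [has_dim] asks for. *)
Lemma has_dim_spanned (S : seq M) : (forall v, spanned S v) ->
  exists2 d, has_dim M d & (d <= size S)%N.
Proof.
move=> hS.
have ex : exists m, `[< exists2 T : seq M, size T = m & forall v, spanned T v >].
  by exists (size S); apply/asboolP; exists S.
case: (ex_minnP ex) => d /asboolP[T sT hT] dmin.
exists d; last by apply: dmin; apply/asboolP; exists S.
pose f (r : 'rV[k]_d) : M := \sum_(i < d) r 0 i *: T`_i.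
have flin : linear f.
  move=> a r s; rewrite /f scaler_sumr -big_split; apply: eq_bigr => i _.
  by rewrite !mxE scalerDl scalerA.
pose flm := GRing.isLinear.Build k 'rV[k]_d M _ f flin.
pose F : {linear 'rV[k]_d -> M} := HB.pack f flm.
exists F.
have finj : injective F.
  suff ker r : f r = 0 -> r = 0.
    move=> r s e; apply/eqP; rewrite -subr_eq0; apply/eqP/ker.
    by rewrite -[LHS]/(F (r - s)) linearB e subrr.
  move=> fr0; apply/rowP => j; rewrite mxE; apply/eqP; case: eqP => // /eqP rj.
  pose T' := [seq T`_i | i <- [seq i <- iota 0 d | i != val j]].
  have := dmin (size T'); rewrite leqNgt size_map.
  have -> : (size [seq i <- iota 0 d | i != val j] < d)%N.
    rewrite -[X in (_ < X)%N](size_iota 0) size_filter -(count_predC (fun i => i == val j)).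
    rewrite -[X in (X < _)%N]add0n ltn_add2r -has_count.
    by apply/hasP; exists (val j); rewrite ?mem_iota /=.
  apply; apply/asboolP; exists T'; rewrite ?size_map // => v W sW hW.
  have hi (i : 'I_d) : i != j -> W T`_i.
    move=> nij; apply: hW; apply/mapP; exists (val i) => //.
    by rewrite mem_filter mem_iota /= add0n ltn_ord andbT -[_ == _]/(i == j).
  apply: (hT v W sW) => t tT.
  have := tT; rewrite -index_mem sT => lt.
  have := nth_index 0 tT; rewrite -[index t T]/(val (Ordinal lt)) => <-.
  have [->|] := eqVneq (Ordinal lt) j; last exact: hi.
  move: fr0; rewrite /f (bigD1 j) //= => /eqP; rewrite addr_eq0 => /eqP e.
  rewrite -[T`_j]scale1r -(mulVf rj) -scalerA e; apply: subZ => //.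
  by apply: subN => //; apply: subsum => // i; move/hi; apply: subZ.
have fsurj v : exists r, F r = v.
  have [c ->] := spannedP (hT v); exists (\row_(i < d) c i).
  by rewrite /= /f sT; apply: eq_bigr => i _; rewrite mxE.
exists (fun v => projT1 (cid (fsurj v))) => [r|v].
  by apply: finj; case: cid.
by case: cid.
Qed.
End Subspaces.

(** * Modules finitely generated over commuting operators *)

Section CommutingFamilies.
(* Imported locally, its notations being incompatible with [in A]. *)
Import mpoly.

Context {k : fieldType} {M : lmodType k} {nz : exists v : M, v != 0}.
Local Notation E := (endo nz).

Section Evaluation.
Context {r : nat} (h : 'I_r -> E).
Hypothesis hC : forall i j, h i * h j = h j * h i.

(** The target ring is not commutative, so multiplicativity is not automatic; [mev_multiplicative]
    derives it from the commutation of the [h i]. *)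
Definition mev (F : {mpoly k[r]}) : E := mmap (in_alg E) h F.

Lemma mevE F : mev F = \sum_(m <- msupp F) F@_m *: mmap1 h m.
Proof. by rewrite /mev /mmap; apply: eq_bigr => m _ /=; rewrite mulr_algl. Qed.

Fact mev_additive : additive mev.
Proof. exact: mmap_is_additive. Qed.

Lemma mevD F G : mev (F + G) = mev F + mev G. Proof. exact: mmapD. Qed.
Lemma mev0 : mev 0 = 0. Proof. exact: mmap0. Qed.
Lemma mev1 : mev 1 = 1.
Proof. by rewrite /mev -mpolyC1 mmapC /= scale1r. Qed.
Lemma mevC a : mev a%:MP = a *: 1. Proof. by rewrite /mev mmapC. Qed.
Lemma mevZ a F : mev (a *: F) = a *: mev F.
Proof. by rewrite /mev mmapZ /= mulr_algl. Qed.

Lemma mmap1_commM m1 m2 : mmap1 h (m1 + m2) = mmap1 h m1 * mmap1 h m2.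
Proof.
rewrite /mmap1 -prodrM_comm; last by move=> i j _ _; apply/commrX/commr_sym/commrX.
by apply: eq_bigr => i _; rewrite mnmDE exprD.
Qed.

Fact mev_multiplicative : multiplicative mev.
Proof.
split=> [p q|]; last exact: mev1.
rewrite {1}(mpolyE p) {1}(mpolyE q) mulr_suml /mev.
rewrite [LHS](raddf_sum (mmap (in_alg E) h)) [in RHS]/mmap mulr_suml.
apply: eq_bigr => m _; rewrite mulr_sumr mulr_sumr.
rewrite [LHS](raddf_sum (mmap (in_alg E) h)); apply: eq_bigr => m' _ /=.
rewrite -scalerAl -scalerAr -mpolyXD !mmapZ mmapX mmap1_commM /=.
by rewrite !mulr_algl -scalerAl -scalerAr.
Qed.

HB.instance Definition _ :=
  GRing.isAdditive.Build {mpoly k[r]} E mev mev_additive.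

Lemma mevX i : mev 'X_i = h i.
Proof. by rewrite /mev mmapX mmap1U. Qed.

Lemma mev_comm (x : E) F : (forall i, h i * x = x * h i) -> mev F * x = x * mev F.
Proof.
move=> hx; rewrite mevE mulr_suml mulr_sumr; apply: eq_bigr => m _.
rewrite -scalerAl -scalerAr; congr (_ *: _).
by apply/commr_sym/commr_prod => i _; apply/commrX/commr_sym/hx.
Qed.

Lemma mev_stable (W : M -> Prop) F : subspace W ->
  (forall i v, W v -> W (h i v)) -> forall v, W v -> W (mev F v).
Proof.
move=> sW hW v Wv; rewrite mevE esumE; apply: subsum => // m _.
rewrite escaleE; apply: subZ => //; rewrite /mmap1.
elim/big_ind: _ v Wv => [//|x y hx hy v Wv|i _ v Wv]; first by apply/hx/hy.
by elim: (m i) v Wv => [//|e IH] v Wv; rewrite exprS; apply/hW/IH.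
Qed.
End Evaluation.

Definition generated {r : nat} (h : 'I_r -> E) (S : seq M) :=
  forall v (W : M -> Prop), subspace W -> (forall s, s \in S -> W s) ->
    (forall i u, W u -> W (h i u)) -> W v.

Lemma generatedP {r : nat} (h : 'I_r -> E)
    (hC : forall i j, h i * h j = h j * h i) S : generated h S ->
  forall v, exists g : nat -> {mpoly k[r]}, v = \sum_(i < size S) mev h (g i) S`_i.
Proof.
move=> gS v; apply: (gS v (fun v => exists g : nat -> {mpoly k[r]}, v = \sum_(i < size S) mev h (g i) S`_i)).
- split; first by exists (fun=> 0); rewrite big1 // => i _; rewrite mev0.
  move=> a u w [g ->] [g' ->]; exists (fun i => a *: g i + g' i).
  rewrite scaler_sumr -big_split; apply: eq_bigr => i _ /=.
  by rewrite mevD mevZ eaddE escaleE.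
- move=> s sS; exists (fun i => (i == index s S)%:R).
  have lt : (index s S < size S)%N by rewrite index_mem.
  rewrite (bigD1 (Ordinal lt)) //= eqxx mulr1n mev1 e1E.
  rewrite nth_index // big1 ?addr0 // => i.
  by rewrite -val_eqE /= => /negPf ->; rewrite mulr0n mev0.
- move=> i u [g ->]; exists (fun j => 'X_i * g j).
  rewrite esum; apply: eq_bigr => j _.
  by have [mM _] := mev_multiplicative hC; rewrite mM mevX.
Qed.

(** The determinant trick. Surjectivity writes each generator as h_0 applied to a combination of
    generators, so a matrix 1 - X_0 G kills the column of generators; by the adjugate its
    determinant kills them too, hence the whole module. *)
Lemma surjective_relation {r : nat} (h : 'I_r.+1 -> E)
    (hC : forall i j, h i * h j = h j * h i) S : generated h S ->
  (forall v, exists w, v = h ord0 w) -> exists2 F, F != 0 & mev h F = 0.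
Proof.
move=> gS surj.
have [mM m1] := mev_multiplicative hC.
have mB := mev_additive h.
have gen (j : 'I_(size S)) : exists g : nat -> {mpoly k[r.+1]},
    S`_j = h ord0 (\sum_(i < size S) mev h (g i) S`_i).
  have [w ->] := surj S`_j; have [g ->] := generatedP hC gS w; by exists g.
have [G hG] := choice gen.
pose A : 'M_(size S) := \matrix_(j, i) ((i == j)%:R - 'X_ord0 * G j i).
have hA j : \sum_i mev h (A j i) S`_i = 0.
  under eq_bigr => i _ do rewrite mxE mB eaddE eoppE mM mevX emulE.
  rewrite sumrB -esum -hG (bigD1 j) //= eqxx mulr1n m1 e1E big1 ?addr0 ?subrr // => i.
  by move=> /negPf ->; rewrite mulr0n mev0.
exists (\det A).
  (* At the origin the matrix becomes the identity, so the determinant has constant term 1. *)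
  apply/eqP => d0; have := congr1 (meval (fun=> 0 : k)) d0.
  rewrite -[LHS]det_map_mx raddf0.
  suff -> : map_mx (meval (fun=> 0)) A = 1%:M by rewrite det1 => /eqP; rewrite oner_eq0.
  apply/matrixP => j i; rewrite !mxE rmorphB rmorphM /= mevalXU mul0r subr0.
  by rewrite rmorph_nat eq_sym.
suff ker l : mev h (\det A) S`_l = 0.
  apply: endoP => v; rewrite e0E; apply: (gS v (fun v => mev h (\det A) v = 0)).
  - by split=> [|a u w hu hw]; rewrite ?e0 // eD eZ hu hw scaler0 addr0.
  - by move=> s /(nthP 0)[i lt <-]; apply: (ker i).
  - by move=> i u hu; rewrite -emulE (mev_comm (h := h)) // emulE hu e0.
have [lt|ge] := ltnP l (size S); last by rewrite nth_default ?e0.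
pose l' := Ordinal lt.
transitivity (\sum_i mev h ((\adj A *m A) l' i) S`_i).
  rewrite mul_adj_mx (bigD1 l') //= mxE eqxx mulr1n big1 ?addr0 // => i.
  by rewrite mxE eq_sym => /negPf ->; rewrite mulr0n mev0.
under eq_bigr => i _ do rewrite mxE raddf_sum esumE.
rewrite exchange_big big1 //= => j _.
under eq_bigr => i _ do rewrite mM emulE.
by rewrite -esum hA e0.
Qed.

Lemma digits_inj N r (a b : 'I_r -> nat) :
  (forall i, (a i < N)%N) -> (forall i, (b i < N)%N) ->
  (\sum_i a i * N ^ i = \sum_i b i * N ^ i)%N -> a =1 b.
Proof.
elim: r a b => [|r IH] a b ha hb; first by move=> _ [].
have E1 c : (\sum_(i < r.+1) c i * N ^ i =
    (\sum_(i < r) c (lift ord0 i) * N ^ i) * N + c ord0)%N.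
  rewrite big_ord_recl expn0 muln1 addnC; congr addn; rewrite big_distrl /=.
  by apply: eq_bigr => i _; rewrite expnS mulnCA mulnC.
rewrite !E1 => e.
have N0 : (0 < N)%N by apply: leq_ltn_trans (ha ord0).
have e0 : a ord0 = b ord0.
  by have := congr1 (modn^~ N) e; rewrite !modnMDl !modn_small.
have e1 : (fun i => a (lift ord0 i)) =1 (fun i => b (lift ord0 i)).
  apply: IH => // ; apply/eqP; rewrite -(eqn_pmul2r N0) -(eqn_add2r (a ord0)).
  by rewrite {2}e0; apply/eqP.
by move=> i; case: (unliftP ord0 i) => [j|] ->.
Qed.
(* Noether normalization: subtracting u^(N^i) from the other members of the  *)
(* family makes u integral over them.                                         *)
Lemma noether_relation {r : nat} (h : 'I_r.+1 -> E)
    (hC : forall i j, h i * h j = h j * h i) F : F != 0 -> mev h F = 0 ->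
  let u := h ord0 in
  exists (N e : nat) (q : nat -> {mpoly k[r]}),
    let t i := h (lift ord0 i) - u ^+ (N ^ i.+1) in
    u ^+ e = \sum_(j < e) mev t (q j) * u ^+ j.
Proof.
(* All exponents occurring in [F] are less than [msize F], so its monomials are told apart by the
   weights whose base [N] digits are the exponents. *)
move=> F0 hF u; pose N := msize F; exists N.
pose t i := h (lift ord0 i) - u ^+ (N ^ i.+1).
have uh i : u * h i = h i * u by apply: hC.
have ut i : t i * u = u * t i by rewrite /t mulrBl mulrBr uh -exprSr -exprS.
have tC i j : t i * t j = t j * t i.
  apply: commrB; first by apply/commr_sym/commrB; [apply: hC | apply/commrX/commr_sym/uh].
  exact/commrX/ut.
have [tmM tm1] := mev_multiplicative tC.
pose tm : {rmorphism {mpoly k[r]} -> E} := HB.pack (mev t)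
  (GRing.isAdditive.Build _ _ (mev t) (mev_additive t))
  (GRing.isMultiplicative.Build _ _ (mev t) (mev_multiplicative tC)).
have cfu : commr_rmorph tm u by move=> a; apply/commr_sym/mev_comm.
pose hm : {rmorphism {poly {mpoly k[r]}} -> E} := horner_morph cfu.
have hmX : hm 'X = u by apply: horner_morphX.
have hmC a : hm a%:P = mev t a by apply: horner_morphC.
pose cst : {rmorphism k -> {poly {mpoly k[r]}}} := polyC \o @mpolyC r k.
(* The polynomial in u whose value is [h j]. For [j = 0] it is ['X] itself, as [N ^ 0 = 1]. *)
pose psi (j : 'I_r.+1) : {poly {mpoly k[r]}} :=
  'X^(N ^ j) + (if unlift ord0 j is Some i then 'X_i else 0)%:P.
have N0 : (0 < N)%N by rewrite lt0n msize_poly_eq0.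
have psi_size j : size (psi j) = (N ^ j).+1.
  rewrite size_polyDl size_polyXn // ltnS.
  by apply: leq_trans (size_polyC_leq1 _) _; rewrite expn_gt0 N0.
have psi_monic j : psi j \is monic.
  rewrite monicE lead_coefDl ?lead_coefXn // size_polyXn ltnS.
  by apply: leq_trans (size_polyC_leq1 _) _; rewrite expn_gt0 N0.
have psi_ev j : hm (psi j) = h j.
  rewrite rmorphD rmorphXn hmX hmC.
  case: (unliftP ord0 j) => [i|] ->; last by rewrite mev0 addr0 expr1.
  by rewrite mevX /t addrC subrK.
pose wt (m : 'X_{1..r.+1}) := (\sum_i m i * N ^ i)%N.
pose X (m : 'X_{1..r.+1}) := \prod_i psi i ^+ m i.
have X_monic m : X m \is monic by apply: monic_prod => i _; apply: monic_exp.
have X_size m : size (X m) = (wt m).+1.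
  rewrite size_prod; last by move=> i _; rewrite monic_neq0 // monic_exp.
  rewrite (eq_bigr (fun i : 'I_r.+1 => (m i * N ^ i + 1)%N)); last first.
    move=> i _; have gt0 : (0 < size (psi i ^+ m i))%N.
      by rewrite lt0n size_poly_eq0 monic_neq0 // monic_exp.
    by rewrite -(prednK gt0) size_exp psi_size addn1 mulnC.
  by rewrite big_split /= sum1_card -addSn addnK.
have [m0 m0F wt_max] : exists2 m0, m0 \in msupp F &
    forall m, m \in msupp F -> (wt m <= wt m0)%N.
  have : exists m, m \in msupp F.
    by move: F0; rewrite -msupp_eq0; case: (msupp F) => // m s _; exists m; apply: mem_head.
  elim: (msupp F) => [[] //|m s IH _]; case: s => [|m' s] in IH *.
    by exists m => [|m1]; rewrite inE // => /eqP ->.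
  have [|m1 m1s hm1] := IH; first by exists m'; apply: mem_head.
  have [le|lt] := leqP (wt m) (wt m1).
    exists m1; first by rewrite inE m1s orbT.
    by move=> m2; rewrite inE => /predU1P[->|/hm1].
  exists m; first exact: mem_head.
  move=> m2; rewrite inE => /predU1P[->|/hm1 h2] //.
  exact: leq_trans h2 (ltnW lt).
have wt_inj m : m \in msupp F -> wt m = wt m0 -> m = m0.
  have small m1 : m1 \in msupp F -> forall i, (m1 i < N)%N.
    move=> m1F i; apply: leq_ltn_trans (msize_mdeg_lt m1F).
    by rewrite mdegE (bigD1 i) //= leq_addr.
  move=> mF e; apply/mnmP.
  by apply: (digits_inj (small _ mF) (small _ m0F)); apply: e.
pose c := F@_m0; have c0 : c != 0 by rewrite -mcoeff_msupp.
(* [F] divided by the coefficient of its heaviest monomial and rewritten as a polynomial in u. It is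
   monic because the other monomials have smaller weight, and this is the integral equation
   sought. *)
pose Q : {poly {mpoly k[r]}} :=
  X m0 + \sum_(m <- rem m0 (msupp F)) cst (c^-1 * F@_m) * X m.
have hQ : hm Q = 0.
  have -> : Q = cst c^-1 * \sum_(m <- msupp F) cst (F@_m) * X m.
    have cK : cst c^-1 * cst c = 1 by rewrite -rmorphM mulVf // rmorph1.
    rewrite (big_rem m0) // mulrDr mulrA cK mul1r mulr_sumr.
    by congr (_ + _); apply: eq_bigr => m _; rewrite rmorphM mulrA.
  rewrite rmorphM rmorph_sum.
  suff -> : \sum_(m <- msupp F) hm (cst F@_m * X m) = mev h F.
    by rewrite hF mulr0.
  rewrite mevE; apply: eq_bigr => m _; rewrite rmorphM rmorph_prod.
  rewrite hmC mevC -scalerAl mul1r.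
  by congr (_ *: _); apply: eq_bigr => i _; rewrite rmorphXn psi_ev.
have low : (size (\sum_(m <- rem m0 (msupp F)) cst (c^-1 * F@_m) * X m)%R <= wt m0)%N.
  apply: leq_trans (size_sum _ _ _) _; apply/bigmax_leqP_seq => m.
  rewrite (rem_filter _ (msupp_uniq F)) mem_filter => /andP[nm mF] _.
  apply: leq_trans (size_polyMleq _ _) _; rewrite X_size.
  apply: leq_trans (_ : (1 + (wt m).+1).-1 <= _)%N.
    by rewrite -!subn1 leq_sub2r // leq_add2r size_polyC_leq1.
  rewrite add1n /= ltn_neqAle wt_max // andbT; apply: contra nm => /eqP e.
  by rewrite /= (wt_inj m mF e).
have Q_size : size Q = (wt m0).+1 by rewrite size_polyDl X_size // ltnS.
have Q_lead : Q`_(wt m0) = 1.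
  have /monicP <- := X_monic m0; rewrite lead_coefE X_size /= coefD.
  by rewrite [X in _ + X]nth_default ?addr0.
exists (wt m0), (fun j => - Q`_j).
have : hm Q = \sum_(j < (wt m0).+1) mev t Q`_j * u ^+ j.
  rewrite -{1}[Q]coefK Q_size poly_def rmorph_sum; apply: eq_bigr => j _.
  by rewrite -mul_polyC rmorphM rmorphXn hmX hmC.
rewrite hQ big_ord_recr /= Q_lead tm1 mul1r => /eqP.
rewrite eq_sym addrC addr_eq0 => /eqP ->; rewrite -sumrN.
by apply: eq_bigr => j _; rewrite raddfN mulNr.
Qed.

(** Induction on the number of operators. If the first one is 0, it is dropped; otherwise it is
    surjective, hence satisfies a relation with the others, and Noether normalization makes it
    integral over one operator fewer. *)
Lemma generated_finite (C : E -> Prop) :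
  (forall x y, C x -> C y -> C (x - y)) -> (forall x y, C x -> C y -> C (x * y)) ->
  C 1 -> (forall x y, C x -> C y -> x * y = y * x) ->
  (forall x, C x -> x = 0 \/ forall v, exists w, v = x w) ->
  forall r (h : 'I_r -> E) S, (forall i, C (h i)) -> generated h S ->
  exists S' : seq M, forall v : M, spanned S' v.
Proof.
move=> CB CM C1 CC Cs; elim=> [|r IH] h S hC gS.
  by exists S => v W sW hS; apply: gS => // -[].
have hcom i j : h i * h j = h j * h i by apply: CC.
have CX x e : C x -> C (x ^+ e).
  by move=> Cx; elim: e => [|e IHe]; rewrite ?expr0 // exprS; apply: CM.
case: (Cs _ (hC ord0)) => [h0|surj].
  apply: (IH (fun i => h (lift ord0 i)) S) => // v W sW hS hW.
  apply: (gS) => // i u; case: (unliftP ord0 i) => [j|] -> Wu; first exact: hW.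
  by rewrite h0; case: sW.
have [F F0 hF] := surjective_relation hcom gS surj.
have [N [e [q he]]] := noether_relation hcom F0 hF.
set t := (fun i => _) in he.
pose u := h ord0.
have Ct i : C (t i) by apply: (CB _ _ (hC _)); apply: CX.
have tC i j : t i * t j = t j * t i by apply: CC; apply: Ct.
have tu i : t i * u = u * t i by apply: CC; [apply: Ct | apply: hC].
(* Integrality of degree [e] lets the powers of [u] below [e] replace all its powers, at the price
   of enlarging the generating set. *)
pose S' := [seq (u ^+ j) s | j <- iota 0 e, s <- S].
apply: (IH t S') => //.
move=> v W sW hS hW.
have mW a : forall x, W x -> W (mev t a x) by move=> x; apply: mev_stable.
have Wu s : s \in S -> forall j, W ((u ^+ j) s).
  move=> sS j; elim/ltn_ind: j => j IHj; have [lt|le] := ltnP j e.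
    by apply: hS; apply: allpairs_f => //; rewrite mem_iota.
  rewrite -(subnK le) exprD he mulr_sumr esumE; apply: subsum => // i _.
  rewrite mulrA -(mev_comm (h := t)); last by move=> l; apply/commrX/tu.
  rewrite -mulrA -exprD emulE; apply: mW; apply: IHj.
  by rewrite -[X in (_ < X)%N](subnK le) ltn_add2l.
suff : forall j, W ((u ^+ j) v) by move/(_ 0%N); rewrite expr0.
apply: (gS v (fun v => forall j, W ((u ^+ j) v))) => //.
  split=> [j|a x y hx hy j]; first by rewrite e0; case: sW.
  by rewrite eD eZ; apply: sW.2.
move=> i x hx j; rewrite -emulE.
have := unliftP ord0 i; case: unliftP => [l|] -> _; last by rewrite -exprSr.
have -> : h (lift ord0 l) = t l + u ^+ (N ^ l.+1) by rewrite subrK.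
rewrite mulrDr eaddE -exprD; apply: subD => //.
by rewrite (_ : u ^+ j * t l = t l * u ^+ j) ?emulE; [apply: hW | apply/commr_sym/commrX/tu].
Qed.
End CommutingFamilies.

(** * Ordered monomials *)

Section OrderedMonomials.
Context {k : fieldType} {M : lmodType k} {nz : exists v : M, v != 0}.
Local Notation E := (endo nz).
Context {L : eqType} (x : L -> E) (e : L -> nat).

(** The restricted PBW monomials: the order of [ls] is the order of the factors, and [e] bounds the
    exponents strictly. *)
Fixpoint monomials (ls : seq L) : seq (seq L) :=
  if ls is l :: ls' then [seq nseq a l ++ m | a <- iota 0 (e l), m <- monomials ls']
  else [:: [::]].

Lemma size_monomials ls : size (monomials ls) = (\prod_(l <- ls) e l)%N.
Proof.
elim: ls => [|l ls IH]; first by rewrite big_nil.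
by rewrite /= size_allpairs size_iota IH big_cons.
Qed.

Definition word (w : seq L) : E := \prod_(l <- w) x l.

Lemma word_cat a b : word (a ++ b) = word a * word b.
Proof. exact: big_cat. Qed.

(** Sorting by successive extraction, with repetitions kept; letters outside [ls] are dropped, which
    is why later statements assume [all [in ls] w]. *)
Fixpoint canon (ls w : seq L) : seq L :=
  if ls is l :: ls' then
    nseq (count_mem l w) l ++ canon ls' [seq y <- w | y != l]
  else [::].

Lemma size_canon ls w : all [in ls] w -> size (canon ls w) = size w.
Proof.
elim: ls w => [[]//|l ls IH] w /= sw.
rewrite size_cat size_nseq IH; last first.
  apply/allP => y; rewrite mem_filter => /andP[nl /(allP sw)].
  by rewrite inE (negPf nl).
by rewrite size_filter -(count_predC (pred1 l) w).
Qed.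

Lemma canon_cat ls1 ls2 w :
  canon (ls1 ++ ls2) w = canon ls1 w ++ canon ls2 [seq y <- w | y \notin ls1].
Proof.
elim: ls1 w => [|l ls IH] w /=; first by rewrite (@eq_filter _ _ predT) ?filter_predT.
rewrite IH -catA -filter_predI; congr (_ ++ (_ ++ canon _ _)).
by apply: eq_filter => y /=; rewrite inE negb_or andbC.
Qed.

Lemma mem_canon ls w : {subset canon ls w <= ls}.
Proof.
elim: ls w => [//|l ls IH] w y /=; rewrite mem_cat mem_nseq inE.
by case/orP => [/andP[_ ->]//|/IH ->]; rewrite orbT.
Qed.

Lemma canon_monomials ls w : (canon ls w \in monomials ls) \/
  exists a i b, i \in ls /\ canon ls w = a ++ nseq (e i) i ++ b.
Proof.
elim: ls w => [|l ls IH] w /=; first by left.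
have [lt|ge] := ltnP (count_mem l w) (e l); last first.
  right; exists [::], l; rewrite -(subnKC ge) nseqD -catA.
  by exists (nseq (count_mem l w - e l) l ++ canon ls [seq y <- w | y != l]); rewrite mem_head.
case: (IH [seq y <- w | y != l]) => [h|[a [i [b [il ->]]]]].
  by left; apply: allpairs_f => //; rewrite mem_iota.
by right; exists (nseq (count_mem l w) l ++ a), i, b; rewrite -catA inE il orbT.
Qed.

Context (zeta : L -> E) (v : M) (ls1 ls2 : seq L).
Let ls := ls1 ++ ls2.
Definition in_span (y : E) := spanned [seq x l | l <- ls] y.
Hypothesis swapP : forall i j, i \in ls -> j \in ls ->
  exists a : k, in_span (x i * x j - a *: (x j * x i)).
Hypothesis e_gt1 : forall i, i \in ls1 -> (1 < e i)%N.
Hypothesis powP : forall i, i \in ls1 -> in_span (x i ^+ e i - zeta i).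
Hypothesis zetaC : forall i l, i \in ls1 -> l \in ls -> zeta i * x l = x l * zeta i.
Hypothesis termP : forall i, i \in ls2 -> exists c, x i v = c *: v.

(** The spanning half of PBW, by induction on length: modulo shorter words, letters can be reordered
    up to scalars, and a full power of a letter of [ls1] can be replaced by [zeta], which moves to
    the front. Letters of [ls2] come last and are absorbed by [v]. *)
Lemma word_span (W : M -> Prop) : subspace W ->
  (forall i u, i \in ls1 -> W u -> W (zeta i u)) ->
  (forall m, m \in monomials ls1 -> W (word m v)) ->
  forall w, all [in ls] w -> W (word w v).
Proof.
move=> sW zW mW w; move: {2}(size w) (leqnn (size w)) => n.
elim: n w => [|n IH] w.
  rewrite leqn0 size_eq0 => /eqP -> _; case: (canon_monomials ls1 [::]) => [/mW|].
    by congr (W (word _ v)); elim: (ls1).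
  have -> : canon ls1 [::] = [::] by elim: (ls1).
  case=> a [i [b [il /(congr1 size)]]]; rewrite !size_cat size_nseq /=.
  by have := e_gt1 il; case: (e i) => // j; rewrite addSn addnS.
rewrite leq_eqVlt ltnS => /predU1P[sw aw|]; last exact: IH.
have wlen a b : (size a + size b <= n)%N -> all [in ls] a -> all [in ls] b ->
    W ((word a * word b) v).
  by move=> h ha hb; rewrite -word_cat; apply: IH; rewrite ?size_cat ?all_cat ?ha.
(* An operator in the span of the letters counts as one letter, so the induction hypothesis covers
   the word in which it replaces two or more. *)
have repl a y b : in_span y -> all [in ls] a -> all [in ls] b ->
    (size a + size b < n)%N -> W ((word a * y * word b) v).
  move=> hy sa sb hn; apply: (hy (fun y => W ((word a * y * word b) v))).
    split=> [|c y1 y2 h1 h2]; first by rewrite mulr0 mul0r; case: sW.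
    by rewrite mulrDr mulrDl -scalerAr -scalerAl eaddE escaleE; apply: sW.2.
  move=> _ /mapP[l lls ->].
  have -> : word a * x l * word b = word a * word (l :: b).
    by rewrite /word big_cons mulrA.
  by apply: wlen; rewrite /= ?addnS ?lls.
have swap a i j b : size (a ++ i :: j :: b) = n.+1 -> all [in ls] (a ++ i :: j :: b) ->
    W (word (a ++ j :: i :: b) v) -> W (word (a ++ i :: j :: b) v).
  rewrite size_cat /= !addnS => -[sz]; rewrite all_cat /= => /and4P[ha hi hj hb].
  have [c hc] := swapP hi hj; rewrite !word_cat /word !big_cons => hW.
  rewrite !mulrA -(mulrA (word a)) -[x i * x j](subrK (c *: (x j * x i))).
  rewrite mulrDr mulrDl eaddE; apply: subD => //; first by apply: repl; rewrite // -sz.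
  by rewrite -scalerAr -scalerAl escaleE; apply: subZ => //; rewrite -!mulrA.
have pass a i l c b : size (a ++ i :: nseq c l ++ b) = n.+1 ->
    all [in ls] (a ++ i :: nseq c l ++ b) ->
    W (word (a ++ nseq c l ++ i :: b) v) -> W (word (a ++ i :: nseq c l ++ b) v).
  elim: c a => [//|c IHc] a sz al hW /=; apply: swap => //.
  rewrite -cat_rcons; apply: IHc; last by rewrite cat_rcons.
    by rewrite cat_rcons -sz !size_cat /= !size_cat.
  by move: al; rewrite cat_rcons !all_cat /= !all_cat => /and4P[-> -> -> ->].
have pull a l u : size (a ++ u) = n.+1 -> all [in ls] (a ++ u) ->
    W (word (a ++ nseq (count_mem l u) l ++ [seq y <- u | y != l]) v) ->
    W (word (a ++ u) v).
  elim: u a => [//|i u IHu] a sz al /=; case: eqP => [eil|/eqP nil] hW.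
    by subst i; rewrite -cat_rcons; apply: IHu; rewrite cat_rcons.
  rewrite -cat_rcons; apply: IHu; rewrite cat_rcons //; apply: pass => //.
    rewrite -sz !size_cat /= size_cat size_nseq size_filter.
    by rewrite -(count_predC (pred1 l) u).
  move: al; rewrite !all_cat /= all_cat => /and3P[-> -> hu] /=.
  rewrite all_filter; apply/andP; split.
    apply/allP => y; rewrite mem_nseq -has_count has_pred1 => /andP[lu /eqP ->].
    exact: (allP hu).
  by apply/allP => y yu; apply/implyP => _; apply: (allP hu).
have sort s a u : size (a ++ u) = n.+1 -> all [in ls] (a ++ u) -> all [in s] u ->
    W (word (a ++ canon s u) v) -> W (word (a ++ u) v).
  elim: s a u => [|l s IHs] a u sz al; first by case: u sz al.
  move=> su /= hW; apply: (pull _ l) => //; rewrite catA; apply: IHs.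
  - rewrite -sz !size_cat size_nseq size_filter -addnA.
    by rewrite -(count_predC (pred1 l) u).
  - move: al; rewrite !all_cat => /andP[-> hu] /=; rewrite all_filter; apply/andP; split.
      apply/allP => y; rewrite mem_nseq -has_count has_pred1 => /andP[lu /eqP ->].
      exact: (allP hu).
    by apply/allP => y yu; apply/implyP => _; apply: (allP hu).
  - apply/allP => y; rewrite mem_filter => /andP[nl /(allP su)].
    by rewrite inE (negPf nl).
  - by rewrite -catA.
apply: (sort ls [::]) => //; have cs := size_canon aw.
have ca : all [in ls] (canon ls w) by apply/allP/mem_canon.
move: cs ca; rewrite sw cat0s canon_cat; set u := canon ls1 w.
(* Without letters of [ls2], the sorted word is a restricted monomial or contains a full power;
   otherwise its last letter acts on [v] by a scalar and disappears. *)
case/lastP: (canon ls2 _) (@mem_canon ls2 [seq y <- w | y \notin ls1]) => [_|c t].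
  rewrite cats0 => su au; have [/mW //|[a [i [b [il ui]]]]] := canon_monomials ls1 w.
  rewrite -/u in ui; move: su au; rewrite ui !size_cat size_nseq !all_cat => sz.
  case/and3P=> ha _ hb; rewrite !word_cat mulrA.
  have -> : word (nseq (e i) i) = x i ^+ e i.
    by rewrite /word big_nseq; elim: (e i) => [//|m IHm]; rewrite iterS IHm exprS.
  have lt : (size a + size b < n)%N.
    rewrite -ltnS -sz addnCA.
    by have := e_gt1 il; case: (e i) => [|[|m]] // _; rewrite !addSn !ltnS leq_addl.
  rewrite -[x i ^+ e i](subrK (zeta i)) mulrDr mulrDl eaddE; apply: subD => //.
    by apply: repl => //; apply: powP.
  have zw c : all [in ls] c -> zeta i * word c = word c * zeta i.
    rewrite /word; elim: c => [|l c IHc] /=; first by rewrite big_nil mulr1 mul1r.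
    by case/andP=> hl hc; rewrite !big_cons mulrA zetaC // -mulrA IHc // mulrA.
  by rewrite -zw // -mulrA emulE; apply: zW => //; apply: wlen => //; apply: ltnW.
move=> ht; have [|z hz] := termP (i := t); first by apply: ht; rewrite mem_rcons mem_head.
rewrite -rcons_cat size_rcons all_rcons -cats1 => -[sz] /andP[_ al].
rewrite word_cat emulE {2}/word big_seq1 hz eZ; apply: subZ => //.
by apply: IH => //; rewrite sz.
Qed.
End OrderedMonomials.

(** * Jacobson's formula *)

Lemma sum_ends (A : zmodType) (F : nat -> A) m : (0 < m)%N ->
  \sum_(i < m.+1) F i = F 0%N + \sum_(i < m.-1) F i.+1 + F m.
Proof. by case: m => // m _; rewrite big_ord_recr big_ord_recl. Qed.

Section Adjoint.
Context {A : nzRingType}.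
Implicit Types (x y : A).

Definition ad x y := x * y - y * x.

(** The binomial formula for the commuting operators of left and right multiplication by [x]. *)
Lemma ad_expand x y m : iter m (ad x) y =
  \sum_(i < m.+1) (-1) ^+ i * (x ^+ (m - i) * y * x ^+ i) *+ 'C(m, i).
Proof.
elim: m => [|m IH].
  by rewrite big_ord1 /= !expr0 !mul1r mulr1.
rewrite iterS IH /ad mulr_sumr mulr_suml.
have El : \sum_(i < m.+1) x * ((-1) ^+ i * (x ^+ (m - i) * y * x ^+ i) *+ 'C(m, i)) =
    x ^+ m.+1 * y + \sum_(i < m.+1)
      (-1) ^+ i.+1 * (x ^+ (m - i) * y * x ^+ i.+1) *+ 'C(m, i.+1).
  rewrite big_ord_recl /= expr0 !mul1r subn0 bin0 !mulr1 mulrA -exprS.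
  rewrite [in RHS]big_ord_recr /= bin_small // mulr0n addr0; congr (_ + _).
  apply: eq_bigr => i _; rewrite /bump /= add1n mulrnAr; congr (_ *+ _).
  rewrite mulrA (commrX i.+1 (commrN1 x) : x * _ = _) -[LHS]mulrA; congr (_ * _).
  by rewrite !mulrA -exprS subnSK.
rewrite El [RHS]big_ord_recl /= expr0 !mul1r subn0 bin0 mulr1 -addrA; congr (_ + _).
rewrite -sumrB; apply: eq_bigr => i _.
rewrite /bump /= add1n subSS binS mulrnDr; congr (_ + _).
rewrite mulrnAl -mulNrn; congr (_ *+ _).
by rewrite [in RHS]exprS mulN1r mulNr -!mulrA -exprSr.
Qed.

Context (p : nat) (hp : p \in [pchar A]) (p_odd : odd p).

(** The inner binomial coefficients vanish in characteristic p, and the last sign is -1 because p is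
    odd. *)
Lemma ad_pchar x y : iter p (ad x) y = ad (x ^+ p) y.
Proof.
have pr := pcharf_prime hp.
rewrite ad_expand.
rewrite (sum_ends (fun i => (-1) ^+ i * (x ^+ (p - i) * y * x ^+ i) *+ 'C(p, i))) ?prime_gt0 //.
rewrite big1 => [|i _].
  rewrite expr0 mul1r subn0 bin0 !mulr1 addr0.
  by rewrite binn subnn expr0 -signr_odd p_odd expr1 mulN1r mul1r.
rewrite -mulr_natr (bin_lt_pcharf_0 hp) ?mulr0 //=.
by rewrite -[X in (_ < X)%N](prednK (prime_gt0 pr)) ltnS.
Qed.

Lemma bin_pred_pchar i : (i < p)%N -> (-1) ^+ i *+ 'C(p.-1, i) = 1 :> A.
Proof.
have p0 := prime_gt0 (pcharf_prime hp).
elim: i => [|i IH] lt; first by rewrite bin0 expr0.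
have : 'C(p, i.+1)%:R = 0 :> A by apply: bin_lt_pcharf_0.
rewrite -{1}(prednK p0) binS natrD => /eqP; rewrite addr_eq0 => /eqP e.
by rewrite -mulr_natr e mulrN exprS mulN1r mulNr opprK mulr_natr IH // ltnW.
Qed.

Lemma ad_pred_pchar x y :
  iter p.-1 (ad x) y = \sum_(i < p) x ^+ (p.-1 - i) * y * x ^+ i.
Proof.
have p0 := prime_gt0 (pcharf_prime hp).
rewrite ad_expand prednK //; apply: eq_bigr => i _.
by rewrite -mulrnAl bin_pred_pchar // mul1r.
Qed.
End Adjoint.

Section Jacobson.
Context {A : nzRingType} (p : nat) (hp : p \in [pchar A]) (p_odd : odd p).

Lemma deriv_exp_sum (q : {poly A}) m :
  (q ^+ m)^`() = \sum_(i < m) q ^+ (m.-1 - i) * q^`() * q ^+ i.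
Proof.
elim: m => [|m IH]; first by rewrite expr0 big_ord0 derivC.
rewrite exprSr derivM IH big_ord_recl /= subn0 expr0 mulr1 addrC; congr (_ + _).
rewrite mulr_suml; apply: eq_bigr => i _.
by rewrite -mulrA -exprSr /bump add1n subnS predn_sub.
Qed.

Context (a b : A).
Let u : {poly A} := a%:P * 'X + b%:P.

Lemma ad_coef q i :
  (ad u q)`_i = ad b q`_i + (if i is j.+1 then ad a q`_j else 0).
Proof.
rewrite /ad /u mulrDl mulrDr !coefB !coefD -mulrA !coefCM mulrA !coefMX !coefMC coefXM.
case: i => [|i] /=; first by rewrite mulr0 !add0r addr0.
by rewrite opprD addrACA [RHS]addrC.
Qed.

Lemma coef_exp_linear m : [/\ (u ^+ m)`_0 = b ^+ m, (u ^+ m)`_m = a ^+ m &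
  forall i, (m < i)%N -> (u ^+ m)`_i = 0].
Proof.
have E q i : (u * q)`_i = (if i is j.+1 then a * q`_j else 0) + b * q`_i.
  by rewrite /u mulrDl coefD -mulrA !coefCM coefXM; case: i => [|i] //=; rewrite mulr0.
elim: m => [|m [IH0 IHm IHl]].
  by split=> [||i]; rewrite ?expr0 ?coef1 //; case: i.
split=> [||[//|i] lt]; rewrite exprS E ?IH0 ?IHm ?IHl ?mulr0 ?addr0 ?add0r -?exprS //.
exact: ltnW.
Qed.

(* Differentiating (a X + b)^p turns its coefficients into iterated brackets  *)
(* of a and b, which a morphism of Lie algebras preserves.                    *)
Lemma coef_exp_pchar i :
  (u ^+ p)`_i.+1 *+ i.+1 = (iter p.-1 (ad u) a%:P)`_i.
Proof.
have hP : p \in [pchar {poly A}] by apply: (rmorph_pchar (@polyC A)).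
rewrite -coef_deriv deriv_exp_sum ad_pred_pchar //.
suff -> : u^`() = a%:P by [].
by rewrite /u derivD derivC addr0 derivM derivC mul0r add0r derivX mulr1.
Qed.

Lemma jacobson_sum : (a + b) ^+ p = a ^+ p + b ^+ p + \sum_(i < p.-1) (u ^+ p)`_i.+1.
Proof.
have [h0 hm hl] := coef_exp_linear p; have p0 := prime_gt0 (pcharf_prime hp).
have -> : a + b = u.[1] by rewrite /u hornerD hornerMX !hornerC mulr1.
rewrite -horner_exp_comm; last by rewrite /comm_poly mulr1 mul1r.
rewrite (horner_coef_wide (n := p.+1)); last first.
  by apply/leq_sizeP => j; apply: hl.
under eq_bigr => i _ do rewrite expr1n mulr1.
by rewrite (sum_ends (fun i => (u ^+ p)`_i)) // h0 hm addrAC [b ^+ p + _]addrC.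
Qed.
End Jacobson.

(** The terms of (a + b)^p other than a^p and b^p are iterated brackets divided by integers prime to
    p, hence are preserved by [f]. So the defect of [f] with respect to p-th powers is additive. *)
Lemma jacobson_morph {A B : nzRingType} (p : nat) (f : {additive A -> B}) :
  p \in [pchar A] -> p \in [pchar B] -> odd p ->
  (forall x y, f (ad x y) = ad (f x) (f y)) ->
  forall a b, (f a + f b) ^+ p - f ((a + b) ^+ p) =
    (f a ^+ p - f (a ^+ p)) + (f b ^+ p - f (b ^+ p)).
Proof.
move=> pA pB p_odd fad a b.
rewrite (jacobson_sum pA) (jacobson_sum pB) [f (_ + _)]raddfD [f (_ + _)]raddfD raddf_sum.
set s := \sum_(i < _) _; set t := \sum_(i < _) _.
suff -> : s = t by rewrite opprD addrACA subrr addr0 opprD addrACA.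
apply: eq_bigr => i _.
have co : (f ((a%:P * 'X + b%:P) ^+ p)`_i.+1) *+ i.+1 =
    (((f a)%:P * 'X + (f b)%:P) ^+ p)`_i.+1 *+ i.+1.
  rewrite -raddfMn /= !coef_exp_pchar //.
  move: (nat_of_ord i) => j; elim: p.-1 j => [|m IH] {}i /=.
    by rewrite !coefC; case: eqP => _; rewrite ?raddf0.
  rewrite !ad_coef raddfD fad IH; congr (_ + _).
  by case: i => [|i]; rewrite ?raddf0 // fad IH.
apply/eqP; rewrite -subr_eq0; apply/eqP; set z := _ - _.
have zi : z *+ i.+1 = 0 by rewrite mulrnBl co subrr.
have ip : (i.+1 < p)%N.
  by rewrite -[X in (_ < X)%N](prednK (prime_gt0 (pcharf_prime pA))) ltnS.
(* Both [i.+1] and [p] kill [z]; as [B] is only a ring, a Bezout relation takes the place of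
   division. *)
have /coprimeP : coprime i.+1 p.
  by rewrite coprime_sym prime_coprime ?(pcharf_prime pA) // gtnNdvd.
case=> // -[l m] /= e; rewrite -[z]mulr1n -e mulrnBr; last first.
  by apply: ltnW; rewrite -subn_gt0 e.
by rewrite mulnC mulrnA zi mul0rn mulnC mulrnA (mulrn_pchar pB) mul0rn subrr.
Qed.

(** * Representations and highest weight vectors *)

Section CommonEigenvectors.
Context {k : closedFieldType} {M : lmodType k} {nz : exists v : M, v != 0}.
Local Notation E := (endo nz).
Implicit Types (u : E) (K : M -> Prop) (v : M).

Definition stable u K := forall v, K v -> K (u v).
Definition nontrivial K := exists2 v, K v & v != 0.

Lemma horner_algM u (q r : {poly k}) : horner_alg u (q * r) = horner_alg u q * horner_alg u r.
Proof. exact: rmorphM. Qed.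
Lemma horner_algB u (q r : {poly k}) : horner_alg u (q - r) = horner_alg u q - horner_alg u r.
Proof. exact: rmorphB. Qed.
Lemma horner_algXn u m : horner_alg u ('X^m : {poly k}) = u ^+ m.
Proof. by rewrite -[RHS](congr1 (fun x => x ^+ m) (horner_algX u)); apply: rmorphXn. Qed.

(** Applying the linear factors of [q] to a nonzero vector one at a time, the last nonzero vector
    reached is an eigenvector. *)
Lemma eigenvector_poly u (q : {poly k}) K : subspace K -> stable u K ->
  nontrivial K -> q != 0 -> (forall v, K v -> horner_alg u q v = 0) ->
  exists2 a, root q a & exists2 v, K v & v != 0 /\ u v = a *: v.
Proof.
move=> sK uK [v Kv v0] q0 hq.
have [s hs] := closed_field_poly_normal q.
have : horner_alg u (\prod_(z <- s) ('X - z%:P)) v = 0.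
  have := hq v Kv; rewrite hs -mul_polyC horner_algM.
  rewrite horner_algC emulE escaleE => /eqP.
  by rewrite scaler_eq0 lead_coef_eq0 (negPf q0) => /eqP.
have {q0 hq} : forall z, z \in s -> root q z.
  move=> z zs; rewrite hs rootZ ?lead_coef_eq0 // root_prod_XsubC.
  exact: zs.
elim: s v Kv v0 {hs} => [|a s IH] v Kv v0 hr.
  by rewrite big_nil -polyC1 horner_algC scale1r e1E => e; rewrite e eqxx in v0.
have [e _|ne] := eqVneq (u v) (a *: v).
  by exists a; [apply/hr/mem_head | exists v].
rewrite big_cons mulrC horner_algM horner_algB horner_algX horner_algC emulE => hv.
apply: (IH ((u - a *: 1) v)) => //.
- by rewrite eaddE eoppE escaleE; apply: subB => //; [apply: uK | apply: subZ].
- by rewrite eaddE eoppE escaleE subr_eq0.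
- by move=> z zs; apply: hr; rewrite inE zs orbT.
Qed.

(** A nilpotent operator has a nonzero kernel in [K], and this kernel is stable under the others
    since they commute with it up to a scalar; induction then applies to the kernel. *)
Lemma common_kernel (us : seq E) K : subspace K -> nontrivial K ->
  (forall u, u \in us -> stable u K) ->
  (forall u, u \in us -> exists m, forall v, K v -> (u ^+ m) v = 0) ->
  (forall u u', u \in us -> u' \in us -> exists a : k,
     forall v, K v -> u (u' v) = a *: u' (u v)) ->
  exists2 v, K v & v != 0 /\ forall u, u \in us -> u v = 0.
Proof.
elim: us K => [|u us IH] K sK nK st nil cm; first by case: nK => v; exists v.
have [m um] := nil u (mem_head _ _).
have [w Kw [w0 uw]] : exists2 v, K v & v != 0 /\ u v = 0.
  have [v Kv v0] := nK; have e := um v Kv; elim: m v Kv v0 e {um} => [|m IHm] v Kv v0 e.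
    by move: v0; rewrite -[v]e1E -(expr0 u) e eqxx.
  have [uv|uv] := eqVneq (u v) 0; first by exists v.
  by apply: (IHm (u v)) => //; [apply: st => //; apply: mem_head | rewrite -emulE -exprSr].
have [|||||v [Kv uv] [v0 hv]] := IH (fun v => K v /\ u v = 0).
- split; first by split; [case: sK | apply: e0].
  by move=> a x y [Kx ux] [Ky uy]; split; [apply: sK.2 | rewrite eD eZ ux uy scaler0 addr0].
- by exists w.
- move=> u' u's v [Kv uv]; split; first by apply: st => //; rewrite inE u's orbT.
  have [|a ->] // := cm u u' (mem_head _ _); first by rewrite inE u's orbT.
  by rewrite uv e0 scaler0.
- move=> u' u's; have [|m' hm'] := nil u'; first by rewrite inE u's orbT.
  by exists m' => v [Kv _]; apply: hm'.
- move=> u1 u2 h1 h2; have [||a ha] := cm u1 u2; rewrite ?inE ?h1 ?h2 ?orbT //.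
  by exists a => v [Kv _]; apply: ha.
by exists v => //; split=> // u'; rewrite inE => /predU1P[->|/hv].
Qed.

Lemma common_eigenvector (us : seq E) K : subspace K -> nontrivial K ->
  (forall u, u \in us -> stable u K) ->
  (forall u, u \in us -> exists2 q : {poly k}, q != 0 & horner_alg u q = 0) ->
  (forall u u', u \in us -> u' \in us -> forall v, K v -> u (u' v) = u' (u v)) ->
  exists2 v, K v & v != 0 /\ forall u, u \in us -> exists a, u v = a *: v.
Proof.
elim: us K => [|u us IH] K sK nK st al cm; first by case: nK => v; exists v.
have [q q0 hq] := al u (mem_head _ _).
have [|a _ [w Kw [w0 uw]]] := eigenvector_poly sK (st _ (mem_head _ _)) nK q0.
  by move=> v _; rewrite hq.
have [|||||v [Kv uv] [v0 hv]] := IH (fun v => K v /\ u v = a *: v).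
- split; first by split; [case: sK | rewrite e0 scaler0].
  move=> b x y [Kx ux] [Ky uy]; split; first exact: sK.2.
  by rewrite eD eZ ux uy scalerDr !scalerA mulrC.
- by exists w.
- move=> u' u's v [Kv uv]; split; first by apply: st => //; rewrite inE u's orbT.
  by rewrite cm ?mem_head ?inE ?u's ?orbT // uv eZ.
- by move=> u' u's; apply: al; rewrite inE u's orbT.
- by move=> u1 u2 h1 h2 v [Kv _]; apply: cm; rewrite ?inE ?h1 ?h2 ?orbT.
exists v => //; split=> // u'; rewrite inE => /predU1P[->|/hv //].
by exists a.
Qed.
End CommonEigenvectors.

(* Representations of [q(n), q(n)]: R false A and R true B are the actions of *)
(* the even element with blocks (A, 0) and of the odd element with blocks     *)
(* (0, B); R true B is only meaningful for B of trace 0.                      *)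
Section Representations.
Context {k : closedFieldType} {M : lmodType k} {nz : exists v : M, v != 0}.
Local Notation E := (endo nz).
Context {n : nat}.
Local Notation Mn := 'M[k]_n.+1.

Definition traceless (b : bool) (A : Mn) := b ==> (\tr A == 0).

(** The grading is encoded by an involution [P] instead of a decomposition: as 2 is invertible,
    graded subspaces are those stable under [P], which is treated as one more operator on an
    ungraded space. *)
Record is_rep (P : E) (R : bool -> Mn -> E) : Prop := {
  rep_linear : forall b, linear (R b);
  rep_bracket : forall b b' A B, traceless b A -> traceless b' B ->
    R b A * R b' B = (-1) ^+ (b && b') *: (R b' B * R b A) +
      R (b (+) b') (A *m B - (-1) ^+ (b && b') *: (B *m A));
  rep_parity : forall b A, traceless b A -> P * R b A = (-1) ^+ b *: (R b A * P);
  rep_involution : P * P = 1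
}.

Definition submodule (P : E) (R : bool -> Mn -> E) (W : M -> Prop) :=
  [/\ subspace W, stable P W & forall b A, traceless b A -> stable (R b A) W].

Section Rep.
Context (P : E) (R : bool -> Mn -> E) (rep : is_rep P R).
Context (p : nat) (hp : p \in [pchar k]) (hp2 : (2 < p)%N).

Lemma p_prime : prime p. Proof. exact: pcharf_prime hp. Qed.
Lemma p_odd : odd p.
Proof. by case: (even_prime p_prime) => // e; move: hp2; rewrite e. Qed.
Lemma two_neq0 : 2%:R != 0 :> k.
Proof. by rewrite -(dvdn_pcharf hp) gtnNdvd. Qed.

Lemma RD b A B : R b (A + B) = R b A + R b B.
Proof. by have := rep_linear rep b 1 A B; rewrite !scale1r. Qed.
Lemma R0 b : R b 0 = 0.
Proof. by apply: (addrI (R b 0)); rewrite -RD !addr0. Qed.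
Lemma RZ b a A : R b (a *: A) = a *: R b A.
Proof. by have := rep_linear rep b a A 0; rewrite R0 !addr0. Qed.
Lemma RN b A : R b (- A) = - R b A.
Proof. by rewrite -scaleN1r RZ scaleN1r. Qed.
Lemma RB b A B : R b (A - B) = R b A - R b B.
Proof. by rewrite RD RN. Qed.
Lemma Rsum b I (r : seq I) (Q : pred I) (F : I -> Mn) :
  R b (\sum_(i <- r | Q i) F i) = \sum_(i <- r | Q i) R b (F i).
Proof. by apply: (big_morph (R b) (RD b) (R0 b)). Qed.

Definition X b i j := R b (delta_mx i j).

Lemma traceless_delta b (i j : 'I_n.+1) : (b ==> (i != j)) ->
  traceless b (delta_mx i j).
Proof.
case: b => //= ij; apply/eqP; rewrite /mxtrace big1 // => l _.
by rewrite mxE; case: eqP => [->|//]; rewrite (negPf ij).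
Qed.

Lemma XX b b' (i j a c : 'I_n.+1) : b ==> (i != j) -> b' ==> (a != c) ->
  X b i j * X b' a c = (-1) ^+ (b && b') *: (X b' a c * X b i j)
   + (X (b (+) b') i c *+ (j == a)
      - (-1) ^+ (b && b') *: (X (b (+) b') a j *+ (c == i))).
Proof.
move=> h h'; rewrite /X (rep_bracket rep) ?traceless_delta // RB RZ.
by rewrite !mul_delta_mx_cond; do 2 case: eqP => _; rewrite ?R0.
Qed.

Lemma odd_sq i j : i != j -> X true i j * X true i j = 0.
Proof.
move=> ij; have := @XX true true i j i j ij ij.
rewrite eq_sym (negPf ij) !mulr0n scaler0 subr0 addr0 expr1 scaleN1r => /eqP.
rewrite -addr_eq0 -mulr2n -scaler_nat scaler_eq0 (negPf two_neq0) /=.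
by move/eqP.
Qed.

Definition hwv (mu : 'I_n.+1 -> k) (v : M) :=
  (forall b (i j : 'I_n.+1), (i < j)%N -> X b i j v = 0) /\ forall i, X false i i v = mu i *: v.

(** Engel's argument by decreasing height, followed by the diagonalization of the even diagonal
    elements, which are killed by the polynomials X^p - X - c_i. *)
Lemma highest_weight (c : 'I_n.+1 -> k) K :
  (forall i j : 'I_n.+1, (i < j)%N -> X false i j ^+ p = 0) ->
  (forall i, X false i i ^+ p = X false i i + c i *: 1) ->
  subspace K -> nontrivial K ->
  (forall b (i j : 'I_n.+1), (i < j)%N -> stable (X b i j) K) ->
  (forall i, stable (X false i i) K) ->
  exists mu v, [/\ v != 0, K v & hwv mu v].
Proof.
move=> nil tor sK nK stn stt.
(* The vectors killed by the root elements of height at least [t]. On [Kt s.+1] the root elements of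
   height at least [s] commute up to sign, since their brackets have height at least [s.+1]. *)
pose Kt t v := K v /\ forall b (i j : 'I_n.+1), (i < j)%N -> (i + t <= j)%N -> X b i j v = 0.
have sKt t : subspace (Kt t).
  split; first by split=> [|b i j _ _]; [case: sK | rewrite e0].
  move=> a u v [Ku hu] [Kv hv]; split; first exact: sK.2.
  by move=> b i j ij ijt; rewrite eD eZ hu // hv // scaler0 addr0.
have nzb (b : bool) (i j : 'I_n.+1) : (i < j)%N -> b ==> (i != j).
  by move=> ij; rewrite -val_eqE neq_ltn ij implybT.
have nKt t : nontrivial (Kt (n.+1 - t)%N).
  elim: t => [|t IH].
    case: nK => v Kv v0; exists v => //; split=> // b i j _.
    by rewrite subn0 leqNgt ltn_addl.
  have [le|lt] := leqP n.+1 t.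
    case: IH => v Kv v0; exists v => //; move: Kv.
    by rewrite (_ : n.+1 - t = n.+1 - t.+1)%N //; lia.
  set s := (n.+1 - t.+1)%N; have es : (n.+1 - t = s.+1)%N by rewrite /s; lia.
  rewrite es in IH.
  pose prs := [seq ij : 'I_n.+1 * 'I_n.+1 <- enum (predT : pred ('I_n.+1 * 'I_n.+1))
    | (ij.1 < ij.2)%N && (ij.1 + s <= ij.2)%N].
  pose us := [seq X b ij.1 ij.2 | b <- [:: false; true], ij <- prs].
  have usP u : u \in us -> exists b (i j : 'I_n.+1), [/\ (i < j)%N, (i + s <= j)%N & u = X b i j].
    case/allpairsP => -[b [i j]] /= [_]; rewrite mem_filter /= => /andP[/andP[ij ijs] _] ->.
    by exists b, i, j.
  have [|||v Kv [v0 hv]] := @common_kernel _ _ _ us (Kt s.+1) (sKt _) IH.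
  - move=> _ /usP[b [i [j [ij ijs ->]]]] v [Kv hv]; split; first exact: stn.
    move=> b' a d ad ads; rewrite -emulE XX ?nzb // !endoE hv // e0 scaler0 add0r.
    case: (d =P i) => [di|_]; case: (j =P a) => [ja|_];
      rewrite ?mulr1n ?mulr0n ?e0E ?hv ?scaler0 ?subr0 ?sub0r ?oppr0 //; subst; lia.
  - move=> _ /usP[b [i [j [ij ijs ->]]]]; case: b; last by exists p => v _; rewrite nil.
    by exists 2%N => v _; rewrite expr2 odd_sq // -val_eqE neq_ltn ij.
  - move=> _ _ /usP[b [i [j [ij ijs ->]]]] /usP[b' [a [d [ad ads ->]]]].
    exists ((-1) ^+ (b && b')) => v [Kv hv].
    rewrite -emulE XX ?nzb // !endoE -[RHS]addr0; congr (_ + _).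
    case: (d =P i) => [di|_]; case: (j =P a) => [ja|_];
      rewrite ?mulr1n ?mulr0n ?e0E ?hv ?scaler0 ?subr0 ?sub0r ?oppr0 ?addr0 //; subst; lia.
  exists v => //; split; first by case: Kv.
  move=> b i j ij ijs; apply: hv; apply/allpairsP; exists (b, (i, j)).
  by split=> //=; [case: b | rewrite mem_filter ij ijs mem_enum].
have := nKt n; rewrite subSnn => n1.
pose us := [seq X false i i | i <- enum 'I_n.+1].
have [|||v [Kv hv] [v0 hu]] := @common_eigenvector _ _ _ us (Kt 1%N) (sKt _) n1.
- move=> _ /mapP[l _ ->] v [Kv hv]; split; first exact: stt.
  move=> b i j ij ijs; rewrite -emulE XX ?(nzb b _ _ ij) // andbF !endoE hv // e0 scaler0 add0r.
  by rewrite addbF; case: (j =P l) => [jl|_]; case: (l =P i) => [li|_]; subst;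
    rewrite ?mulr1n ?mulr0n ?endoE ?e0E ?hv ?scaler0 ?subr0 ?sub0r ?oppr0.
- move=> _ /mapP[i _ ->]; exists ('X^p - 'X - (c i)%:P).
    rewrite -size_poly_gt0 -addrA size_polyDl ?size_polyXn //.
    by rewrite -opprD size_polyN size_XaddC ltnS ltnW.
  by rewrite !horner_algB horner_algXn horner_algX horner_algC tor [_ + _ *: 1]addrC addrK subrr.
- move=> _ _ /mapP[i _ ->] /mapP[j _ ->] v [Kv hv].
  rewrite -emulE XX // !endoE /= expr0 scale1r.
  by case: (eqVneq i j) => [->|ij];
    rewrite ?mulr1n ?mulr0n ?scale1r ?subrr ?e0E ?addr0 // eq_sym (negPf ij) mulr0n scaler0 subrr e0E addr0.
have hmu i : exists a, X false i i v = a *: v.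
  by apply: hu; apply/mapP; exists i; rewrite ?mem_enum.
have [mu hmu'] := choice hmu; exists mu, v; split=> //; split=> // b i j ij.
by apply: hv; rewrite // addn1.
Qed.
End Rep.
End Representations.

(** * Triangular matrices and isotropic subspaces *)

Section ClosedFieldMatrices.
Context {k : closedFieldType}.

Lemma eigenvalue_exists n (A : 'M[k]_n.+1) : exists a, eigenvalue A a.
Proof.
have /closed_rootP[a ra] : size (char_poly A) != 1 by rewrite size_char_poly.
by exists a; rewrite eigenvalue_root_char.
Qed.

(** An eigenvector is completed to a basis, then the lower right block is treated by induction; rows
    act on the right, hence the lower triangular form. *)
Lemma trigonalize n (A : 'M[k]_n) :
  exists2 g, g \in unitmx & is_trig_mx (g *m A *m invmx g).
Proof.
elim: n A => [|n IH] A.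
  by exists 1%:M; rewrite ?unitmx1 //; apply/is_trig_mxP => -[].
have [a /eigenvalueP[v va v0]] := eigenvalue_exists A.
(* As [v] has rank 1, the first row of this invertible matrix is proportional to [v]. *)
pose g := row_ebase v; have gu : g \in unitmx by apply: row_ebase_unit.
have [c c0 gv] : exists2 c, c != 0 & v = c *: row 0 g.
  have := mulmx_ebase v; rewrite -/g; set C := col_ebase v => e.
  have r1 : \rank v = 1%N by apply/eqP; rewrite eqn_leq rank_leq_row lt0n mxrank_eq0.
  have eC : v = C 0 0 *: row 0 g.
    rewrite -{1}e r1; apply/rowP => j; rewrite !mxE big_ord_recl /= big1 ?addr0.
      by rewrite !mxE big_ord1 !mxE eqxx /= mulr1.
    by move=> i _; rewrite !mxE big_ord1 !mxE /= mulr0 mul0r.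
  exists (C 0 0) => //; apply: contra v0 => /eqP C0.
  by rewrite eC C0 scale0r.
have row0 : row 0 (g *m A *m invmx g) = a *: row 0 1%:M.
  rewrite !row_mul; have -> : row 0 g = c^-1 *: v by rewrite gv scalerA mulVf // scale1r.
  rewrite -scalemxAl va -!scalemxAl scalerA mulrC -scalerA; congr (_ *: _).
  by rewrite gv -!scalemxAl scalerA mulVf // scale1r -row_mul mulmxV.
have ur0 (B : 'M[k]_(1 + n)) : row 0 B = a *: row 0 1%:M -> ursubmx B = 0.
  move=> rB; apply/rowP => j; have /rowP/(_ (rshift 1 j)) := rB.
  by rewrite !mxE -val_eqE /= mulr0 => <-; congr (B _ _); apply/val_inj.
set B : 'M_(1 + n) := g *m A *m invmx g in row0.
have [h hu ht] := IH (drsubmx B).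
pose H : 'M_(1 + n) := block_mx 1%:M 0 0 h.
have HK : H *m block_mx 1%:M 0 0 (invmx h) = 1%:M.
  by rewrite mulmx_block !mul0mx !mulmx0 !addr0 !add0r mulmxV // mulmx1 -scalar_mx_block.
have [Hu eH] := mulmx1_unit HK.
have iH : invmx H = block_mx 1%:M 0 0 (invmx h).
  by rewrite -[RHS](mulKmx Hu) HK mulmx1.
exists (H *m g); first by rewrite unitmx_mul Hu.
have -> : invmx (H *m g) = invmx g *m invmx H.
  have Hg : H *m g \in unitmx by rewrite unitmx_mul Hu.
  rewrite -[RHS](mulKmx Hg) -(mulmxA H) (mulmxA g) mulmxV // mul1mx mulmxV //.
  by rewrite mulmx1.
have -> : H *m g *m A *m (invmx g *m invmx H) = H *m (g *m A *m invmx g) *m invmx H.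
  by rewrite !mulmxA.
rewrite -[g *m A *m _]/B -[B](@submxK _ 1 n 1 n) iH (ur0 _ row0).
suff : is_trig_mx (H *m block_mx (ulsubmx B) 0 (dlsubmx B) (drsubmx B)
  *m block_mx 1%:M 0 0 (invmx h) : 'M_(1 + n)) by [].
rewrite /H !mulmx_block !mul0mx !mulmx0 !mul1mx !mulmx1 !addr0 !add0r.
apply/is_trig_mxP => i j ij; rewrite mxE; case: splitP => i' ei; rewrite mxE; case: splitP => j' ej.
- by move: ij; rewrite ei ej !ord1.
- by rewrite mul0mx mxE.
- by move: ij; rewrite ei ej !ord1.
- by have /is_trig_mxP := ht; apply; move: ij; rewrite ei ej ltn_add2l.
Qed.

Lemma upper_trigonalize n (A : 'M[k]_n) : exists2 g, g \in unitmx &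
  forall i j : 'I_n, (i < j)%N -> (invmx g *m A *m g) j i = 0.
Proof.
have [g gu gt] := trigonalize A^T; exists g^T; first by rewrite unitmx_tr.
move=> i j ij; have /is_trig_mxP/(_ i j ij) := gt.
suff -> : invmx g^T *m A *m g^T = (g *m A^T *m invmx g)^T by rewrite [X in _ -> X = _]mxE.
by rewrite !trmx_mul trmxK trmx_inv mulmxA.
Qed.

(** Unless [y] is already isotropic, the form at x + ty is a polynomial of degree 2 in t, which has
    a root. *)
Lemma isotropic_vector d (G : 'M[k]_d) (x y : 'rV[k]_d) : exists s t : k,
  [/\ (s != 0) || (t != 0) &
    (s *: x + t *: y) *m G *m (s *: x + t *: y)^T = 0].
Proof.
pose b (u w : 'rV[k]_d) : k := (u *m G *m w^T) 0 0.
have b0 u w : b u w = 0 -> u *m G *m w^T = 0.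
  by move=> e; apply/matrixP => i j; rewrite !ord1 [LHS]e mxE.
have [yy|yy] := eqVneq (b y y) 0.
  by exists 0, 1; rewrite oner_eq0 orbT scale0r scale1r add0r; split=> //; apply: b0.
pose q : {poly k} := (b y y)%:P * 'X^2 + (b x y + b y x)%:P * 'X + (b x x)%:P.
have /closed_rootP[t] : size q != 1.
  apply/eqP => sq; have : q`_2 = 0 by apply: (leq_sizeP _ 1%N); rewrite ?sq.
  rewrite !coefD !coefCM coefXn coefX coefC /= mulr1 mulr0 !addr0 => e.
  by rewrite e eqxx in yy.
rewrite rootE !hornerE => /eqP rt.
exists 1, t; rewrite oner_eq0; split=> //; apply: b0; rewrite scale1r.
have bD u w z : b (u + t *: w) z = b u z + t * b w z.
  by rewrite /b !mulmxDl -!scalemxAl !mxE.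
have bD' u w z : b z (u + t *: w) = b z u + t * b z w.
  rewrite /b (_ : (u + t *: w)^T = u^T + t *: w^T).
    by rewrite mulmxDr -scalemxAr !mxE.
  by apply/matrixP => i j; rewrite !mxE.
have {}rt : b y y * t * t + (b x y + b y x) * t + b x x = 0 by exact: rt.
by rewrite bD !bD' -[RHS]rt; ring.
Qed.

(** [us] is a basis of a maximal isotropic subspace, of dimension m with d at most 2m + 1, and [cs]
    a basis of a complement. The form may be degenerate. *)
Lemma isotropic_split d (G : 'M[k]_d) : G^T = G -> exists cs us : seq 'rV[k]_d,
  [/\ (size cs <= uphalf d)%N, forall x y, x \in us -> y \in us -> x *m G *m y^T = 0
    & forall x : 'rV[k]_d, spanned (cs ++ us) x].
Proof.
move=> Gsym.
pose Q m := `[< exists U : 'M[k]_(m, d), row_free U /\ U *m G *m U^T = 0 >].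
have Q0 : exists m, Q m.
  by exists 0%N; apply/asboolP; exists 0; split; [rewrite /row_free mxrank0 | apply/matrixP => -[]].
have Qle m : Q m -> (m <= d)%N.
  by move=> /asboolP[U [/eqP rU _]]; rewrite -rU rank_leq_col.
case: (ex_maxnP Q0 Qle) => m /asboolP[U [Ufree Uiso]] mmax.
have rU : \rank U = m by apply/eqP.
have dm : (d <= m.*2.+1)%N.
  rewrite leqNgt; apply/negP => lt.
  (* If d were at least 2m + 2, a complement [W] of [U] in its orthogonal would have dimension at
     least 2 and contain an isotropic vector, which would enlarge [U]. *)
  pose V := kermx (G *m U^T); pose W := (V :\: U)%MS.
  have rV : (d - m <= \rank V)%N.
    by rewrite mxrank_ker leq_sub2l // (leq_trans (rank_leq_col _)).
  have rW : (1 < \rank W)%N.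
    have := mxrank_cap_compl V U; rewrite -/W.
    have : (\rank (V :&: U)%MS <= m)%N by rewrite -[X in (_ <= X)%N]rU mxrankS // capmxSr.
    move: rV lt; lia.
  pose x i := row i (row_base W).
  pose i0 := Ordinal (ltnW rW); pose i1 := Ordinal rW.
  have [s [t [st iso]]] := isotropic_vector G (x i0) (x i1).
  set y := s *: x i0 + t *: x i1 in iso.
  have y0 : y != 0.
    apply/eqP => y0; pose c : 'rV_(\rank W) := s *: delta_mx 0 i0 + t *: delta_mx 0 i1.
    have cy : c *m row_base W = y by rewrite mulmxDl -!scalemxAl -!rowE.
    have c0 : c = 0.
      by apply: (row_free_inj (row_base_free W)); rewrite /= cy y0 mul0mx.
    have e0 := congr1 (fun z : 'rV_(\rank W) => z 0 i0) c0.
    have e1 := congr1 (fun z : 'rV_(\rank W) => z 0 i1) c0.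
    move: e0 e1 st; rewrite !mxE !eqxx /= !mulr1 !mulr0 addr0 add0r.
    by move=> -> ->; rewrite eqxx.
  have yW : (y <= W)%MS.
    by rewrite addmx_sub // scalemx_sub // -(eq_row_base W) row_sub.
  have yU : (y :&: U)%MS = 0.
    apply/eqP; rewrite -submx0 -(capmx_diff V U) sub_capmx.
    by rewrite (submx_trans (capmxSl _ _) yW) capmxSr.
  have yV : y *m G *m U^T = 0.
    apply/eqP; rewrite -mulmxA -/V; apply/eqP/sub_kermxP.
    exact: submx_trans yW (diffmxSl _ _).
  suff /mmax : Q m.+1 by rewrite ltnn.
  apply/asboolP.
  exists (col_mx y U); split.
    have e : \rank (col_mx y U) = \rank (y + U)%MS by rewrite addsmxE.
    rewrite /row_free e mxrank_disjoint_sum // rU.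
    suff -> : \rank y = 1%N by [].
    by apply/eqP; rewrite eqn_leq rank_leq_row lt0n mxrank_eq0.
  suff : (col_mx y U *m G *m (col_mx y U)^T : 'M_(1 + m)) = 0 by [].
  rewrite tr_col_mx mul_col_mx mul_col_row iso yV Uiso.
  have -> : U *m G *m y^T = 0.
    by apply: trmx_inj; rewrite !trmx_mul trmxK Gsym mulmxA yV trmx0.
  by rewrite block_mx0.
pose C := row_base (U^C)%MS.
have rC : \rank (U^C)%MS = (d - m)%N by rewrite mxrank_compl rU.
exists [seq row i C | i <- enum 'I_(\rank (U^C)%MS)], [seq row i U | i <- enum 'I_m].
split.
- by rewrite size_map size_enum_ord rC; move: dm; lia.
- move=> _ _ /mapP[i _ ->] /mapP[j _ ->].
  apply/matrixP => a b; rewrite !ord1 [RHS]mxE.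
  have := congr1 (fun Z : 'M_m => Z i j) Uiso; rewrite [RHS]mxE => <-.
  by rewrite -row_mul [LHS]mxE [RHS]mxE; apply: eq_bigr => l _; rewrite !mxE.
move=> x.
have /submxP[D ->] : (x <= col_mx C U)%MS.
  rewrite -(addsmxE C U); apply: submx_trans (submx1 x) _.
  apply: submx_trans (_ : (U + U^C <= _)%MS); first by rewrite sub1mx addsmx_compl_full.
  by rewrite addsmxC addsmxS // eq_row_base.
rewrite -[D]hsubmxK mul_row_col !mulmx_sum_row.
have sS := spanned_sub ([seq row i C | i <- enum 'I_(\rank (U^C)%MS)] ++ [seq row i U | i <- enum 'I_m]).
apply: (subD sS); apply: (subsum sS) => i _; apply: (subZ sS); apply: spanned_mem.
  by rewrite mem_cat; apply/orP; left; apply/mapP; exists i; rewrite ?mem_enum.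
by rewrite mem_cat; apply/orP; right; apply/mapP; exists i; rewrite ?mem_enum.
Qed.
End ClosedFieldMatrices.

(** * Irreducible representations *)

Section Letters.
Context {k : closedFieldType} {n : nat}.
Local Notation Mn := 'M[k]_n.+1.

Definition pairs (Q : 'I_n.+1 -> 'I_n.+1 -> bool) : seq ('I_n.+1 * 'I_n.+1) :=
  [seq ij <- enum (predT : pred ('I_n.+1 * 'I_n.+1)) | Q ij.1 ij.2].

Lemma mem_pairs Q i j : ((i, j) \in pairs Q) = Q i j.
Proof. by rewrite mem_filter mem_enum andbT. Qed.

Definition lower := pairs (fun i j => (j < i)%N).
Definition upper := pairs (fun i j => (i < j)%N).

Lemma size_lower : size lower = (n.+1 * n)./2.
Proof.
rewrite /lower /pairs size_filter -sum1_count big_enum_cond /=.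
rewrite -(pair_big_dep xpredT (fun i j : 'I_n.+1 => (j < i)%N) (fun _ _ => 1%N)) /=.
rewrite -[(n.+1 * n)%N]/(n.+1 * n.+1.-1)%N -bin2 -bin2_sum big_mkord.
apply: eq_bigr => i _; rewrite -(big_ord_widen _ (fun=> 1%N)) 1?ltnW //.
by rewrite sum1_card card_ord.
Qed.

(** Its rows form the basis e_(i+1) - e_0 of the diagonals of trace 0, so that [isotropic_split] can
    be applied to free coordinates. *)
Definition tdiag_mx : 'M[k]_(n, n.+1) :=
  \matrix_(i, j) ((j == lift ord0 i)%:R - (j == ord0)%:R).
Definition tdiag (x : 'rV[k]_n) : Mn := diag_mx (x *m tdiag_mx).

Definition root_letters (s : seq ('I_n.+1 * 'I_n.+1)) : seq (bool * Mn) :=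
  [seq (false, delta_mx ij.1 ij.2) | ij <- s] ++ [seq (true, delta_mx ij.1 ij.2) | ij <- s].
Definition diag_letters (s : seq 'rV[k]_n) : seq (bool * Mn) := [seq (true, tdiag x) | x <- s].

(** The letters that build the monomials; those of [pos_letters] are to act by scalars on the vector
    to which [upper_bound_borel] applies them. *)
Definition neg_letters cs := root_letters lower ++ diag_letters cs.
Definition pos_letters us :=
  root_letters upper ++ [seq (false, delta_mx i i) | i <- enum 'I_n.+1] ++ diag_letters us.

Lemma tdiag_mx_sum (x : 'rV[k]_n) : \sum_j (x *m tdiag_mx) 0 j = 0.
Proof.
under eq_bigr => j _ do rewrite mxE.
rewrite exchange_big big1 //= => i _; rewrite -mulr_sumr.
under eq_bigr => j _ do rewrite mxE.
rewrite sumrB (bigD1 (lift ord0 i)) //= eqxx big1 => [|j /negPf -> //].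
rewrite (bigD1 ord0) //= big1 => [|j /negPf -> //].
by rewrite !addr0 subrr mulr0.
Qed.
Lemma tr_tdiag x : \tr (tdiag x) = 0.
Proof. by rewrite mxtrace_diag tdiag_mx_sum. Qed.

Lemma tdiag_linear : linear tdiag.
Proof. by move=> a x y; rewrite /tdiag mulmxDl -scalemxAl linearP. Qed.

Lemma tdiagP (d : 'rV[k]_n.+1) : \sum_j d 0 j = 0 -> exists x, d = x *m tdiag_mx.
Proof.
rewrite big_ord_recl => d0; exists (\row_i d 0 (lift ord0 i)).
apply/rowP => j; rewrite mxE.
under eq_bigr => i _ do rewrite !mxE mulrBr.
rewrite sumrB; case: (unliftP ord0 j) => [j'|] ->.
  rewrite (bigD1 j') //= eqxx mulr1 big1 => [|i ni].
    rewrite big1 => [|i _]; first by rewrite addr0 subr0.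
    by rewrite mulr0.
  by rewrite (inj_eq lift_inj) eq_sym (negPf ni) mulr0.
rewrite big1 => [|i _]; last by rewrite (negPf (neq_lift _ _)) mulr0.
rewrite sub0r -[LHS](addrK (\sum_(i < n) d 0 (lift ord0 i))) d0 sub0r.
by congr (- _); apply: eq_bigr => i _; rewrite eqxx mulr1.
Qed.

Lemma letters_traceless cs us l :
  l \in neg_letters cs ++ pos_letters us -> traceless l.1 l.2.
Proof.
have hr s : (forall ij, ij \in s -> ij.1 != ij.2) -> l \in root_letters s -> traceless l.1 l.2.
  move=> hs; rewrite mem_cat => /orP[/mapP[ij _ ->]//|/mapP[ij /hs ne ->]].
  exact: traceless_delta.
have hd s : l \in diag_letters s -> traceless l.1 l.2.
  by case/mapP => x _ ->; rewrite /traceless /= tr_tdiag.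
rewrite !mem_cat => /orP[/orP[|/hd//]|/orP[|/orP[/mapP[i _ ->]//|/hd//]]]; rewrite -mem_cat.
  by apply: hr => -[i j]; rewrite mem_pairs -val_eqE neq_ltn orbC => ->.
by apply: hr => -[i j]; rewrite mem_pairs -val_eqE neq_ltn => ->.
Qed.

Context {M : lmodType k} {nz : exists v : M, v != 0}.
Local Notation E := (endo nz).
Context (P : E) (R : bool -> Mn -> E) (rep : is_rep P R).
Definition letter (l : bool * Mn) : E := R l.1 l.2.

Lemma letters_span cs us : (forall x : 'rV[k]_n, spanned (cs ++ us) x) ->
  forall b A, traceless b A ->
  spanned [seq letter l | l <- neg_letters cs ++ pos_letters us] (R b A).
Proof.
move=> hs b A tA; set S := map _ _; have sS := spanned_sub S.
have root c i j : i != j -> spanned S (R c (delta_mx i j)).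
  move=> ij; apply: spanned_mem; apply/mapP; exists (c, delta_mx i j) => //.
  have [lt|gt] : (i < j)%N \/ (j < i)%N by apply/orP; rewrite -neq_ltn.
    rewrite !mem_cat; apply/orP; right; apply/orP; left; apply/orP.
    by case: c; [right|left]; apply/mapP; exists (i, j); rewrite ?mem_pairs.
  rewrite !mem_cat; apply/orP; left; apply/orP; left; apply/orP.
  by case: c; [right|left]; apply/mapP; exists (i, j); rewrite ?mem_pairs.
have offd : spanned S (\sum_i \sum_(j | j != i) A i j *: R b (delta_mx i j)).
  by apply: (subsum sS) => i _; apply: (subsum sS) => j ij; apply: (subZ sS); apply: root; rewrite eq_sym.
have -> : R b A = R b (diag_mx (\row_i A i i)) +
    \sum_i \sum_(j | j != i) A i j *: R b (delta_mx i j).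
  have eA : A = diag_mx (\row_i A i i) + \sum_i \sum_(j | j != i) A i j *: delta_mx i j.
    rewrite {1}[A]matrix_sum_delta diag_mx_sum_delta -big_split; apply: eq_bigr => i _.
    by rewrite mxE (bigD1 i).
  rewrite {1}eA (RD rep) (Rsum rep); congr (_ + _); apply: eq_bigr => i _.
  by rewrite (Rsum rep); apply: eq_bigr => j _; rewrite (RZ rep).
apply: (subD sS) => //; case: b tA {offd} => /= tA.
  have [|x ->] := tdiagP (d := \row_i A i i).
    by apply/eqP; under eq_bigr => j _ do rewrite mxE.
  apply: (hs x (fun x => spanned S (R true (tdiag x)))).
    split; first by rewrite /tdiag mul0mx linear0 (R0 rep); case: sS.
    by move=> a y z hy hz; rewrite tdiag_linear (RD rep) (RZ rep); apply: sS.2.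
  move=> y ys; apply: spanned_mem; apply/mapP; exists (true, tdiag y) => //.
  move: ys; rewrite !mem_cat => /orP[h|h]; apply/orP; [left|right].
    by apply/orP; right; apply/mapP; exists y.
  by apply/orP; right; apply/orP; right; apply/mapP; exists y.
rewrite diag_mx_sum_delta (Rsum rep); apply: (subsum sS) => i _.
rewrite (RZ rep); apply: (subZ sS); apply: spanned_mem; apply/mapP; exists (false, delta_mx i i) => //.
rewrite !mem_cat; apply/orP; right; apply/orP; right; apply/orP; left.
by apply/mapP; exists i; rewrite ?mem_enum.
Qed.

Lemma bracket_letters cs us i j :
  (forall x : 'rV[k]_n, spanned (cs ++ us) x) ->
  i \in neg_letters cs ++ pos_letters us -> j \in neg_letters cs ++ pos_letters us ->
  exists a : k, spanned [seq letter l | l <- neg_letters cs ++ pos_letters us]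
    (letter i * letter j - a *: (letter j * letter i)).
Proof.
move=> hs /letters_traceless ti /letters_traceless tj.
exists ((-1) ^+ (i.1 && j.1)); rewrite /letter (rep_bracket rep) // addrAC subrr add0r.
apply: letters_span => //; rewrite /traceless; apply/implyP => /= ij.
have -> : i.1 && j.1 = false by case: (i.1) (j.1) ij => -[].
by rewrite expr0 scale1r linearB /= mxtrace_mulC subrr.
Qed.
End Letters.

Lemma delta_mx_exp (k : fieldType) n (i j : 'I_n.+1) m : (1 < m)%N ->
  (delta_mx i j : 'M[k]_n.+1) ^+ m = delta_mx i j *+ (i == j).
Proof.
case: m => [|[|m]] // _; have sq : (delta_mx i j : 'M[k]_n.+1) ^+ 2 = delta_mx i j *+ (i == j).
  by rewrite expr2 -[LHS]/(delta_mx i j *m delta_mx i j) mul_delta_mx_cond eq_sym.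
elim: m => [//|m IH]; rewrite exprS IH mulrnAr -expr2 sq -mulrnA.
by case: eqP.
Qed.

(** * Central operators and finite dimension of irreducible representations *)

Section Irreducible.
Context {k : closedFieldType} {M : lmodType k} {nz : exists v : M, v != 0}.
Local Notation E := (endo nz).
Context {n : nat}.
Local Notation Mn := 'M[k]_n.+1.
Context (p : nat) (hp : p \in [pchar k]) (hp2 : (2 < p)%N).

Definition irreducible_rep (P : E) (R : bool -> Mn -> E) := forall W,
  submodule P R W -> (forall v, W v -> v = 0) \/ forall v, W v.

Definition centralizes (P : E) (R : bool -> Mn -> E) (u : E) :=
  u * P = P * u /\ forall b A, traceless b A -> u * R b A = R b A * u.

Definition zeta (R : bool -> Mn -> E) A := R false A ^+ p - R false (A ^+ p).

Section Rep.
Context (P : E) (R : bool -> Mn -> E) (rep : is_rep P R).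

Lemma rep_ad b A B : traceless b B -> R b (ad A B) = ad (R false A) (R b B).
Proof.
move=> tB; rewrite /ad (rep_bracket rep) //= expr0 !scale1r addrAC subrr add0r.
by [].
Qed.

(** Both R(A)^p and R(A^p) have as adjoint action the p-th power of that of R(A): the first by
    [ad_pchar] among operators, the second by [ad_pchar] among matrices, transported by R. *)
Lemma zeta_central A : centralizes P R (zeta R A).
Proof.
have hE : p \in [pchar E] := endo_pchar hp; have hM : p \in [pchar Mn] by rewrite pchar_lalg.
split.
  have hP : P * R false A = R false A * P by rewrite (rep_parity rep) // expr0 scale1r.
  rewrite /zeta mulrBl mulrBr [P * R _ (A ^+ p)](rep_parity rep) // expr0 scale1r.
  by congr (_ - _); apply/commr_sym/commrX.
move=> b B tB; apply/eqP; rewrite -subr_eq0; apply/eqP.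
rewrite -[LHS]/(ad (zeta R A) (R b B)).
have -> : ad (zeta R A) (R b B) = ad (R false A ^+ p) (R b B) - ad (R false (A ^+ p)) (R b B).
  by rewrite /zeta /ad mulrBl mulrBr !opprB [LHS]addrACA [RHS]addrACA [- _ - _]addrC.
rewrite -rep_ad // -!(ad_pchar (p := p)) ?(p_odd hp hp2) //.
suff it m : R b (iter m (ad A) B) = iter m (ad (R false A)) (R b B) /\
    traceless b (iter m (ad A) B) by rewrite (it p).1 subrr.
elim: m => [//|m [IH1 IH2]] /=; rewrite rep_ad // IH1; split=> //.
apply/implyP => _; rewrite /ad linearB /=.
by rewrite -[_ * iter _ _ _]/(A *m iter m (ad A) B) mxtrace_mulC subrr.
Qed.

Lemma odd_square B : traceless true B -> R true B ^+ 2 = R false (B *m B).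
Proof.
move=> tB; have := rep_bracket rep tB tB.
rewrite expr1 !scaleN1r opprK -expr2 addrC => /eqP; rewrite -subr_eq opprK.
rewrite (RD rep) -!mulr2n -!scaler_nat => /eqP e.
by apply: (scalerI (two_neq0 hp hp2)).
Qed.

Lemma homogeneous K : subspace K -> stable P K -> nontrivial K ->
  exists2 v, K v & v != 0 /\ exists s, P v = s *: v.
Proof.
move=> sK PK [v Kv v0]; have PP w : P (P w) = w by rewrite -emulE (rep_involution rep).
have [e|ne] := eqVneq (v + P v) 0; last first.
  exists (v + P v); first by apply: (subD sK) => //; apply: PK.
  by split=> //; exists 1; rewrite eD PP scale1r addrC.
exists (v - P v); first by apply: (subB sK) => //; apply: PK.
split; last by exists (-1); rewrite eB PP scaleN1r opprB.
apply: contra v0 => /eqP e'; have : 2%:R *: v == 0.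
  have <- : (v + P v) + (v - P v) = 2%:R *: v.
    by rewrite addrACA subrr addr0 scaler_nat.
  by rewrite e e' addr0.
by rewrite scaler_eq0 (negPf (two_neq0 hp hp2)).
Qed.

(** The span of the words applied to [v] is a submodule; homogeneity of [v] is what makes it stable
    under [P]. *)
Lemma words_all (cs us : seq 'rV[k]_n) v :
  (forall x : 'rV[k]_n, spanned (cs ++ us) x) ->
  irreducible_rep P R -> v != 0 -> (exists s, P v = s *: v) ->
  let ls := neg_letters cs ++ pos_letters us in
  forall W : M -> Prop, subspace W ->
  (forall w, all [in ls] w -> W (word (letter R) w v)) -> forall u, W u.
Proof.
move=> hs irr v0 [s Pv] ls.
pose D u := forall W : M -> Prop, subspace W ->
  (forall w, all [in ls] w -> W (word (letter R) w v)) -> W u.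
have sub_pre (x : E) (W : M -> Prop) : subspace W -> subspace (fun u => W (x u)).
  move=> sW; split=> [|a y z hy hz]; first by rewrite e0; case: sW.
  by rewrite eD eZ; apply: sW.2.
have sD : subspace D.
  split=> [W [] //|a y z hy hz W sW hW].
  by apply: sW.2; [apply: hy|apply: hz].
have Dl l : l \in ls -> stable (letter R l) D.
  move=> lls u Du W sW hW; apply: (Du (fun u => W (letter R l u))); first exact: sub_pre.
  move=> w wls; have := hW (l :: w); rewrite /word big_cons emulE; apply.
  by rewrite /= lls.
suff [D0|DT] : (forall u, D u -> u = 0) \/ forall u, D u.
- have Dv : D v by move=> W _ /(_ [::]); rewrite /word big_nil e1E; apply.
  by rewrite (D0 _ Dv) eqxx in v0.
- by move=> W sW hW u; apply: DT.
apply: irr; split=> // [u Du W sW hW|b A tA u Du].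
  apply: (Du (fun u => W (P u))); first exact: sub_pre.
  move=> w wls; suff [c ->] : exists c : k, P (word (letter R) w v) = c *: word (letter R) w v.
    by apply: subZ => //; apply: hW.
  elim: w wls => [_|l w IH /= /andP[lls wls]].
    by rewrite /word big_nil e1E; exists s.
  have [c hc] := IH wls; exists ((-1) ^+ l.1 * c).
  rewrite /word big_cons emulE -emulE (rep_parity rep) ?(letters_traceless lls) //.
  by rewrite escaleE emulE hc eZ scalerA.
apply: (letters_span rep hs tA (W := fun y : E => D (y u))).
  split=> [|a y z hy hz]; first by case: sD.
  by rewrite eaddE escaleE; apply: sD.2.
by move=> _ /mapP[l lls ->]; apply: Dl.
Qed.

Context (irr : irreducible_rep P R).

(** The image of [u] is a submodule. This form of Schur's lemma needs no finite dimension and is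
    what [generated_finite] consumes. *)
Lemma schur u : centralizes P R u -> u = 0 \/ forall v, exists w, v = u w.
Proof.
case=> uP uR; have [|h|h] := irr (W := fun v => exists w, v = u w).
- split; first split.
  + by exists 0; rewrite e0.
  + by move=> a _ _ [y ->] [z ->]; exists (a *: y + z); rewrite eD eZ.
  + by move=> _ [y ->]; exists (P y); rewrite -emulE -uP.
  + by move=> b A tA _ [y ->]; exists (R b A y); rewrite -emulE -uR.
- by left; apply: endoP => v; apply: h; exists v.
- by right.
Qed.

Lemma schur_ker u v : centralizes P R u -> v != 0 -> u v = 0 -> u = 0.
Proof.
case=> uP uR v0 uv; have [|h|h] := irr (W := fun v => u v = 0).
- split; first split.
  + by rewrite e0.
  + by move=> a y z hy hz; rewrite eD eZ hy hz scaler0 addr0.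
  + by move=> y hy; rewrite -emulE uP emulE hy e0.
  + by move=> b A tA y hy; rewrite -emulE uR // emulE hy e0.
- by rewrite (h v uv) eqxx in v0.
- by apply: endoP => w; apply: h.
Qed.

(** By PBW the module is generated by finitely many monomials over the commuting operators [zeta],
    each of which is 0 or surjective by [schur]; so [generated_finite] applies. *)
Lemma irreducible_finite : exists S : seq M, forall v : M, spanned S v.
Proof.
(* Only a finite spanning family of diagonals is wanted here, hence the zero form. *)
have [cs [us [_ _ hs]]] := isotropic_split (trmx0 k n n).
set ls := neg_letters cs ++ pos_letters us.
have [v [_ [v0 Pv]]] : exists v, True /\ (v != 0 /\ exists s, P v = s *: v).
  have [|||v _ hv] := @homogeneous (fun=> True) => //; last by exists v.
  by case: nz => v v0; exists v.
(* The square of an odd letter is already the action of an even element ([odd_square]), so no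
   central correction occurs. *)
pose z (l : bool * Mn) : E := if l.1 then 0 else zeta R l.2.
have zC l : centralizes P R (z l).
  rewrite /z; case: l.1; last exact: zeta_central.
  by split=> *; rewrite mulr0 mul0r.
(* The center of the centralizer: it is commutative by construction and contains the operators
   [zeta]. *)
pose C x := centralizes P R x /\ forall y, centralizes P R y -> x * y = y * x.
have CC l : C (z l).
  split=> // y [yP yR]; rewrite /z; case: l.1; first by rewrite mulr0 mul0r.
  by rewrite /zeta mulrBl mulrBr yR // -[R _ _ ^+ p * y](commrX p (yR false l.2 isT)).
pose h (i : 'I_(size ls)) := z (tnth (in_tuple ls) i).
pose e (l : bool * Mn) := if l.1 then 2%N else p.
pose S := [seq word (letter R) m v | m <- monomials e ls].
apply: (@generated_finite _ _ _ C _ _ _ _ _ (size ls) h S).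
- move=> x y [[xP xR] xC] [[yP yR] yC]; split; first split.
  + by rewrite mulrBl mulrBr xP yP.
  + by move=> b A tA; rewrite mulrBl mulrBr xR // yR.
  + by move=> w wC; rewrite mulrBl mulrBr xC // yC.
- move=> x y [[xP xR] xC] [[yP yR] yC]; split; first split.
  + by rewrite -mulrA yP mulrA xP mulrA.
  + by move=> b A tA; rewrite -mulrA yR // mulrA xR // mulrA.
  + by move=> w wC; rewrite -mulrA yC // mulrA xC // mulrA.
- by split; [split|] => *; rewrite mulr1 mul1r.
- by move=> x y [_ xC] [yC _]; apply: xC.
- by move=> x [xC _]; apply: schur.
- by move=> i; apply: CC.
move=> u W sW SW hW; apply: (words_all hs irr v0 Pv sW) => w aw.
apply: (@word_span _ _ _ _ (letter R) e z v ls [::]) => //; rewrite ?cats0 //.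
- by move=> i j ils jls; rewrite /in_span cats0; apply: (bracket_letters rep hs).
- by move=> [[] A] _ //; apply: ltn_trans hp2.
- move=> [b A] ils; rewrite /in_span cats0 /letter /z /e /=.
  case: b ils => /letters_traceless tA.
    by rewrite subr0 /letter odd_square //; apply: (letters_span rep hs).
  by rewrite /zeta /letter /= opprB addrCA subrr addr0; apply: (letters_span rep hs).
- by move=> i l _ /letters_traceless tl; apply: (zC i).2.
- move=> i x ils Wx.
  have lt : (index i ls < size ls)%N by rewrite index_mem.
  have := hW (Ordinal lt) x Wx.
  by rewrite /h (tnth_nth i) /= nth_index.
- by move=> m hm; apply: SW; apply: map_f.
Qed.

(** In finite dimension [u] has an eigenvalue, and [u] minus this scalar, having a nonzero kernel,
    vanishes by [schur_ker]. *)
Lemma central_scalar u : centralizes P R u -> exists c : k, u = c *: (1 : E).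
Proof.
move=> uC; have [S hS] := irreducible_finite.
have [d [f [g fK gK]] _] := has_dim_spanned hS.
case: d f g fK gK => [|d] f g fK gK.
  have [v v0] := nz; exfalso; move: v0.
  by rewrite -(gK v) (thinmx0 (g v)) linear0 eqxx.
have glin : linear g.
  by move=> a x y; apply: (can_inj fK); rewrite gK linearP !gK.
pose G := \matrix_i g (u (f (delta_mx 0 i))) .
have hG r : g (u (f r)) = r *m G.
  rewrite mulmx_sum_row {1}[r]row_sum_delta.
  have g0 : g 0 = 0 by apply: (can_inj fK); rewrite gK linear0.
  rewrite linear_sum esum (big_morph g (id1 := 0) (op1 := +%R)) //; last first.
    by move=> x y; have := glin 1 x y; rewrite !scale1r.
  apply: eq_bigr => i _; rewrite linearZ eZ rowK.
  by have := glin (r 0 i) (u (f (delta_mx 0 i))) 0; rewrite g0 !addr0.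
have [a /eigenvalueP[r ra r0]] := eigenvalue_exists G.
exists a; apply/eqP; rewrite -subr_eq0; apply/eqP.
apply: (@schur_ker _ (f r)).
- case: uC => uP uR; split=> [|b A tA].
    by rewrite mulrBl mulrBr uP -scalerAl -scalerAr mulr1 mul1r.
  by rewrite mulrBl mulrBr uR // -scalerAl -scalerAr mulr1 mul1r.
- by apply: contra r0 => /eqP fr; rewrite -(fK r) fr; apply/eqP/(can_inj fK); rewrite gK linear0.
- by rewrite eaddE eoppE escaleE e1E -(gK (u _)) hG ra linearZ subrr.
Qed.
End Rep.
End Irreducible.

Definition irr_dim p n := (p ^ (n * (n - 1))./2 * 2 ^ uphalf (n ^ 2 - 1))%N.

(** The n^2 + 2n odd dimensions split into the odd root elements, n(n+1) in number and hence even,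
    and the n odd diagonal ones, which alone feel the rounding. *)
Lemma irr_dimE p n : irr_dim p n.+1 =
  (p ^ (n.+1 * n)./2 * 2 ^ (n.+1 * n)./2 * 2 ^ uphalf n)%N.
Proof.
rewrite /irr_dim subn1 /= -mulnA -expnD; congr (_ * 2 ^ _)%N.
have ev : ~~ odd (n.+1 * n) by rewrite oddM /=; case: odd.
have -> : (n.+1 ^ 2 - 1 = n.+1 * n + n)%N by rewrite expnS expn1 mulnS; lia.
have := odd_double_half (n.+1 * n); rewrite (negPf ev) add0n => {1}<-.
by rewrite uphalf_half; lia.
Qed.

Lemma mxtrace_delta_mul (k : fieldType) n (i j : 'I_n) (B : 'M[k]_n) :
  \tr (delta_mx i j *m B) = B j i.
Proof.
rewrite /mxtrace (bigD1 i) //= big1 => [|a ai].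
  rewrite addr0 mxE (bigD1 j) //= big1 => [|b bj]; first by rewrite mxE !eqxx mul1r addr0.
  by rewrite mxE (negPf bj) andbF mul0r.
by rewrite mxE big1 // => b _; rewrite mxE (negPf ai) mul0r.
Qed.

(** * Odd diagonal elements on highest weight vectors *)

Section DiagonalAction.
Context {k : closedFieldType} {M : lmodType k} {nz : exists v : M, v != 0}.
Local Notation E := (endo nz).
Context {n : nat}.
Local Notation Mn := 'M[k]_n.+1.
Context (P : E) (R : bool -> Mn -> E) (rep : is_rep P R).
Implicit Types d : 'rV[k]_n.+1.

Lemma bracket_delta_diag (i j : 'I_n.+1) d b :
  delta_mx i j *m diag_mx d - (-1) ^+ b *: (diag_mx d *m delta_mx i j) =
  (d 0 j - (-1) ^+ b * d 0 i) *: delta_mx i j :> Mn.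
Proof.
apply/matrixP => a c; rewrite mul_mx_diag mul_diag_mx !mxE.
by case: eqP => [->|_]; case: eqP => [->|_]; rewrite ?andbF ?mulr1 ?mulr0 ?mul0r ?mul1r ?mulr0 ?subr0.
Qed.

Lemma diag_stable mu d : traceless true (diag_mx d) -> stable (R true (diag_mx d)) (hwv R mu).
Proof.
move=> tx v [hn ht].
split=> [b i j ij|i].
  rewrite -emulE (rep_bracket rep) ?traceless_delta //; last by rewrite -val_eqE neq_ltn ij implybT.
  rewrite eaddE escaleE emulE -[R b (delta_mx _ _) v]/(X R b i j v) hn // e0 scaler0 add0r.
  by rewrite bracket_delta_diag (RZ rep) escaleE [R _ _ v]hn // scaler0.
rewrite -emulE (rep_bracket rep) // bracket_delta_diag expr0 scale1r mul1r subrr scale0r (R0 rep) addr0.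
by rewrite emulE -[R false (delta_mx _ _) v]/(X R false i i v) ht eZ.
Qed.

(** The Clifford relation for the symmetric form with diagonal coefficients mu_i: anticommutators of
    odd diagonal elements are even diagonal elements, which act by the weight. *)
Lemma diag_bracket mu d d' v : traceless true (diag_mx d) -> traceless true (diag_mx d') ->
  hwv R mu v ->
  R true (diag_mx d) (R true (diag_mx d') v) =
  - R true (diag_mx d') (R true (diag_mx d) v) + (2%:R * \sum_i mu i * d 0 i * d' 0 i) *: v.
Proof.
move=> td td' [hn ht].
rewrite -emulE (rep_bracket rep) // expr1 !scaleN1r opprK; congr (_ + _).
have -> : diag_mx d *m diag_mx d' + diag_mx d' *m diag_mx d =
    \sum_i (2%:R * (d 0 i * d' 0 i)) *: delta_mx i i.
  rewrite !mulmx_diag !diag_mx_sum_delta -big_split; apply: eq_bigr => i _.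
  by rewrite /= -scalerDl !mxE [X in _ + X]mulrC mulr_natl mulr2n.
rewrite (Rsum rep) esumE mulr_sumr scaler_suml; apply: eq_bigr => i _.
by rewrite (RZ rep) escaleE [R _ _ v]ht scalerA -!mulrA [mu i * _]mulrC !mulrA.
Qed.

Lemma hwv_subspace mu : subspace (hwv R mu).
Proof.
split; first by split=> *; rewrite e0 ?scaler0.
move=> a u w [hu1 hu2] [hw1 hw2]; split=> [b i j ij|i].
  by rewrite eD eZ hu1 // hw1 // scaler0 addr0.
by rewrite eD eZ hu2 hw2 scalerDr !scalerA mulrC.
Qed.

Lemma parity_kernel b A u : traceless b A -> R b A u = 0 -> R b A (P u) = 0.
Proof.
move=> tA e; have := congr1 (fun y : E => y u) (rep_parity rep tA).
rewrite escaleE !emulE e e0 => /esym/eqP.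
by rewrite scaler_eq0 signr_eq0 => /eqP.
Qed.

Lemma hwv_parity mu : stable P (hwv R mu).
Proof.
move=> u [hn ht]; split.
- move=> b i j ij; apply: parity_kernel; last exact: hn.
  by apply: traceless_delta; rewrite -val_eqE neq_ltn ij implybT.
- move=> i; have := rep_parity rep (b := false) (A := delta_mx i i) isT.
  rewrite expr0 scale1r => e.
  by rewrite /X -emulE -e emulE [R _ _ u]ht eZ.
Qed.
End DiagonalAction.

(** * The p-character and the upper bound *)

Section UpperBound.
Context {k : closedFieldType} {M : lmodType k} {nz : exists v : M, v != 0}.
Local Notation E := (endo nz).
Context {n : nat}.
Local Notation Mn := 'M[k]_n.+1.
Context (p : nat) (hp : p \in [pchar k]) (hp2 : (2 < p)%N).

Section Character.
Context (P : E) (R : bool -> Mn -> E) (rep : is_rep P R).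
Context (irr : irreducible_rep P R).

(** [zeta] is additive by [jacobson_morph] and satisfies zeta(aA) = a^p zeta(A). Taking p-th roots
    of the scalars [zeta (delta_mx i j)] therefore gives a linear form, represented through the
    trace pairing. *)
Lemma p_character :
  exists C : Mn, forall A, zeta p R A = (\tr (A *m C)) ^+ p *: (1 : E).
Proof.
have pE : p \in [pchar E] := endo_pchar hp.
have pM : p \in [pchar Mn] by rewrite pchar_lalg.
have Radd : additive (R false) by move=> A B; rewrite (RB rep).
pose f : {additive Mn -> E} := HB.pack (R false) (GRing.isAdditive.Build _ _ (R false) Radd).
have zD A B : zeta p R (A + B) = zeta p R A + zeta p R B.
  rewrite /zeta (RD rep).
  apply: (jacobson_morph (f := f) pM pE (p_odd hp hp2)) => x y.
  exact: (rep_ad rep).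
have zZ a A : zeta p R (a *: A) = a ^+ p *: zeta p R A.
  by rewrite /zeta (RZ rep) !exprZn (RZ rep) scalerBr.
have root_p (a : k) : exists b : k, a = b ^+ p.
  have /closed_rootP[b] : size ('X^p - a%:P) != 1.
    rewrite size_polyDl ?size_polyXn ?size_polyN.
      by rewrite eqSS -lt0n (ltn_trans _ hp2).
    by apply: leq_ltn_trans (size_polyC_leq1 _) _; rewrite ltnS (ltn_trans _ hp2).
  by rewrite rootE !hornerE subr_eq0 => /eqP <-; exists b.
have ex (ij : 'I_n.+1 * 'I_n.+1) :
    exists b : k, zeta p R (delta_mx ij.1 ij.2) = b ^+ p *: (1 : E).
  have [c ->] := central_scalar hp hp2 rep irr (zeta_central hp hp2 rep (delta_mx ij.1 ij.2)).
  by have [b ->] := root_p c; exists b.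
have [th hth] := choice ex; exists (\matrix_(j, i) th (i, j)) => A.
have z0 : zeta p R 0 = 0 by apply: (addrI (zeta p R 0)); rewrite -zD !addr0.
have pS I (r : seq I) (F : I -> k) : (\sum_(i <- r) F i) ^+ p = \sum_(i <- r) F i ^+ p.
  exact: (raddf_sum (pFrobenius_aut hp)).
rewrite {1}[A]matrix_sum_delta (big_morph (zeta p R) zD z0).
rewrite /mxtrace pS scaler_suml; apply: eq_bigr => i _.
rewrite (big_morph (zeta p R) zD z0) mxE pS scaler_suml; apply: eq_bigr => j _.
by rewrite zZ (hth (i, j)) scalerA mxE exprMn.
Qed.

Section Twist.
Context (g : Mn) (gu : g \in unitmx).
Definition twist b A := R b (g *m A *m invmx g).

Lemma tr_twist A : \tr (g *m A *m invmx g) = \tr A.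
Proof. by rewrite mxtrace_mulC mulmxA mulVmx // mul1mx. Qed.

Lemma traceless_twist b A : traceless b A -> traceless b (g *m A *m invmx g).
Proof. by rewrite /traceless tr_twist. Qed.

Lemma mul_twist A B :
  (g *m A *m invmx g) *m (g *m B *m invmx g) = g *m (A *m B) *m invmx g.
Proof. by rewrite !mulmxA mulmxKV. Qed.

Lemma twist_is_rep : is_rep P twist.
Proof.
split.
- move=> b a A B; rewrite /twist mulmxDr mulmxDl -scalemxAr -scalemxAl.
  by rewrite (RD rep) (RZ rep).
- move=> b b' A B tA tB; rewrite /twist (rep_bracket rep) ?traceless_twist //.
  congr (_ + R _ _).
  by rewrite !mul_twist mulmxBr mulmxBl -scalemxAr -scalemxAl.
- by move=> b A tA; apply: (rep_parity rep); apply: traceless_twist.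
- exact: (rep_involution rep).
Qed.

Lemma twist_irreducible : irreducible_rep P twist.
Proof.
move=> W [sW PW RW]; apply: irr; split=> // b A tA.
have -> : R b A = twist b (invmx g *m A *m g).
  by rewrite /twist !mulmxA mulmxV // mul1mx mulmxK.
apply: RW; move: tA; rewrite /traceless.
by rewrite mxtrace_mulC mulmxA mulmxV // mul1mx.
Qed.

Lemma zeta_twist A : zeta p twist A = zeta p R (g *m A *m invmx g).
Proof.
rewrite /zeta /twist; congr (_ - R _ _); elim: p => [|m IH].
  by rewrite !expr0 mulmx1 mulmxV.
by rewrite !exprS -IH -![_ * _]/(_ *m _) mul_twist.
Qed.
End Twist.

(** The Gram matrix, in the coordinates of [tdiag], of the Clifford form of [diag_bracket]. *)
Definition weight_form (mu : 'I_n.+1 -> k) : 'M[k]_n :=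
  tdiag_mx *m diag_mx (\row_i mu i) *m tdiag_mx^T.

Lemma tdiag_bracket mu (x y : 'rV[k]_n) v : hwv R mu v ->
  R true (tdiag x) (R true (tdiag y) v) =
  - R true (tdiag y) (R true (tdiag x) v) + (2%:R * (x *m weight_form mu *m y^T) 0 0) *: v.
Proof.
move=> hv; have tx (z : 'rV[k]_n) : traceless true (tdiag z) by rewrite /traceless /= tr_tdiag.
rewrite (diag_bracket rep (tx x) (tx y) hv) /weight_form.
have -> : x *m (tdiag_mx *m diag_mx (\row_i mu i) *m tdiag_mx^T) *m y^T =
    (x *m tdiag_mx) *m diag_mx (\row_i mu i) *m (y *m tdiag_mx)^T.
  by rewrite trmx_mul !mulmxA.
rewrite mul_mx_diag [in RHS]mxE; congr (_ + (_ * _) *: _); apply: eq_bigr => i _.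
rewrite [X in _ = X * _]mxE [X in _ = _ * X * _]mxE [X in _ = _ * X]mxE.
by rewrite [mu i * _]mulrC.
Qed.

(** The module is spanned by the restricted monomials in [neg_letters] applied to one homogeneous
    highest weight vector that is also killed by a maximal isotropic space of odd diagonal
    elements. *)
Lemma upper_bound_borel :
  (forall i j : 'I_n.+1, (i < j)%N -> zeta p R (delta_mx i j) = 0) ->
  exists2 d, has_dim M d & (d <= irr_dim p n.+1)%N.
Proof.
move=> z0.
have p1 : (1 < p)%N := ltn_trans (isT : (1 < 2)%N) hp2.
have zs A := central_scalar hp hp2 rep irr (zeta_central hp hp2 rep A).
have nil (i j : 'I_n.+1) : (i < j)%N -> X R false i j ^+ p = 0.
  move=> ij; have := z0 i j ij; rewrite /zeta delta_mx_exp //.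
  by rewrite -val_eqE /= ltn_eqF // (R0 rep) subr0.
have tor i : exists c : k, X R false i i ^+ p = X R false i i + c *: (1 : E).
  have [c hc] := zs (delta_mx i i); exists c.
  by rewrite -hc /zeta delta_mx_exp // eqxx mulr1n addrC subrK.
have [c hc] := choice tor.
have [||||mu [v [v0 _ vmu]]] := @highest_weight _ _ _ _ _ _ rep p hp hp2 c (fun=> True) nil hc.
- by split.
- by case: nz => v v0; exists v.
- by [].
- by [].
have shw := hwv_subspace R mu.
have Gsym : (weight_form mu)^T = weight_form mu.
  by rewrite /weight_form !trmx_mul trmxK tr_diag_mx mulmxA.
have [cs [us [scs iso hs]]] := isotropic_split Gsym.
pose ops := [seq R true (tdiag x) | x <- us].
have two := two_neq0 hp hp2.
have isoK x y w : x \in us -> y \in us -> hwv R mu w ->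
    R true (tdiag x) (R true (tdiag y) w) = - R true (tdiag y) (R true (tdiag x) w).
  by move=> hx hy hw; rewrite (tdiag_bracket _ _ hw) iso // mxE mulr0 scale0r addr0.
(* On highest weight vectors the isotropic elements anticommute and square to 0. *)
have [|||w hw [w0 wk]] := @common_kernel _ _ _ ops (hwv R mu) shw (ex_intro2 _ _ v vmu v0).
- by move=> _ /mapP[x _ ->]; apply: (diag_stable rep); rewrite /traceless /= tr_tdiag.
- move=> _ /mapP[x xs ->]; exists 2%N => u hu; rewrite expr2 emulE.
  have /eqP := isoK x x u xs xs hu; rewrite -addr_eq0 -mulr2n -scaler_nat.
  by rewrite scaler_eq0 (negPf two) => /eqP.
- move=> _ _ /mapP[x xs ->] /mapP[y ys ->]; exists (-1) => u hu.
  by rewrite scaleN1r isoK.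
(* This space is stable under the parity, so a homogeneous vector can be found in it, as [words_all]
   demands. *)
pose K u := hwv R mu u /\ forall x, x \in us -> R true (tdiag x) u = 0.
have sK : subspace K.
  split; first by split=> [|*]; [case: shw | rewrite e0].
  move=> a u y [hu1 hu2] [hy1 hy2]; split; first exact: shw.2.
  by move=> x xs; rewrite eD eZ hu2 // hy2 // scaler0 addr0.
have PK : stable P K.
  move=> u [hu ku]; split; first exact: (hwv_parity rep).
  by move=> x xs; apply: (parity_kernel rep); [rewrite /traceless /= tr_tdiag | apply: ku].
have [|u [hu ku] [u0 Pu]] := homogeneous hp hp2 rep sK PK.
  by exists w => //; split=> // x xs; apply: wk; apply: map_f.
pose e (l : bool * Mn) := if l.1 then 2%N else p.
pose z (l : bool * Mn) : E := if l.1 then 0 else zeta p R l.2.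
pose S := [seq word (letter R) m u | m <- monomials e (neg_letters cs)].
have hS : forall y, spanned S y.
  apply: (words_all rep hs irr u0 Pu (spanned_sub S)) => m am.
  apply: (@word_span _ _ _ _ (letter R) e z u (neg_letters cs) (pos_letters us)) => //.
  - by move=> i j il jl; apply: (bracket_letters rep hs).
  - by move=> [[] A] _.
  - move=> [b A] ils; have : (b, A) \in neg_letters cs ++ pos_letters us by rewrite mem_cat ils.
    move=> {ils} /letters_traceless; case: b => tA.
      by rewrite subr0 /letter (odd_square hp hp2 rep) //; apply: (letters_span rep hs).
    by rewrite /zeta /letter /= opprB addrCA subrr addr0; apply: (letters_span rep hs).
  - move=> i l _ /letters_traceless tl; rewrite /z; case: i.1; first by rewrite mulr0 mul0r.
    exact: (zeta_central hp hp2 rep i.2).2.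
  - move=> l; rewrite !mem_cat => /orP[/orP[]|/orP[]] /mapP[x]; rewrite ?mem_pairs.
    + by case: x => i j; rewrite mem_pairs => ij ->; exists 0; rewrite scale0r; apply: hu.1.
    + by case: x => i j; rewrite mem_pairs => ij ->; exists 0; rewrite scale0r; apply: hu.1.
    + by move=> _ ->; exists (mu x); apply: hu.2.
    + by move=> xs ->; exists 0; rewrite scale0r; apply: ku.
  - exact: spanned_sub.
  - move=> i y _; rewrite /z; case: i.1; first by move=> _; rewrite e0E; case: (spanned_sub S).
    have [a ->] := zs i.2; rewrite escaleE e1E; exact: (subZ (spanned_sub S)).
  - by move=> m' hm'; apply: spanned_mem; apply: map_f.
have [d hd le] := has_dim_spanned hS; exists d => //; apply: leq_trans le _.
rewrite size_map size_monomials irr_dimE /neg_letters /root_letters -catA !big_cat !big_map /=.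
rewrite !big_const_seq !count_predT !iter_muln_1 size_lower.
by rewrite mulnA leq_mul2l leq_exp2l // scs orbT.
Qed.
End Character.

(** Conjugation replaces C by an upper triangular matrix, whose pairing with E_ij is its (j, i)
    entry, zero for i < j. *)
Theorem upper_bound (P : E) (R : bool -> Mn -> E) : is_rep P R ->
  irreducible_rep P R -> exists2 d, has_dim M d & (d <= irr_dim p n.+1)%N.
Proof.
move=> rep irr; have [C hC] := p_character rep irr.
have [g gu hg] := upper_trigonalize C.
apply: (upper_bound_borel (twist_is_rep rep gu) (twist_irreducible irr gu)) => i j ij.
rewrite zeta_twist // hC -!mulmxA mxtrace_mulC -mulmxA mxtrace_delta_mul hg //.
by rewrite expr0n gtn_eqF ?scale0r // (ltn_trans _ hp2).
Qed.
End UpperBound.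

(** * Free families and Clifford operators *)

Lemma sum_pair (V : zmodType) (I J : finType) (F : I * J -> V) :
  \sum_p F p = \sum_i \sum_j F (i, j).
Proof. by rewrite pair_bigA; apply: eq_bigr => -[]. Qed.

Section Independence.
Context {k : closedFieldType} {M : lmodType k} {nz : exists v : M, v != 0}.
Local Notation E := (endo nz).

Definition free_family {J : finType} (b : J -> M) :=
  forall c : J -> k, \sum_j c j *: b j = 0 -> forall j, c j = 0.

Definition dim_ge (K : M -> Prop) (D : nat) := exists (J : finType) (b : J -> M),
  [/\ #|J| = D, forall j, K (b j) & free_family b].

Lemma dim_ge1 (K : M -> Prop) : nontrivial K -> dim_ge K 1.
Proof.
case=> v Kv v0; exists unit, (fun=> v); split=> // [|c]; first by rewrite card_unit.
rewrite (bigD1 tt) //= big1 ?addr0 => [/eqP|[]] //; rewrite scaler_eq0 (negPf v0) orbF.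
by move=> /eqP c0 [].
Qed.

Lemma dim_ge_sub (K K' : M -> Prop) D : (forall v, K v -> K' v) -> dim_ge K D -> dim_ge K' D.
Proof. by move=> h [J [b [cJ Kb fb]]]; exists J, b; split=> // j; apply: h. Qed.

Lemma has_dim_ge d D : has_dim M d -> dim_ge (fun=> True) D -> (D <= d)%N.
Proof.
case=> f [g fK gK] [J [b [cJ _ fb]]]; rewrite -cJ leqNgt; apply/negP => lt.
pose B : 'M_(#|J|, d) := \matrix_i g (b (enum_val i)).
have : row_free B.
  rewrite -kermx_eq0; apply/eqP/row_matrixP => i.
  rewrite row0; set r := row i _.
  have rB : r *m B = 0 by rewrite -row_mul mulmx_ker row0.
  have e : \sum_j r 0 (enum_rank j) *: b j = 0.
    rewrite (reindex (@enum_val J predT)) /=; last first.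
      by exists enum_rank => j _; rewrite ?enum_valK ?enum_rankK.
    transitivity (f (r *m B)); last by rewrite rB linear0.
    rewrite mulmx_sum_row linear_sum; apply: eq_bigr => j _.
    by rewrite linearZ rowK gK enum_valK.
  apply/rowP => j; rewrite [RHS]mxE.
  by have := fb (fun j => r 0 (enum_rank j)) e (enum_val j); rewrite /= enum_valK.
by rewrite /row_free => /eqP rB; have := rank_leq_col B; rewrite rB leqNgt lt.
Qed.

Definition quasi_commute (x y : E) := exists2 a : k, a != 0 & x * y = a *: (y * x).

Lemma quasi_commuteX x y m : quasi_commute x y -> quasi_commute x (y ^+ m).
Proof.
case=> a a0 e; exists (a ^+ m); first exact: expf_neq0.
elim: m => [|m IH]; first by rewrite !expr0 mulr1 mul1r scale1r.
rewrite !exprS mulrA e -scalerAl -[y * x * _]mulrA IH -scalerAr scalerA.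
by rewrite mulrA.
Qed.

Lemma quasi_commuteM x y z : quasi_commute x y -> quasi_commute x z -> quasi_commute x (y * z).
Proof.
case=> a a0 e [b b0 e']; exists (a * b); first exact: mulf_neq0.
by rewrite mulrA e -scalerAl -[y * x * z]mulrA e' -scalerAr scalerA mulrA.
Qed.

Lemma quasi_commute_sym x y : quasi_commute x y -> quasi_commute y x.
Proof.
case=> a a0 e; exists a^-1; first by rewrite invr_eq0.
by rewrite e scalerA mulVf // scale1r.
Qed.

(** In a relation whose coefficients at powers below a vanish, multiplication by f^(q-a) kills the
    powers above a and isolates the power a. *)
Lemma free_powers (S f : E) q {J : finType} (b : J -> M) :
  f ^+ q.+1 = 0 -> quasi_commute f S ->
  free_family (fun j => S ((f ^+ q) (b j))) ->
  free_family (fun aj : 'I_q.+1 * J => S ((f ^+ aj.1) (b aj.2))).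
Proof.
move=> fq fS fb c hc.
suff H a : forall (a' : 'I_q.+1) j, a' = a :> nat -> c (a', j) = 0.
  by case=> a j; apply: (H a).
elim/ltn_ind: a => a IH a' j ea; subst a.
have [z z0 ez] : quasi_commute (f ^+ (q - a')) S.
  by apply/quasi_commute_sym/quasi_commuteX/quasi_commute_sym.
apply: (fb (fun j => c (a', j))).
have := congr1 (fun x => (f ^+ (q - a')) x) hc; rewrite esum e0.
rewrite sum_pair /=.
rewrite (bigD1 a') //= [X in _ + X]big1 ?addr0 => [|x xa].
  have E1 y : (f ^+ (q - a')) (c (a', y) *: S ((f ^+ a') (b y))) =
      z *: (c (a', y) *: S ((f ^+ q) (b y))).
    rewrite eZ -!emulE ez -scalerAl -mulrA -exprD subnK; last by rewrite -ltnS.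
    by rewrite escaleE !scalerA mulrC.
  under eq_bigr => y _ do rewrite E1.
  by rewrite -scaler_sumr => /eqP; rewrite scaler_eq0 (negPf z0) => /eqP.
rewrite big1 // => y _; have [lt|le] := ltnP x a'.
  by rewrite (IH _ lt x) // scale0r e0.
have gt : (a' < x)%N by rewrite ltn_neqAle le andbT eq_sym.
rewrite eZ -!emulE ez -scalerAl -mulrA -exprD.
have -> : (q - a' + x = q.+1 + (x - a'.+1))%N.
  have := ltn_ord a'; have := ltn_ord x; lia.
by rewrite exprD fq mul0r mulr0 scaler0 e0E scaler0.
Qed.

Definition top (fs : seq (E * nat)) : E := \prod_(fq <- fs) fq.1 ^+ fq.2.

(** Freeness of the top monomial propagates to all restricted monomials, one factor at a time, by
    [free_powers]. *)
Lemma free_monomials (fs : seq (E * nat)) (J : finType) (b : J -> M) :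
  (forall x y, x \in fs -> y \in fs -> quasi_commute x.1 y.1) ->
  (forall x, x \in fs -> x.1 ^+ x.2.+1 = 0) ->
  free_family (fun j => top fs (b j)) ->
  forall K, (forall x, x \in fs -> stable x.1 K) -> (forall j, K (b j)) ->
  dim_ge K ((\prod_(fq <- fs) fq.2.+1) * #|J|)%N.
Proof.
elim: fs J b => [|[f q] fs IH] J b hc h0 hf K st Kb.
  exists J, b; rewrite big_nil mul1n; split=> // c e j.
  by apply: (hf c); rewrite /top big_nil.
have hcfs x : x \in fs -> x \in (f, q) :: fs by rewrite inE orbC => ->.
have fT : quasi_commute f (top fs).
  have : forall x, x \in fs -> quasi_commute f x.1.
    by move=> x /hcfs xs; apply: (hc (f, q) x) => //; apply: mem_head.
  elim: (fs) => [|x s IHs] hs; rewrite /top.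
    by rewrite big_nil; exists 1; rewrite ?oner_eq0 // mulr1 mul1r scale1r.
  rewrite big_cons; apply: quasi_commuteM.
    by apply/quasi_commuteX/hs/mem_head.
  by apply: IHs => y ys; apply: hs; rewrite inE ys orbT.
have [z z0 ez] : quasi_commute (f ^+ q) (top fs).
  by apply/quasi_commute_sym/quasi_commuteX/quasi_commute_sym.
have hf' : free_family (fun aj : 'I_q.+1 * J => top fs ((f ^+ aj.1) (b aj.2))).
  apply: free_powers => //; first by apply: (h0 (f, q)); apply: mem_head.
  move=> c e; apply: hf.
  have E1 j : c j *: top ((f, q) :: fs) (b j) = z *: (c j *: top fs ((f ^+ q) (b j))).
    have -> : top ((f, q) :: fs) = f ^+ q * top fs by rewrite /top big_cons.
    by rewrite ez escaleE emulE !scalerA mulrC.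
  by under eq_bigr => j _ do rewrite E1; rewrite -scaler_sumr e scaler0.
have st1 : stable f K by apply: (st (f, q)); apply: mem_head.
have KX a : stable (f ^+ a) K.
  by elim: a => [|a IHa] v Kv; rewrite ?expr0 // exprS; apply/st1/IHa.
have := IH _ _ (fun x y xs ys => hc x y (hcfs x xs) (hcfs y ys))
  (fun x xs => h0 x (hcfs x xs)) hf' K (fun x xs => st x (hcfs x xs)).
rewrite card_prod card_ord mulnA big_cons /= [(q.+1 * _)%N]mulnC; apply.
by case=> a j; apply: KX.
Qed.

(* For anticommuting c1 and c2, the involution-like operator c1 c2 splits K  *)
(* into two eigenspaces exchanged by c1.                                      *)
Lemma clifford_dim (cs : seq E) m K : size cs = m.*2 -> subspace K -> nontrivial K ->
  (forall c, c \in cs -> stable c K) ->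
  (forall c, c \in cs -> exists2 s : k, s != 0 & forall v, K v -> c (c v) = s *: v) ->
  pairwise (fun c d : E => `[< forall v, K v -> c (d v) = - d (c v) >]) cs ->
  (2%:R != 0 :> k) -> dim_ge K (2 ^ m).
Proof.
move=> + + + + + + two.
elim: m cs K => [|m IH] [|c1 [|c2 cs]] // K sz sK nK st sq ac; first exact: dim_ge1.
case: sz => sz; move: ac => /= /andP[/andP[/asboolP c12 /allP c1s] /andP[/allP c2s ac]].
have [|s1 s10 hs1] := sq c1; first exact: mem_head.
have [|s2 s20 hs2] := sq c2; first by rewrite !inE eqxx orbT.
have k1 : stable c1 K by apply: st; apply: mem_head.
have k2 : stable c2 K by apply: st; rewrite !inE eqxx orbT.
have kj : stable (c1 * c2) K by move=> v Kv; apply/k1/k2.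
have c21 v : K v -> c2 (c1 v) = - c1 (c2 v) by move=> Kv; rewrite c12 // opprK.
have JJ v : K v -> c1 (c2 (c1 (c2 v))) = - (s1 * s2) *: v.
  move=> Kv; rewrite c21 ?hs2 //; last exact: k2.
  by rewrite eN !eZ hs1 // scalerA scaleNr mulrC.
(* The square of c1 c2 is -s1 s2 on K, so its eigenvalues are [t] and [- t], distinct as 2 is
   invertible. *)
have [t ht] : exists t, t ^+ 2 = - (s1 * s2).
  have /closed_rootP[t] : size ('X^2 - (- (s1 * s2))%:P) != 1.
    by rewrite size_XnsubC.
  by rewrite rootE !hornerE subr_eq0 => /eqP; exists t.
have t0 : t != 0 by rewrite -sqrf_eq0 ht oppr_eq0 mulf_neq0.
pose Kp v := K v /\ c1 (c2 v) = t *: v.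
have sKp : subspace Kp.
  split; first by split; [case: sK | rewrite !e0 scaler0].
  move=> a u v [Ku hu] [Kv hv]; split; first exact: sK.2.
  by rewrite !eD !eZ hu hv scalerDr !scalerA mulrC.
have nKp : nontrivial Kp.
  case: nK => v Kv v0; have Kw := kj _ Kv.
  have [e|ne] := eqVneq (c1 (c2 v) + t *: v) 0; last first.
    exists (c1 (c2 v) + t *: v) => //; split; first by apply: (subD sK) => //; apply: (subZ sK).
    by rewrite !eD !eZ JJ // -ht scalerDr scalerA -expr2 addrC.
  exists (c1 v); last first.
    apply: contra v0 => /eqP e'; have := hs1 v Kv; rewrite e' e0 => /esym/eqP.
    by rewrite scaler_eq0 (negPf s10).
  split; first exact: k1.
  rewrite c21 // eN; move/eqP: e; rewrite addr_eq0 => /eqP ->.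
  by rewrite !eN eZ opprK.
have stp c : c \in cs -> stable c Kp.
  move=> ccs v [Kv hv]; have Kc : stable c K by apply: st; rewrite !inE ccs !orbT.
  have /asboolP e1 := c1s c ccs; have /asboolP e2 := c2s c ccs.
  by split; [apply: Kc | rewrite e2 // eN e1 ?opprK ?hv ?eZ //; apply: k2].
have ac' : pairwise (fun c d : E => `[< forall v, Kp v -> c (d v) = - d (c v) >]) cs.
  by apply: sub_pairwise ac => c d /asboolP h; apply/asboolP => v [Kv _]; apply: h.
have [||J [b [cJ Kb fb]]] := IH cs Kp _ sKp nKp stp _ ac'.
- exact: sz.
- move=> c ccs; have [|s s0 hs] := sq c; first by rewrite !inE ccs !orbT.
  by exists s => // v [Kv _]; apply: hs.
exists (bool * J)%type, (fun ej => if ej.1 then c1 (b ej.2) else b ej.2); split.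
- by rewrite card_prod card_bool cJ expnS.
- by case=> -[] j /=; have [Kbj _] := Kb j; first exact: k1.
move=> c; rewrite sum_pair big_bool /=; set y := \sum_j c (true, j) *: c1 (b j); set x := \sum_j _.
pose y' := \sum_j c (true, j) *: b j.
have ey : y = c1 y' by rewrite esum; apply: eq_bigr => j _; rewrite eZ.
have Kx : Kp x by apply: (subsum sKp) => j _; apply: (subZ sKp).
have Ky : Kp y' by apply: (subsum sKp) => j _; apply: (subZ sKp).
rewrite ey => e.
have ex : x = - c1 y' by apply/eqP; rewrite -addr_eq0 addrC e.
(* [x] lies in the eigenspace of [t], and in that of [- t] because it is the opposite of [c1 y']. *)
have x0 : x = 0.
  have h1 : c1 (c2 x) = - (t *: x).
    rewrite {1}ex !eN c21 ?eN ?opprK; last by case: Ky.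
    by rewrite Ky.2 eZ ex scalerN opprK.
  have := Kx.2; rewrite h1 => /eqP; rewrite eq_sym -addr_eq0 -scalerDl -mulr2n -mulr_natl.
  by rewrite scaler_eq0 mulf_eq0 (negPf two) (negPf t0) => /eqP.
have y0 : y' = 0.
  have c1y : c1 y' = 0 by apply/eqP; rewrite -oppr_eq0 -ex x0.
  have := hs1 _ Ky.1; rewrite c1y e0 => /esym/eqP.
  by rewrite scaler_eq0 (negPf s10) => /eqP.
by case=> -[] j; [apply: (fb (fun j => c (true, j))) | apply: (fb (fun j => c (false, j)))].
Qed.
End Independence.

(** * The rank one case *)

Section RankOne.
Context {k : closedFieldType} {M : lmodType k} {nz : exists v : M, v != 0}.
Local Notation E := (endo nz).
Context {n : nat}.
Local Notation Mn := 'M[k]_n.+1.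
Context (p : nat) (hp : p \in [pchar k]) (hp2 : (2 < p)%N).
Context (P : E) (R : bool -> Mn -> E) (rep : is_rep P R).

Section Pair.
Context (i j : 'I_n.+1) (ij : i != j).
Let f := X R false j i.
Let f' := X R true j i.
Let e := X R false i j.
Let e' := X R true i j.
Let hi := X R false i i.
Let hj := X R false j j.
Let H := R true (delta_mx i i - delta_mx j j).

Let ji : j != i. Proof. by rewrite eq_sym. Qed.
Let HE : H = X R true i i - X R true j j. Proof. exact: (RB rep). Qed.
Let tH : traceless true (delta_mx i i - delta_mx j j : Mn).
Proof.
rewrite /traceless /= linearB /= /mxtrace.
rewrite (bigD1 i) //= big1 => [|a /negPf ai]; last by rewrite mxE ai.
by rewrite (bigD1 j) //= big1 => [|a /negPf aj]; rewrite ?mxE ?aj // !eqxx subrr.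
Qed.

Ltac xx := rewrite (XX rep) ?eqxx ?ij ?ji //= ?(negPf ij) ?(negPf ji)
  ?mulr1n ?mulr0n ?scaler0 ?expr0 ?expr1 ?scale1r ?scaleN1r ?subr0 ?sub0r ?addr0 ?opprK.

Lemma ef : e * f = f * e + (hi - hj). Proof. by rewrite /e /f; xx. Qed.
Lemma ef' : e * f' = f' * e + H. Proof. by rewrite HE /e /f'; xx. Qed.
Lemma e'f : e' * f = f * e' + H. Proof. by rewrite HE /e' /f; xx. Qed.
Lemma e'f' : e' * f' = - (f' * e') + (hi + hj). Proof. by rewrite /e' /f'; xx. Qed.
Lemma ff' : f' * f = f * f'. Proof. by rewrite /f /f'; xx. Qed.
Lemma f'f' : f' * f' = 0. Proof. exact: (odd_sq rep hp hp2). Qed.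
Lemma hif b : hi * X R b j i = X R b j i * hi - X R b j i.
Proof. by rewrite /hi; xx; case: b. Qed.
Lemma hjf b : hj * X R b j i = X R b j i * hj + X R b j i.
Proof. by rewrite /hj; xx; case: b. Qed.

Let D : Mn := delta_mx i i - delta_mx j j.
Ltac dd := rewrite /D ?(mulmxBl, mulmxBr) ?(mulmxBl, mulmxBr) ?(mulmxBl, mulmxBr)
  !mul_delta_mx_cond ?eqxx ?(negPf ij) ?(negPf ji) ?mulr1n ?mulr0n ?subr0 ?sub0r.

Let Dji : D *m delta_mx j i = - delta_mx j i. Proof. by dd. Qed.
Let jiD : delta_mx j i *m D = delta_mx j i. Proof. by dd. Qed.
Let Dij : D *m delta_mx i j = delta_mx i j. Proof. by dd. Qed.
Let ijD : delta_mx i j *m D = - delta_mx i j. Proof. by dd. Qed.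
Let DD : D *m D = delta_mx i i + delta_mx j j. Proof. by dd; rewrite opprK. Qed.

Lemma Hf : H * f = f * H - f' *+ 2.
Proof.
rewrite /H /f /X (rep_bracket rep) // andbF expr0 !scale1r -/D Dji jiD.
by rewrite -opprD (RN rep) [R _ (delta_mx j i + _)](RD rep) mulr2n.
Qed.
Lemma Hf' : H * f' = - (f' * H).
Proof.
rewrite /H /f' /X (rep_bracket rep) ?traceless_delta // expr1 !scaleN1r -/D Dji jiD opprK addNr.
by rewrite (R0 rep) addr0.
Qed.
Lemma eH : e * H = H * e - e' *+ 2.
Proof.
rewrite /H /e /X (rep_bracket rep) // expr0 !scale1r -/D Dij ijD.
by rewrite -opprD (RN rep) [R _ (delta_mx i j + _)](RD rep) mulr2n.
Qed.
Lemma HH : H * H = hi + hj.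
Proof.
apply: (scalerI (two_neq0 hp hp2)); rewrite !scaler_nat !mulr2n.
have := rep_bracket rep tH tH; rewrite -/H -/D expr1 !scaleN1r opprK DD => {1}->.
by rewrite addrAC addNr add0r [R _ (_ + _)](RD rep) [R _ (_ + _)](RD rep).
Qed.
Lemma hiH : hi * H = H * hi.
Proof.
rewrite /H /hi /X (rep_bracket rep) // expr0 !scale1r -/D.
by rewrite (_ : _ - _ = 0) ?(R0 rep) ?addr0 //; dd; rewrite subrr.
Qed.
Lemma hjH : hj * H = H * hj.
Proof.
rewrite /H /hj /X (rep_bracket rep) // expr0 !scale1r -/D.
by rewrite (_ : _ - _ = 0) ?(R0 rep) ?addr0 //; dd; rewrite subrr.
Qed.

Section Vector.
Context (v : M) (al be : k).
Hypotheses (ev : e v = 0) (e'v : e' v = 0) (hiv : hi v = al *: v) (hjv : hj v = be *: v).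

(** The sl(2) computation, for a weight vector not assumed to be killed by [e]: it is also applied
    to [f' w], which [e] sends to a multiple of [v]. *)
Lemma e_fpow (u : M) (a b : k) m : hi u = a *: u -> hj u = b *: u ->
  e ((f ^+ m.+1) u) = (f ^+ m.+1) (e u) + (m.+1%:R * (a - b - m%:R)) *: (f ^+ m) u.
Proof.
move=> hu hu'.
have wi l : hi ((f ^+ l) u) = (a - l%:R) *: (f ^+ l) u.
  elim: l => [|l IH]; first by rewrite expr0 subr0.
  rewrite exprS emulE -emulE hif !endoE IH eZ -[X in _ - X]scale1r -scalerBl.
  by congr (_ *: _); rewrite -natr1; ring.
have wj l : hj ((f ^+ l) u) = (b + l%:R) *: (f ^+ l) u.
  elim: l => [|l IH]; first by rewrite expr0 addr0.
  rewrite exprS emulE -emulE hjf !endoE IH eZ -[X in _ + X]scale1r -scalerDl.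
  by congr (_ *: _); rewrite -natr1; ring.
elim: m => [|m IH].
  rewrite !expr1 expr0 -emulE ef !endoE hu hu' -scalerBl subr0 mul1r //.
rewrite exprS emulE -emulE ef !endoE IH eD eZ -addrA; congr (_ + _).
rewrite wi wj -emulE -exprS -scalerBl -scalerDl; congr (_ *: _).
rewrite -!natr1; ring.
Qed.

Let w := H v.
Let sg := al + be.
(* e' sends f^m f' v to Gvec m, and e sends Gvec m.+1 to a nonzero multiple   *)
(* of Gvec m, so that f^(p-1) f' v is brought back to Gvec 0 = sg v.          *)
Definition Gvec m := sg *: (f ^+ m) v - m%:R *: (f ^+ m.-1) (f' w).

Let ew : e w = 0.
Proof. by rewrite -emulE eH mulr2n !endoE ev e'v e0 addr0 subrr. Qed.
Let hiw : hi w = al *: w. Proof. by rewrite -emulE hiH emulE hiv eZ. Qed.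
Let hjw : hj w = be *: w. Proof. by rewrite -emulE hjH emulE hjv eZ. Qed.
Let HHv : H w = sg *: v. Proof. by rewrite -emulE HH eaddE hiv hjv -scalerDl. Qed.

Lemma e'_fpow m : e' ((f ^+ m) (f' v)) = Gvec m.
Proof.
have Hw l : H ((f ^+ l) (f' v)) = - (f ^+ l) (f' w).
  elim: l => [|l IH]; first by rewrite !expr0 !e1E -emulE Hf' eoppE emulE.
  have f0 : f' ((f ^+ l) (f' v)) = 0.
    have -> : f' ((f ^+ l) (f' v)) = ((f ^+ l) * (f' * f')) v.
      rewrite -[LHS]/((f' * f ^+ l * f') v) mulrA.
      by rewrite (commrX l (ff' : GRing.comm f' f)).
    by rewrite f'f' mulr0.
  rewrite exprS emulE -emulE Hf mulr2n !endoE IH f0 addr0 subr0 eN //.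
elim: m => [|m IH].
  rewrite /Gvec !expr0 scale0r subr0 !e1E -emulE e'f' !endoE e'v e0 oppr0 add0r.
  by rewrite hiv hjv -scalerDl.
rewrite exprS emulE -emulE e'f !endoE IH Hw /Gvec eB !eZ -!emulE -!exprS -addrA; congr (_ + _).
rewrite -natr1 scalerDl scale1r opprD; congr (_ + _).
by case: m {IH Hw} => [|m] //=; rewrite !scale0r oppr0.
Qed.

Lemma e_Gvec m : e (Gvec m.+1) = (m.+1%:R * (al - be - m.+1%:R)) *: Gvec m.
Proof.
rewrite /Gvec eB !eZ (e_fpow _ hiv hjv) ev e0 add0r /=.
have uf : hi (f' w) = (al - 1) *: f' w.
  by rewrite -emulE hif !endoE hiw eZ scalerBl scale1r.
have uf' : hj (f' w) = (be + 1) *: f' w.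
  by rewrite -emulE hjf !endoE hjw eZ scalerDl scale1r.
have ef'w : e (f' w) = sg *: v by rewrite -emulE ef' !endoE ew e0 add0r HHv.
rewrite scalerBr !scalerA.
case: m => [|m].
  rewrite !expr0 !e1E ef'w scalerA -[0%:R]/(0 : k) mulr0 scale0r subr0 -scalerBl.
  by rewrite [RHS]subr0; congr (_ *: _); ring.
rewrite (e_fpow _ uf uf') ef'w eZ scalerDr !scalerA opprD addrA -scalerBl /=; congr (_ + _).
  by congr (_ *: _); rewrite -!natr1; ring.
by congr (- (_ *: _)); rewrite -!natr1; ring.
Qed.

(** If the vector vanished, so would [Gvec p.-1], its image under e'. Applying e repeatedly descends
    to [Gvec 0], a nonzero multiple of [v], through coefficients that are nonzero because al - be is
    not in the prime field. *)
Lemma block_neq0 : v != 0 -> sg != 0 ->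
  (forall m : nat, al - be != m%:R) -> (f ^+ p.-1 * f') v != 0.
Proof.
move=> v0 s0 nab; apply/eqP => fv; move: v0; apply/negP; rewrite negbK.
have pr := pcharf_prime hp.
have nzm m : (m.+1 < p)%N -> (m.+1%:R : k) != 0.
  by move=> lt; rewrite -(dvdn_pcharf hp) gtnNdvd.
have : Gvec p.-1 = 0 by rewrite -e'_fpow -[(f ^+ _) (f' v)]emulE fv e0.
have : (p.-1 < p)%N by rewrite prednK // prime_gt0.
elim: p.-1 => [_|m IH lt].
  by rewrite /Gvec scale0r subr0 expr0 e1E => /eqP; rewrite scaler_eq0 (negPf s0).
move=> G0; apply: IH; first exact: ltnW.
have /eqP := e_Gvec m; rewrite G0 e0 eq_sym scaler_eq0 mulf_eq0 (negPf (nzm m lt)) /=.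
by rewrite subr_eq0 (negPf (nab _)) => /eqP.
Qed.
End Vector.
End Pair.
End RankOne.

(** * The lower bound *)

Section ProductCommutation.
Context {k : fieldType} {A : algType k} {J : eqType} (B : J -> A).

Definition scomm (s : k) (x y : A) := x * y = s *: (y * x).

Lemma scommM s t x y z : scomm s x z -> scomm t y z -> scomm (s * t) (x * y) z.
Proof.
by rewrite /scomm => hx hy; rewrite -mulrA hy -scalerAr [x * (z * y)]mulrA hx -scalerAl scalerA mulrA mulrC.
Qed.

Lemma scommMr s t x y z : scomm s x y -> scomm t x z -> scomm (s * t) x (y * z).
Proof.
by rewrite /scomm => hy hz; rewrite mulrA hy -scalerAl -[y * x * z]mulrA hz -scalerAr scalerA mulrA.
Qed.

Lemma scommX t x z m : scomm t x z -> scomm (t ^+ m) (x ^+ m) z.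
Proof.
move=> h; elim: m => [|m IH]; first by rewrite /scomm !expr0 mul1r mulr1 scale1r.
by rewrite !exprS; apply: scommM.
Qed.

Lemma scomm_prod s x (r : seq J) : (forall j, j \in r -> scomm s x (B j)) ->
  scomm (s ^+ size r) x (\prod_(j <- r) B j).
Proof.
elim: r => [|j r IH] h; first by rewrite big_nil /scomm expr0 scale1r mulr1 mul1r.
rewrite big_cons exprS; apply: scommMr; first by apply/h/mem_head.
by apply: IH => i ir; apply: h; rewrite inE ir orbT.
Qed.

(** Passing [x] through [B a] leaves the correction [C], which can be moved next to the factor
    [B b], on whichever side this lies, and dies there. *)
Lemma comm_prod_correction s t x C a b (r : seq J) : t != 0 -> uniq r -> a \in r -> b \in r -> a != b ->
  (forall j, j \in r -> j != a -> scomm s x (B j)) -> x * B a = s *: (B a * x) + C ->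
  (forall j, j \in r -> j != a -> scomm t C (B j)) -> C * B b = 0 -> B b * C = 0 ->
  scomm (s ^+ size r) x (\prod_(j <- r) B j).
Proof.
move=> t0 ur ar br ab hx ha hC Cb bC.
case/splitPr: ar ur br hx hC => r1 r2; rewrite cat_uniq /= => /and4P[_ nr1 nr2 _] br hx hC.
have na j : j \in r1 ++ r2 -> j != a.
  rewrite mem_cat => /orP[j1|j2]; apply/eqP => e; subst j; last by rewrite j2 in nr2.
  by move: nr1; rewrite negb_or j1.
have hin j : j \in r1 ++ r2 -> j \in r1 ++ a :: r2.
  by rewrite !mem_cat inE => /orP[->|->]; rewrite ?orbT.
have h1 j : j \in r1 ++ r2 -> scomm s x (B j) by move=> jr; apply: hx; [apply: hin | apply: na].
have hC1 j : j \in r1 ++ r2 -> scomm t C (B j) by move=> jr; apply: hC; [apply: hin | apply: na].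
have hC0 : \prod_(j <- r1) B j * (C * \prod_(j <- r2) B j) = 0.
  have : b \in r1 ++ r2.
    by move: br; rewrite !mem_cat inE eq_sym (negPf ab).
  rewrite mem_cat => /orP[b1|b2].
    case/splitPr: b1 hC1 => s1 s2 hC1.
    have h2 : scomm (t ^+ size s2) C (\prod_(j <- s2) B j).
      by apply: scomm_prod => j js; apply: hC1; rewrite !mem_cat inE js !orbT.
    have e2 : (\prod_(j <- s2) B j) * C = (t ^+ size s2)^-1 *: (C * \prod_(j <- s2) B j).
      by rewrite h2 scalerA mulVf ?expf_neq0 // scale1r.
    rewrite big_cat big_cons /= mulrA -!mulrA [_ * (C * _)]mulrA e2.
    rewrite -scalerAl -!scalerAr -!mulrA [B b * (C * _)]mulrA bC.
    by rewrite mul0r mulr0 scaler0.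
  case/splitPr: b2 hC1 => s1 s2 hC1.
  have h2 : scomm (t ^+ size s1) C (\prod_(j <- s1) B j).
    by apply: scomm_prod => j js; apply: hC1; rewrite !mem_cat js !orbT.
  rewrite big_cat big_cons /= [C * _]mulrA h2 -scalerAl -mulrA [C * _]mulrA Cb mul0r mulr0.
  by rewrite scaler0 mulr0.
have h11 : scomm (s ^+ size r1) x (\prod_(j <- r1) B j).
  by apply: scomm_prod => j j1; apply: h1; rewrite mem_cat j1.
have h12 : scomm (s ^+ size r2) x (\prod_(j <- r2) B j).
  by apply: scomm_prod => j j2; apply: h1; rewrite mem_cat j2 orbT.
rewrite big_cat big_cons size_cat /= exprD exprS /scomm.
move: h11 h12 hC0; set P1 := \prod_(j <- r1) B j; set P2 := \prod_(j <- r2) B j.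
move=> h11 h12 hC0; rewrite [x * _]mulrA h11 -scalerAl -[P1 * x * _]mulrA [x * (B a * _)]mulrA ha.
rewrite mulrDl mulrDr hC0 addr0 -scalerAl -[B a * x * _]mulrA h12 -!scalerAr !scalerA !mulrA.
by [].
Qed.
End ProductCommutation.

(** * Dimension of submodules for a generic p-character *)

Section LowerBound.
Context {k : closedFieldType} {M : lmodType k} {nz : exists v : M, v != 0}.
Local Notation E := (endo nz).
Context {n : nat}.
Local Notation Mn := 'M[k]_n.+1.
Context (p : nat) (hp : p \in [pchar k]) (hp2 : (2 < p)%N).
Context (P : E) (R : bool -> Mn -> E) (rep : is_rep P R).
Context (c : 'I_n.+1 -> k).
Hypothesis nil : forall i j, i != j -> X R false i j ^+ p = 0.
Hypothesis tor : forall i, X R false i i ^+ p = X R false i i + c i *: 1.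
Hypothesis c_neq0 : forall i, c i != 0.
Hypothesis c_sep : forall i j, i != j -> (c i != c j) && (c i != - c j).
Hypothesis c_sum : forall mu : 'I_n.+1 -> k, (forall i, mu i ^+ p = mu i + c i) ->
  forall m : 'I_n.+1, \sum_(i : 'I_n.+1 | (i <= m)%N) (mu i)^-1 != 0.

Let p0 : (0 < p)%N := ltn_trans (isT : (0 < 2)%N) hp2.

Lemma weight_root i a v : v != 0 -> X R false i i v = a *: v -> a ^+ p = a + c i.
Proof.
move=> v0 hv; have hm m : (X R false i i ^+ m) v = a ^+ m *: v.
  elim: m => [|m IH]; first by rewrite !expr0 scale1r.
  by rewrite !exprS emulE IH eZ hv scalerA mulrC.
have := hm p; rewrite tor eaddE escaleE hv -scalerDl => /eqP.
by rewrite -subr_eq0 -scalerBl scaler_eq0 (negPf v0) orbF subr_eq0 eq_sym => /eqP.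
Qed.

(** Weights solve a^p = a + c_i. Since Frobenius is additive and fixes the prime field, a + b = 0
    would force c_i = -c_j, and a - b = m would force c_i = c_j. *)
Lemma weight_sep i j a b v : i != j -> v != 0 -> X R false i i v = a *: v ->
  X R false j j v = b *: v -> a + b != 0 /\ forall m : nat, a - b != m%:R.
Proof.
move=> ij v0 /(weight_root v0) ha /(weight_root v0) hb; have /andP[h1 h2] := c_sep ij.
have FD x y : (x + y) ^+ p = x ^+ p + y ^+ p := raddfD (pFrobenius_aut hp) x y.
split=> [|m].
  apply: contra h2 => /eqP ab; have := FD a b.
  rewrite ab expr0n gtn_eqF // ha hb addrACA ab add0r => /esym/eqP.
  by rewrite addr_eq0.
apply: contra h1 => /eqP ab; have := FD (a - b) b.
rewrite subrK ha hb ab -(pFrobenius_autE hp) (pFrobenius_aut_nat hp) => e.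
have /eqP : a + c i = a + c j by rewrite e addrA -ab subrK.
by rewrite (inj_eq (addrI a)).
Qed.

Definition weight_vector u := exists nu : 'I_n.+1 -> k, forall i, X R false i i u = nu i *: u.

Lemma weight_vector_root b a d u : b ==> (a != d) -> weight_vector u -> weight_vector (X R b a d u).
Proof.
move=> ad [nu hu]; exists (fun i => nu i + (i == a)%:R - (d == i)%:R) => i.
rewrite -emulE (XX rep) // andFb addFb expr0 !scale1r !endoE hu eZ -addrA scalerDl; congr (_ + _).
rewrite scalerBl; congr (_ - _).
  by case: eqP => [->|_]; rewrite ?mulr1n ?mulr0n ?scale1r ?scale0r.
by case: eqP => [->|_]; rewrite ?mulr1n ?mulr0n ?scale1r ?scale0r.
Qed.

Section Row.
Context (r : 'I_n.+1).
Let g b j := X R b r j.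
Definition block j := g false j ^+ p.-1 * g true j.
Definition indices l := [seq inord j : 'I_n.+1 | j <- index_iota l r].
Definition block_prod l := \prod_(j <- indices l) block j.

Lemma val_inord j : (j < r)%N -> (inord j : 'I_n.+1) = j :> nat.
Proof. by move=> jr; rewrite inordK // (ltn_trans jr). Qed.

Lemma mem_indices l j : (j \in indices l) = (l <= j < r)%N.
Proof.
apply/mapP/idP => [[i]|/andP[lj jr]].
  by rewrite mem_index_iota => /andP[li ir] ->; rewrite val_inord // li.
by exists (val j); rewrite ?mem_index_iota ?lj //; apply/ord_inj; rewrite val_inord.
Qed.

Lemma uniq_indices l : uniq (indices l).
Proof.
rewrite map_inj_in_uniq ?iota_uniq // => i j; rewrite !mem_index_iota.
by move=> /andP[_ ir] /andP[_ jr] /(congr1 (@nat_of_ord _)); rewrite !val_inord.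
Qed.

Lemma block_prodS l : (l < r)%N -> block_prod l = block (inord l) * block_prod l.+1.
Proof. by move=> lr; rewrite /block_prod !big_map big_ltn. Qed.

(** The factors act from column r-1 down to column 0. After each one the vector is still a weight
    vector killed by the positive root elements needed to apply [block_neq0] to the next pair (l,
    r). *)
Lemma highest_chain mu v : v != 0 -> hwv R mu v -> block_prod 0 v != 0.
Proof.
move=> v0 [hn ht].
suff H d : (d <= r)%N -> let u := block_prod (r - d) v in
    [/\ u != 0, weight_vector u, forall b (a : 'I_n.+1), (a < r - d)%N -> X R b a r u = 0 &
      forall b (a e : 'I_n.+1), (a < e)%N -> (e < r - d)%N -> X R b a e u = 0].
  by have := H r (leqnn r); rewrite subnn => -[].
elim: d => [_|d IH dr].
  rewrite subn0 /block_prod /indices /index_iota subnn big_nil e1E; split=> //; first by exists mu.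
  - by move=> b a ar; apply: hn.
  - by move=> b a e ae _; apply: hn.
have [u0 [nu hu] k1 k2] := IH (ltnW dr).
set l := (r - d.+1)%N; have el : (r - d = l.+1)%N by rewrite /l; lia.
rewrite el in u0 hu k1 k2; have lr : (l < r)%N by rewrite /l; lia.
rewrite block_prodS //; pose L : 'I_n.+1 := inord l.
have eL : L = l :> nat by apply: val_inord.
rewrite -/L emulE; set u := block_prod l.+1 v in u0 hu k1 k2 *.
have Lr : L != r by rewrite -val_eqE /= eL neq_ltn lr.
have rL : r != L by rewrite eq_sym.
have [ab0 abm] := weight_sep Lr u0 (hu L) (hu r).
have gneq b : b ==> (r != L) by rewrite rL implybT.
(* The condition on column [L] is included because the bracket of E_ar with E_rL is E_aL; with it,
   the conditions are stable under the row elements of column [L]. *)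
pose Z u := (forall b (a : 'I_n.+1), (a < l)%N -> X R b a r u = 0 /\ X R b a L u = 0) /\
  forall b (a e : 'I_n.+1), (a < e)%N -> (e < l)%N -> X R b a e u = 0.
have nlt (b : bool) (a e : 'I_n.+1) : (a < e)%N -> b ==> (a != e).
  by move=> ae; rewrite -val_eqE neq_ltn ae implybT.
have Zg b : stable (g b L) Z.
  move=> y [Z1 Z2]; split.
    move=> b' a al; have [h1 h2] := Z1 b' a al.
    have ar : (a < r)%N by apply: ltn_trans al lr.
    have aL : (a < L)%N by rewrite eL.
    have La : (L == a) = false by rewrite -val_eqE /= gtn_eqF.
    split; rewrite -emulE (XX rep) ?(nlt _ _ _ ar) ?(nlt _ _ _ aL) ?gneq //
      !endoE ?h1 ?h2 e0 scaler0 add0r La ?eqxx.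
      by rewrite mulr0n scaler0 oppr0 addr0 mulr1n (Z1 _ a al).2.
    by rewrite eq_sym (negPf rL) !mulr0n !(scaler0, oppr0, addr0).
  move=> b' a e ae el'; rewrite -emulE (XX rep) ?(nlt _ _ _ ae) ?gneq // !endoE Z2 // e0 scaler0 add0r.
  have -> : (e == r) = false by rewrite -val_eqE /= ltn_eqF // (ltn_trans el').
  have -> : (L == a) = false.
    by rewrite -val_eqE /= gtn_eqF // eL (ltn_trans ae).
  by rewrite !mulr0n !(scaler0, oppr0, addr0).
have Zu : Z u.
  split=> [b a al|b a e ae el']; last by apply: k2 => //; apply: ltnW.
  by split; [apply: k1; apply: ltnW | apply: k2; rewrite eL].
have pow (Q : M -> Prop) b m : stable (g b L) Q -> stable (g b L ^+ m) Q.
  by move=> st; elim: m => [|m IHm] y Qy; rewrite ?expr0 // exprS; apply/st/IHm.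
have ZB : Z (block L u) by apply: (pow Z); [apply: Zg | apply: Zg].
split.
- apply: (block_neq0 hp hp2 rep Lr (al := nu L) (be := nu r)) => //.
  + by apply: k1; rewrite eL.
  + by apply: k1; rewrite eL.
- have wg b : stable (g b L) weight_vector by move=> y; apply: weight_vector_root.
  by apply: (pow weight_vector); [apply: wg | apply: wg; exists nu].
- by move=> b a al; apply: (ZB.1 b a al).1.
- by move=> b a e ae el'; apply: ZB.2.
Qed.

Lemma row_commute (b b' : bool) (i j : 'I_n.+1) : i != r -> j != r ->
  scomm ((-1) ^+ (b && b')) (g b i) (g b' j).
Proof.
move=> ir jr; rewrite /scomm /g (XX rep); last 2 first.
- by rewrite eq_sym ir implybT.
- by rewrite eq_sym jr implybT.
by rewrite (negPf ir) (negPf jr) !mulr0n !(scaler0, subr0, addr0).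
Qed.

Lemma row_block (b : bool) (i j : 'I_n.+1) : i != r -> j != r -> scomm ((-1) ^+ b) (g b i) (block j).
Proof.
move=> ir jr; have := row_commute b false ir jr; rewrite andbF expr0 => h0.
have h1 : scomm 1 (g b i) (g false j ^+ p.-1).
  rewrite /scomm scale1r; apply: commrX; by rewrite /GRing.comm h0 scale1r.
by have := scommMr h1 (row_commute b true ir jr); rewrite andbT mul1r.
Qed.

Lemma row_block0 (b : bool) (i : 'I_n.+1) : i != r -> g b i * block i = 0.
Proof.
move=> ir; have ri : r != i by rewrite eq_sym.
rewrite /block; case: b; last by rewrite mulrA -exprS prednK // nil ?mul0r.
have h := row_commute true false ir ir; rewrite /scomm expr0 scale1r in h.
rewrite mulrA (commrX p.-1 (h : GRing.comm _ _)) -mulrA.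
by rewrite (odd_sq rep hp hp2) ?mulr0.
Qed.

Lemma block_row0 (b : bool) (i : 'I_n.+1) : i != r -> block i * g b i = 0.
Proof.
move=> ir; have := row_block b ir ir; rewrite /scomm row_block0 // => /esym/eqP.
by rewrite scaler_eq0 signr_eq0 => /eqP.
Qed.

(** The bracket of E_ij with E_ri is a multiple of E_rj, and [block j] already holds the top powers
    of E_rj and E'_rj, so every correction vanishes. *)
Lemma block_prod_root (b : bool) (i j : 'I_n.+1) : i != j -> (i < r)%N -> (j < r)%N ->
  scomm (((-1) ^+ b) ^+ size (indices 0)) (X R b i j) (block_prod 0).
Proof.
move=> ij ir jr; set x := X R b i j.
have nr (a : 'I_n.+1) : (a < r)%N -> a != r by move=> ar; rewrite -val_eqE neq_ltn ar.
have [nir njr] := (nr _ ir, nr _ jr).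
have rn (a : 'I_n.+1) : a != r -> r != a by rewrite eq_sym.
have bij : b ==> (i != j) by rewrite ij implybT.
have grow (b' : bool) (a : 'I_n.+1) : a != r -> b' ==> (r != a) by move=> ar; rewrite rn ?implybT.
have xg (b' : bool) : x * g b' i = (-1) ^+ (b && b') *: (g b' i * x) - (-1) ^+ (b && b') *: g (b (+) b') j.
  by rewrite /x /g (XX rep) ?grow // (negPf njr) eqxx mulr0n sub0r mulr1n.
have xgj (b' : bool) (a : 'I_n.+1) : a != r -> a != i -> scomm ((-1) ^+ (b && b')) x (g b' a).
  move=> ar ai; rewrite /scomm /x /g (XX rep) ?grow // (negPf njr) (negPf ai).
  by rewrite !mulr0n !(scaler0, subr0, addr0).
pose y := g b j; pose y' := g (~~ b) j.
(* The correction left by [block i]: the first term comes from the odd factor, the second from the p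
   - 1 even ones. *)
pose C := - ((-1) ^+ b *: (g false i ^+ p.-1 * y')) - (g false i ^+ p.-2 * y * g true i) *+ p.-1.
have yi : scomm 1 y (g false i) by have := row_commute b false njr nir; rewrite andbF.
have xpow m : x * g false i ^+ m.+1 = g false i ^+ m.+1 * x - (g false i ^+ m * y) *+ m.+1.
  elim: m => [|m IH].
    by rewrite expr1 expr0 mul1r mulr1n xg andbF addbF expr0 !scale1r.
  rewrite exprSr mulrA IH mulrBl -[g false i ^+ _ * x * _]mulrA xg andbF addbF.
  rewrite expr0 !scale1r mulrBr mulrA -exprSr -addrA.
  congr (_ + _); rewrite mulrnAl -mulrA yi scale1r mulrA -exprSr -opprD; congr (- _).
have ep : p.-1 = p.-2.+1 by move: hp2; case: (p) => [|[|[|]]].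
have xB : x * block i = (-1) ^+ b *: (block i * x) + C.
  rewrite /block mulrA ep xpow -ep mulrBl -[g false i ^+ _ * x * _]mulrA xg.
  rewrite andbT addbT /C -/y' mulrBr -!scalerAr !mulrA.
  by rewrite mulrnAl addrA.
apply: (comm_prod_correction (t := - (-1) ^+ b) (C := C) (a := i) (b := j)).
- by rewrite oppr_eq0 signr_eq0.
- exact: uniq_indices.
- by rewrite mem_indices ir.
- by rewrite mem_indices jr.
- exact: ij.
- move=> a; rewrite mem_indices => /andP[_ ar] ai.
  have h0 : scomm 1 x (g false a) by have := xgj false a (nr _ ar) ai; rewrite andbF.
  have h1 : scomm 1 x (g false a ^+ p.-1).
    by rewrite /scomm scale1r; apply: commrX; rewrite /GRing.comm h0 scale1r.
  by have := scommMr h1 (xgj true a (nr _ ar) ai); rewrite andbT mul1r.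
- exact: xB.
- move=> a; rewrite mem_indices => /andP[_ /nr ar] ai.
  have hf m : scomm 1 (g false i ^+ m) (block a).
    by have := scommX m (row_block false nir ar); rewrite expr0 expr1n.
  have h1 := scommM (hf p.-1) (row_block (~~ b) njr ar).
  have h2 := scommM (scommM (hf p.-2) (row_block b njr ar)) (row_block true nir ar).
  move: h1 h2; rewrite !mul1r expr1 mulrN1 -/y -/y' /scomm => h1 h2.
  have e : (-1) ^+ (~~ b) = - (-1) ^+ b :> k.
    by case: b {h1 h2 y y' C xB xpow yi x xg xgj bij}; rewrite ?expr0 ?expr1 ?opprK.
  rewrite e in h1.
  rewrite /C mulrBl mulrBr scalerBr !mulNr !mulrN !scalerN -scalerAl h1 mulrnAl h2.
  by rewrite mulrnAr -!scalerAr scalerMnr !scalerA mulrC.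
- have y0 : y * block j = 0 by apply: row_block0.
  have y'0 : y' * block j = 0 by apply: row_block0.
  have e := row_commute b true njr nir; rewrite -/y /scomm in e.
  rewrite /C mulrBl mulNr -scalerAl -[_ * y' * _]mulrA y'0 mulr0 scaler0 oppr0 sub0r mulrnAl.
  rewrite -[_ * y * g true i]mulrA e -scalerAr -scalerAl -!mulrA y0 !mulr0.
  by rewrite scaler0 mul0rn oppr0.
- have y0 : block j * y = 0 by apply: block_row0.
  have y'0 : block j * y' = 0 by apply: block_row0.
  have hf m : block j * g false i ^+ m = g false i ^+ m * block j.
    by apply/commrX; rewrite /GRing.comm (row_block false nir njr) scale1r.
  rewrite /C mulrBr mulrN -scalerAr [block j * (_ * y')]mulrA hf -[_ * block j * y']mulrA y'0.
  rewrite mulr0 scaler0 oppr0 sub0r mulrnAr !mulrA hf -[_ * block j * y]mulrA y0.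
  by rewrite mulr0 mul0r mul0rn oppr0.
Qed.

Lemma block_prod_weight i : exists a : k,
  X R false i i * block_prod 0 = block_prod 0 * X R false i i + a *: block_prod 0.
Proof.
pose Q y := exists a : k, X R false i i * y = y * X R false i i + a *: y.
have QM y z : Q y -> Q z -> Q (y * z).
  case=> a ha [b hb]; exists (a + b).
  by rewrite mulrA ha mulrDl -mulrA hb mulrDr !mulrA -scalerAr -scalerAl -addrA scalerDl [_ *: _ + _]addrC.
have Q1 : Q 1 by exists 0; rewrite mulr1 mul1r scale0r addr0.
have Qg b j : j != r -> Q (g b j).
  move=> jr; exists ((i == r)%:R - (j == i)%:R).
  rewrite /g (XX rep) //; last by rewrite eq_sym jr implybT.
  rewrite andFb addFb expr0 !scale1r scalerBl !scaler_nat; congr (_ + (_ - _)).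
    by case: eqP => [->|].
  by case: eqP => [->|].
rewrite /block_prod big_seq; apply: (big_ind Q) => // j; rewrite mem_indices => /andP[_ jr].
have nj : j != r by rewrite -val_eqE neq_ltn jr.
by apply: (QM); [elim: (p.-1) => [|m IH]; rewrite ?expr0 // exprS; apply: QM => //; apply: Qg | apply: Qg].
Qed.
End Row.

Section Submodule.
Context (W : M -> Prop) (subW : submodule P R W) (ntW : nontrivial W).

(** A filtration from the vectors of [W] killed by all positive root elements ([m = 0]) up to [W]
    itself ([m = n.+1]). *)
Definition level (m : nat) u := W u /\
  forall b (a d : 'I_n.+1), (a < d)%N -> (m <= d)%N -> X R b a d u = 0.

Lemma level_subspace m : subspace (level m).
Proof.
case: subW => sW _ _; split; first by split=> *; [case: sW | rewrite e0].
move=> a u v [Wu hu] [Wv hv]; split; first exact: sW.2.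
by move=> b x y xy my; rewrite eD eZ hu // hv // scaler0 addr0.
Qed.

Lemma W_root b (i j : 'I_n.+1) : b ==> (i != j) -> stable (X R b i j) W.
Proof. by case: subW => _ _ RW ij; apply: RW; apply: traceless_delta. Qed.

Let nlt (b : bool) (a e : 'I_n.+1) : (a < e)%N -> b ==> (a != e).
Proof. by move=> ae; rewrite -val_eqE neq_ltn ae implybT. Qed.

Lemma level_root_stable m b (i j : 'I_n.+1) : (i < j)%N -> stable (X R b i j) (level m).
Proof.
move=> ij u [Wu hu]; split; first by apply: W_root => //; apply: nlt.
have [mj|jm] := leqP m j.
  by move=> b' a d _ _; rewrite hu // e0.
move=> b' a d ad md.
rewrite -emulE (XX rep) ?(nlt _ ij) ?(nlt _ ad) // !endoE hu // e0 scaler0 add0r.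
have -> : (d == i) = false.
  by rewrite -val_eqE /= gtn_eqF // (leq_trans _ md) // (ltn_trans ij).
rewrite mulr0n sub0r; case: eqP => [ja|_]; last by rewrite mulr0n scaler0 oppr0.
by rewrite mulr1n hu ?scaler0 ?oppr0 // (ltn_trans ij) // ja.
Qed.

Lemma level_torus_stable m i : stable (X R false i i) (level m).
Proof.
move=> u [Wu hu]; split; first exact: W_root.
move=> b a d ad md; rewrite -emulE (XX rep) ?(nlt _ ad) // !endoE hu // e0 scaler0 add0r addbF.
have -> : (X R b a i *+ (d == i)) u = 0.
  by case: eqP => [<-|_]; rewrite ?mulr1n ?hu // mulr0n e0E.
have -> : (X R b i d *+ (i == a)) u = 0.
  by case: eqP => [->|_]; rewrite ?mulr1n ?hu // mulr0n e0E.
by rewrite scaler0 subr0.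
Qed.

Lemma level_row_stable (r : 'I_n.+1) b (j : 'I_n.+1) : (j < r)%N ->
  stable (X R b r j) (level r.+1).
Proof.
move=> jr u [Wu hu].
have rj : b ==> (r != j) by rewrite -val_eqE neq_ltn jr orbT implybT.
split; first exact: W_root.
move=> b' a d ad rd; rewrite -emulE (XX rep) ?(nlt _ ad) // !endoE hu // e0 scaler0 add0r.
have -> : (d == r) = false by rewrite -val_eqE /= gtn_eqF.
rewrite mulr0n e0E add0r; case: eqP => [ja|_]; last by rewrite mulr0n e0E scaler0 oppr0.
by rewrite mulr1n hu ?scaler0 ?oppr0.
Qed.

(* If nonzero, the kernel would contain a highest weight vector, contrary to  *)
(* highest_chain.                                                             *)
Lemma block_prod_inj (r : 'I_n.+1) u : level r u -> block_prod r 0 u = 0 -> u = 0.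
Proof.
move=> lu Fu; apply/eqP/negPn/negP => u0.
pose K v := level r v /\ block_prod r 0 v = 0.
have sK : subspace K.
  have sl := level_subspace r; split; first by split; [case: sl | rewrite e0].
  by move=> a x y [lx hx] [ly hy]; split; [apply: sl.2 | rewrite eD eZ hx hy scaler0 addr0].
have nilu (i j : 'I_n.+1) : (i < j)%N -> X R false i j ^+ p = 0.
  by move=> ij; apply: nil; rewrite -val_eqE neq_ltn ij.
have [|||mu [v [v0 [lv Fv] hv]]] := highest_weight rep hp hp2 nilu tor sK.
- by exists u.
- move=> b i j ij v [lv Fv]; split; first exact: level_root_stable.
  have [rj|jr] := leqP r j; first by case: lv => _ -> //; rewrite e0.
  have ne : i != j by rewrite -val_eqE neq_ltn ij.
  have := block_prod_root b ne (ltn_trans ij jr) jr; rewrite /scomm => h.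
  have /eqP := congr1 (fun y : E => y v) h; rewrite escaleE !emulE Fv e0 eq_sym.
  by rewrite scaler_eq0 expf_eq0 signr_eq0 andbF => /eqP.
- move=> i v [lv Fv]; split; first exact: level_torus_stable.
  have [a h] := block_prod_weight r i.
  have := congr1 (fun y : E => y v) h; rewrite eaddE escaleE !emulE Fv e0 scaler0 addr0.
  by move=> <-.
by have := highest_chain r v0 hv; rewrite Fv eqxx.
Qed.

(** The top monomial of row r is [block_prod r 0], injective on [level r]; hence all (2p)^r
    restricted monomials act freely. They preserve only [level r.+1], where their values lie. *)
Lemma level_step (r : 'I_n.+1) D : dim_ge (level r) D ->
  dim_ge (level r.+1) ((p * 2) ^ r * D)%N.
Proof.
case=> J [b [<- Kb fb]].
pose fs : seq (E * nat) :=
  flatten [seq [:: (X R false r j, p.-1); (X R true r j, 1%N)] | j <- indices r 0].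
have fsP x : x \in fs -> exists (c0 : bool) (j : 'I_n.+1),
    [/\ j != r, (j < r)%N, x.1 = X R c0 r j & x.2 = (if c0 then 1%N else p.-1)].
  case/flatten_mapP => j; rewrite mem_indices => /andP[_ jr].
  have nj : j != r by rewrite -val_eqE neq_ltn jr.
  by rewrite !inE => /orP[] /eqP ->; [exists false, j | exists true, j].
have topE : top fs = block_prod r 0.
  rewrite /top big_flatten big_map; apply: eq_bigr => j _.
  by rewrite !big_cons big_nil /= mulr1 expr1.
have cardE : (\prod_(fq <- fs) fq.2.+1 = (p * 2) ^ r)%N.
  rewrite big_flatten big_map (eq_bigr (fun=> p * 2)%N) => [|j _].
    by rewrite big_const_seq count_predT iter_muln_1 size_map size_iota subn0.
  by rewrite !big_cons big_nil /= muln1 prednK.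
rewrite -cardE; apply: (free_monomials (b := b)).
- move=> x y /fsP[cx [i [ir _ -> _]]] /fsP[cy [j [jr _ -> _]]].
  by exists ((-1) ^+ (cx && cy)); rewrite ?signr_eq0 // (row_commute _ _ ir jr).
- move=> x /fsP[[] [j [jr _ -> ->]]]; first by rewrite expr2 (odd_sq rep hp hp2) // eq_sym.
  by rewrite prednK // nil // eq_sym.
- move=> a; rewrite topE.
  under eq_bigr => j _ do rewrite -eZ; rewrite -esum => e.
  apply: fb; apply: block_prod_inj e.
  by apply: (subsum (level_subspace r)) => j _; apply: (subZ (level_subspace r)).
- by move=> x /fsP[c0 [j [_ jr -> _]]]; apply: level_row_stable.
- move=> j; have [Wb hb] := Kb j; split=> // b' a d ad rd.
  by apply: hb => //; apply: ltnW.
Qed.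

Lemma level_dim m D : (m <= n.+1)%N -> dim_ge (level 0) D ->
  dim_ge (level m) ((p * 2) ^ (\sum_(i < m) i) * D)%N.
Proof.
move=> mn h0; elim: m mn => [_|m IH mn]; first by rewrite big_ord0 mul1n.
rewrite big_ord_recr /= expnD mulnAC mulnC.
exact: (level_step (r := Ordinal mn) (IH (ltnW mn))).
Qed.

(** The highest weight vectors of one weight carry n anticommuting operators with nonzero squares,
    to which [clifford_dim] applies. *)
Lemma level0_dim : dim_ge (level 0) (2 ^ uphalf n).
Proof.
have nilu (i j : 'I_n.+1) : (i < j)%N -> X R false i j ^+ p = 0.
  by move=> ij; apply: nil; rewrite -val_eqE neq_ltn ij.
have [sW PW RW] := subW.
have [||mu [v [v0 Wv hv]]] := highest_weight rep hp hp2 nilu tor sW ntW.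
- by move=> b i j ij; apply: W_root; apply: nlt.
- by move=> i; apply: W_root.
have hmu i : mu i ^+ p = mu i + c i by apply: weight_root v0 (hv.2 i).
have mu0 i : mu i != 0.
  apply: contra (c_neq0 i) => /eqP e; have := hmu i.
  by rewrite e expr0n gtn_eqF // add0r => <-.
(* The odd traceless diagonal elements d m are orthogonal for the form        *)
(* \sum_i mu_i x_i y_i given by their anticommutators on weight vectors.      *)
pose s m : k := \sum_(i : 'I_n.+1 | (i <= m)%N) (mu i)^-1.
pose d m : 'rV[k]_n.+1 := \row_i
  (if (i <= m)%N then (mu i)^-1 else if i == m.+1 :> nat then - s m else 0).
have dE m (F : 'I_n.+1 -> k) (mn : (m.+1 < n.+1)%N) :
    \sum_i d m 0 i * F i =
    \sum_(i : 'I_n.+1 | (i <= m)%N) (mu i)^-1 * F i - s m * F (Ordinal mn).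
  rewrite (bigID (fun i : 'I_n.+1 => (i <= m)%N)) /=; congr (_ + _).
    by apply: eq_bigr => i im; rewrite mxE im.
  rewrite (bigD1 (Ordinal mn)) /= ?ltnn // big1 => [|i /andP[im nim]].
    by rewrite addr0 mxE /= ltnn eqxx mulNr.
  by rewrite mxE (negPf im) -(inj_eq val_inj) /= in nim *; rewrite (negPf nim) mul0r.
have dsum m : (m < n)%N -> \sum_i d m 0 i = 0.
  move=> mn; under eq_bigr => i _ do rewrite -[d m 0 i]mulr1.
  rewrite (dE m (fun=> 1) (mn : (m.+1 < n.+1)%N)).
  by under eq_bigr => i _ do rewrite mulr1; rewrite mulr1 subrr.
have td m : (m < n)%N -> traceless true (diag_mx (d m)).
  by move=> mn; rewrite /traceless /= mxtrace_diag dsum.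
have orth m l : (m < l)%N -> (l < n)%N -> \sum_i mu i * d m 0 i * d l 0 i = 0.
  move=> ml ln; have mn := ltn_trans ml ln; rewrite -[RHS](dsum m mn).
  apply: eq_bigr => i _; rewrite [mu i * _]mulrC -mulrA.
  have [il|li] := leqP i l; first by rewrite [d l 0 i]mxE il mulfV // mulr1.
  rewrite [d m 0 i]mxE leqNgt (ltn_trans ml li) /= gtn_eqF ?mul0r //.
  by apply: leq_ltn_trans li.
(* The value is s_m mu_(m+1) s_(m+1), which is why [c_sum] asks for nonzero partial sums. *)
have norm m : (m < n)%N -> \sum_i mu i * d m 0 i * d m 0 i != 0.
  move=> mn; have mn' : (m.+1 < n.+1)%N by [].
  under eq_bigr => i _ do rewrite [mu i * _]mulrC -mulrA.
  rewrite (dE m (fun i => mu i * d m 0 i) mn').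
  have -> : \sum_(i : 'I_n.+1 | (i <= m)%N) (mu i)^-1 * (mu i * d m 0 i) = s m.
    by apply: eq_bigr => i im; rewrite mulrA mulVf // mul1r mxE im.
  have sm : s m != 0 by apply: (c_sum hmu (Ordinal (ltnW mn'))).
  have sm1 : s m.+1 != 0 by apply: (c_sum hmu (Ordinal mn')).
  rewrite [d m 0 _]mxE /= ltnn eqxx !mulrN opprK.
  have e1 : s m.+1 = s m + (mu (Ordinal mn'))^-1.
    rewrite /s (bigD1 (Ordinal mn')) //= addrC; congr (_ + _).
    apply: eq_bigl => i; rewrite -val_eqE /= leq_eqVlt ltnS.
    by case: eqP => [->|_] /=; rewrite ?andbF ?andbT ?ltnn.
  have -> : s m + s m * (mu (Ordinal mn') * s m) = s m * mu (Ordinal mn') * s m.+1.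
    rewrite e1 mulrDr -[_ * _ * _^-1]mulrA mulfV // mulr1 addrC.
    by congr (_ + _); rewrite -!mulrA.
  by rewrite !mulf_neq0.
pose K u := W u /\ hwv R mu u.
have sK : subspace K.
  have sh := hwv_subspace R mu; split; first by split; [case: sW | case: sh].
  by move=> a x y [Wx hx] [Wy hy]; split; [apply: sW.2 | apply: sh.2].
apply: (@dim_ge_sub _ _ K); first by move=> u [Wu [hu _]]; split=> // b a e ae _; apply: hu.
pose ws : seq E := [seq R true (diag_mx (d m)) | m <- iota 0 n].
(* The parity anticommutes with odd operators and squares to 1; for odd n it supplies the generator
   that makes their number even and rounds n/2 up. *)
pose cs := ws ++ (if odd n then [:: P] else [::]).
have csP x : x \in cs -> x = P \/ exists2 m, (m < n)%N & x = R true (diag_mx (d m)).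
  rewrite mem_cat => /orP[/mapP[m mi ->]|].
    by right; exists m => //; move: mi; rewrite mem_iota.
  by case: odd; rewrite ?inE // => /eqP ->; left.
have two := two_neq0 hp hp2.
apply: (@clifford_dim _ _ _ cs) => //.
  rewrite size_cat size_map size_iota uphalf_half.
  by have := odd_double_half n; case: (odd n) => /=; lia.
- by exists v.
- move=> x /csP[->|[m mn ->]] u [Wu hu]; split.
  + exact: PW.
  + exact: (hwv_parity rep).
  + by apply: RW => //; apply: td.
  + by apply: (diag_stable rep) => //; apply: td.
- move=> x /csP[->|[m mn ->]].
    by exists 1; rewrite ?oner_eq0 // => u _; rewrite -emulE (rep_involution rep) scale1r.
  exists (\sum_i mu i * d m 0 i * d m 0 i); first exact: norm.
  move=> u [_ hu]; have := diag_bracket rep (td m mn) (td m mn) hu.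
  move/eqP; rewrite eq_sym addrC subr_eq -mulr2n -scaler_nat -scalerA => /eqP e.
  exact/esym/(scalerI two).
have Pw m : (m < n)%N -> forall u, R true (diag_mx (d m)) (P u) = - P (R true (diag_mx (d m)) u).
  move=> mn u; have := congr1 (fun y : E => y u) (rep_parity rep (td m mn)).
  by rewrite escaleE expr1 scaleN1r !emulE => ->; rewrite opprK.
rewrite pairwise_cat; apply/and3P; split.
- apply/allrelP => x y /mapP[m]; rewrite mem_iota => /andP[_ mn] ->.
  by case: odd; rewrite ?inE // => /eqP ->; apply/asboolP => u _; apply: Pw.
- rewrite pairwise_map; apply: (@sub_in_pairwise _ (fun m => m < n)%N ltn).
  + move=> m l mn ln ml; apply/asboolP => u [_ hu].
    by rewrite (diag_bracket rep (td m mn) (td l ln) hu) orth // mulr0 scale0r addr0.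
  + by apply/allP => m; rewrite mem_iota.
  + by rewrite -(sorted_pairwise ltn_trans) iota_ltn_sorted.
- by case: odd.
Qed.

Theorem lower_bound : dim_ge W (irr_dim p n.+1).
Proof.
have := level_dim (leqnn _) level0_dim.
have -> : (\sum_(i < n.+1) i = (n.+1 * n)./2)%N.
  by rewrite -[(n.+1 * n)%N]/(n.+1 * n.+1.-1)%N -bin2 -bin2_sum big_mkord.
rewrite expnMn irr_dimE; apply: dim_ge_sub => u; by case.
Qed.
End Submodule.
End LowerBound.

(** * Fock representations *)

Section Fock.
Context {k : closedFieldType} (p : nat) (hp : p \in [pchar k]).

(* Creation operators z and annihilation operators d, bosonic (false) and     *)
(* fermionic (true), one of each kind for each mode in s.                     *)
Record is_fock {T : eqType} (s : seq T) (kap sig : T -> k) {M : lmodType k}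
    {nz : exists v : M, v != 0} (P : endo nz) (z d : bool -> T -> endo nz) : Prop := {
  fock_zz : forall b b' t t', t \in s -> t' \in s ->
    z b t * z b' t' = (-1) ^+ (b && b') *: (z b' t' * z b t);
  fock_dd : forall b b' t t', t \in s -> t' \in s ->
    d b t * d b' t' = (-1) ^+ (b && b') *: (d b' t' * d b t);
  fock_dz : forall b b' t t', t \in s -> t' \in s ->
    d b t * z b' t' = (-1) ^+ (b && b') *: (z b' t' * d b t) + ((b == b') && (t == t'))%:R;
  fock_Pz : forall b t, t \in s -> P * z b t = (-1) ^+ b *: (z b t * P);
  fock_Pd : forall b t, t \in s -> P * d b t = (-1) ^+ b *: (d b t * P);
  fock_PP : P * P = 1;
  fock_zp : forall t, t \in s -> z false t ^+ p = kap t *: 1;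
  fock_dp : forall t, t \in s -> sig t = 0 -> d false t ^+ p = 0;
  fock_zdp : forall t, t \in s ->
    (z false t * d false t) ^+ p =
    z false t * d false t + ((kap t * sig t) ^+ p - kap t * sig t) *: 1
}.

Section Step.
Context (V : vectType k) (nz : exists v : V, v != 0).
Let q := p.-1.
Let pq : p = q.+1.
Proof. by rewrite /q prednK // prime_gt0 // (pcharf_prime hp). Qed.
Local Notation J := ('I_q.+1 * bool)%type.
Local Notation V' := {ffun J -> V}.

Lemma step_nz : exists F : V', F != 0.
Proof.
case: nz => v v0; exists [ffun=> v]; apply/eqP => /ffunP/(_ (ord0, false)).
by rewrite !ffunE => /eqP; rewrite (negPf v0).
Qed.
Local Notation E := (endo nz).
Local Notation E' := (endo step_nz).

Definition mkop (g : V' -> J -> V) (gl : forall j, linear (g^~ j)) : E'.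
Proof.
exists (fun F => [ffun j => g F j]) => a F G.
by apply/ffunP => j; rewrite !ffunE gl.
Defined.

Lemma mkopE g gl F j : @mkop g gl F j = g F j.
Proof. by rewrite ffunE. Qed.

Lemma opP (x y : E') : (forall F j, x F j = y F j) -> x = y.
Proof. by move=> h; apply: endoP => F; apply/ffunP => j. Qed.

Lemma op_add (x y : E') F j : (x + y) F j = x F j + y F j.
Proof. by rewrite eaddE ffunE. Qed.
Lemma op_opp (x : E') F j : (- x) F j = - x F j.
Proof. by rewrite eoppE ffunE. Qed.
Lemma op_scale a (x : E') F j : (a *: x) F j = a *: x F j.
Proof. by rewrite escaleE ffunE. Qed.

(* The sign is that of moving x, of parity b, past the odd variable of the    *)
(* component j.                                                               *)
Definition lift_op (b : bool) (x : E) : E'.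
Proof.
apply: (@mkop (fun F j => (-1) ^+ (b && j.2) *: x (F j))) => j a F G.
by rewrite !ffunE eD eZ scalerDr !scalerA mulrC.
Defined.

Lemma lift_opE b x F j : lift_op b x F j = (-1) ^+ (b && j.2) *: x (F j).
Proof. exact: mkopE. Qed.

Lemma lift_opM b b' x y : lift_op b x * lift_op b' y = lift_op (b (+) b') (x * y).
Proof.
apply: opP => F j; rewrite emulE !lift_opE eZ scalerA -emulE; congr (_ *: _).
by case: b b' j => [] [] [m []] /=; rewrite ?expr0 ?expr1 ?mulr1 ?mul1r ?mulrNN ?mulr1.
Qed.

Lemma lift_opD b x y : lift_op b (x + y) = lift_op b x + lift_op b y.
Proof. by apply: opP => F j; rewrite op_add !lift_opE eaddE scalerDr. Qed.
Lemma lift_opZ b a x : lift_op b (a *: x) = a *: lift_op b x.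
Proof. by apply: opP => F j; rewrite op_scale !lift_opE escaleE !scalerA mulrC. Qed.
Lemma lift_op1 : lift_op false 1 = 1.
Proof. by apply: opP => F j; rewrite lift_opE expr0 scale1r. Qed.
Lemma lift_opX x m : lift_op false x ^+ m = lift_op false (x ^+ m).
Proof.
elim: m => [|m IH]; first by rewrite !expr0 lift_op1.
by rewrite !exprS IH lift_opM.
Qed.

Context (kap sig : k).
Let tau := kap * sig.

(** [V'] is V tensored with k[x]/(x^p - kap) and an exterior algebra on one generator, [F (m, e)]
    being the coefficient of x^m and of the e-th power of the generator. This is multiplication by
    x. *)
Definition xop : E'.
Proof.
apply: (@mkop (fun F j => if j.1 == ord0 then kap *: F (ord_max, j.2)
  else F (inord j.1.-1, j.2))) => j a F G.
by case: eqP => _; rewrite !ffunE ?scalerDr ?scalerA ?[kap * a]mulrC.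
Defined.

(** The operator d/dx + sig x^(p-1). The second term keeps the commutation relation with x but
    shifts the eigenvalues of xy by tau = kap sig. *)
Definition yop : E'.
Proof.
apply: (@mkop (fun F j => if j.1 == ord_max then sig *: F (ord0, j.2)
  else (j.1.+1%:R + tau) *: F (inord j.1.+1, j.2))) => j a F G.
by case: eqP => _; rewrite !ffunE scalerDr !scalerA [_ * a]mulrC.
Defined.

(** Multiplication by the odd generator; [etaop] is the derivative with respect to it. *)
Definition xiop : E'.
Proof.
apply: (@mkop (fun F j => if j.2 then F (j.1, false) else 0)) => j a F G.
by case: j.2; rewrite ?ffunE // scaler0 addr0.
Defined.

Definition etaop : E'.
Proof.
apply: (@mkop (fun F j => if j.2 then 0 else F (j.1, true))) => j a F G.
by case: j.2; rewrite ?ffunE // scaler0 addr0.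
Defined.

Lemma xE F m e : xop F (m, e) =
  if m == 0 :> nat then kap *: F (ord_max, e) else F (inord m.-1, e).
Proof. by rewrite mkopE. Qed.
Lemma yE F m e : yop F (m, e) =
  if m == q :> nat then sig *: F (ord0, e) else (m.+1%:R + tau) *: F (inord m.+1, e).
Proof. by rewrite mkopE. Qed.
Lemma xiE F m e : xiop F (m, e) = if e then F (m, false) else 0.
Proof. by rewrite mkopE. Qed.
Lemma etaE F m e : etaop F (m, e) = if e then 0 else F (m, true).
Proof. by rewrite mkopE. Qed.

Lemma q1 : (q%:R + 1 : k) = 0.
Proof. by rewrite natr1 -pq (pcharf0 hp). Qed.

Lemma yxE F m e : yop (xop F) (m, e) = (m%:R + 1 + tau) *: F (m, e).
Proof.
rewrite yE; case: eqP => [mq|/eqP nm].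
  rewrite xE /= scalerA mulrC -/tau mq q1 add0r.
  by congr (_ *: F (_, _)); apply: ord_inj; rewrite /= mq.
rewrite xE natr1 /=.
have lt : (m.+1 < q.+1)%N by rewrite ltnS ltn_neqAle nm -ltnS ltn_ord.
by rewrite inordK //= inord_val.
Qed.

Lemma xyE F m e : xop (yop F) (m, e) = (m%:R + tau) *: F (m, e).
Proof.
rewrite xE; case: eqP => [m0|/eqP nm].
  rewrite yE eqxx scalerA -/tau m0 add0r.
  by congr (_ *: F (_, _)); apply: ord_inj; rewrite /= m0.
have lt : (m.-1 < q.+1)%N by apply: leq_ltn_trans (leq_pred _) (ltn_ord m).
have mS : m.-1.+1 = m by rewrite prednK // lt0n.
rewrite yE inordK // mS inord_val.
by case: eqP => // e'; have := ltn_ord m; rewrite -mS e' ltnn.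
Qed.

Lemma xpE : xop ^+ p = kap *: 1.
Proof.
have H m : (m <= q.+1)%N -> forall F (i : 'I_q.+1) e, (xop ^+ m) F (i, e) =
    if (m <= i)%N then F (inord (i - m), e) else kap *: F (inord (i + q.+1 - m), e).
  elim: m => [_ F i e|m IH mq F i e]; first by rewrite subn0 inord_val.
  rewrite exprSr emulE IH ?(ltnW mq) //; have := ltn_ord i; case: (ltngtP m i) => mi iq.
  - rewrite xE inordK ?gtn_eqF ?subn_gt0 //; last by lia.
    by congr (F (inord _, _)); lia.
  - rewrite xE inordK; last by lia.
    rewrite gtn_eqF; last by lia.
    by congr (_ *: F (inord _, _)); lia.
  - rewrite mi subnn xE inordK // eqxx.
    by congr (_ *: F (_, _)); apply: ord_inj; rewrite /= inordK; lia.
rewrite pq; apply: opP => F [i e]; rewrite H // leqNgt ltn_ord op_scale e1E.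
by rewrite addnK inord_val.
Qed.

Lemma ypE : sig = 0 -> yop ^+ p = 0.
Proof.
move=> s0; have H m : forall F (i : 'I_q.+1) e, (q < i + m)%N -> (yop ^+ m) F (i, e) = 0.
  elim: m => [|m IH] F i e h; first by have := ltn_ord i; lia.
  rewrite exprS emulE yE; case: eqP => [|/eqP ni]; first by rewrite s0 scale0r.
  rewrite IH ?scaler0 // inordK; first by lia.
  by have := ltn_ord i; lia.
by rewrite pq; apply: opP => F [i e]; rewrite H ?ffunE // addnS ltnS leq_addl.
Qed.

(** The product is diagonal with eigenvalues i + tau, and Frobenius fixes the integer i. *)
Lemma xypE : (xop * yop) ^+ p = xop * yop + (tau ^+ p - tau) *: 1.
Proof.
have H m F i e : ((xop * yop) ^+ m) F (i, e) = (i%:R + tau) ^+ m *: F (i, e).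
  elim: m => [|m IH]; first by rewrite !expr0 scale1r.
  by rewrite !exprS emulE emulE xyE IH scalerA.
apply: opP => F [i e]; rewrite H op_add op_scale emulE xyE e1E -scalerDl; congr (_ *: _).
have FD a b : (a + b) ^+ p = a ^+ p + b ^+ p := raddfD (pFrobenius_aut hp) a b.
by rewrite FD -(pFrobenius_autE hp) pFrobenius_aut_nat -addrA [tau + _]addrC subrK.
Qed.

Lemma xi_lift b x : xiop * lift_op b x = (-1) ^+ b *: (lift_op b x * xiop).
Proof.
apply: opP => F [m e]; rewrite op_scale !emulE xiE !lift_opE xiE.
case: e => /=; last by rewrite e0 !scaler0.
by rewrite andbF andbT expr0 scale1r scalerA -signr_addb addbb expr0 scale1r.
Qed.
Lemma eta_lift b x : etaop * lift_op b x = (-1) ^+ b *: (lift_op b x * etaop).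
Proof.
apply: opP => F [m e]; rewrite op_scale !emulE etaE !lift_opE etaE.
case: e => /=; first by rewrite e0 !scaler0.
by rewrite andbF andbT expr0 scale1r.
Qed.
Lemma x_lift b x : xop * lift_op b x = lift_op b x * xop.
Proof.
apply: opP => F [m e]; rewrite !emulE xE !lift_opE xE /=.
by case: eqP => _ //; rewrite eZ !scalerA mulrC.
Qed.
Lemma y_lift b x : yop * lift_op b x = lift_op b x * yop.
Proof.
apply: opP => F [m e]; rewrite !emulE yE !lift_opE yE /=.
by case: eqP => _; rewrite eZ !scalerA mulrC.
Qed.

Lemma x_xi : xop * xiop = xiop * xop.
Proof.
apply: opP => F [m e]; rewrite !emulE xE !xiE xE.
by case: e; case: eqP => //; rewrite scaler0.
Qed.
Lemma x_eta : xop * etaop = etaop * xop.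
Proof.
apply: opP => F [m e]; rewrite !emulE xE !etaE xE.
by case: e; case: eqP => //; rewrite scaler0.
Qed.
Lemma y_xi : yop * xiop = xiop * yop.
Proof.
apply: opP => F [m e]; rewrite !emulE yE !xiE yE.
by case: e; case: eqP => //; rewrite !scaler0.
Qed.
Lemma y_eta : yop * etaop = etaop * yop.
Proof.
apply: opP => F [m e]; rewrite !emulE yE !etaE yE.
by case: e; case: eqP => //; rewrite !scaler0.
Qed.
Lemma xi_xi : xiop * xiop = 0.
Proof. by apply: opP => F [m e]; rewrite emulE !xiE ffunE; case: e. Qed.
Lemma eta_eta : etaop * etaop = 0.
Proof. by apply: opP => F [m e]; rewrite emulE !etaE ffunE; case: e. Qed.
Lemma eta_xi : etaop * xiop = - (xiop * etaop) + 1.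
Proof.
apply: opP => F [m e]; rewrite op_add op_opp !emulE e1E !(etaE, xiE).
by case: e; rewrite ?addNr ?oppr0 ?add0r.
Qed.
Lemma y_x : yop * xop = xop * yop + 1.
Proof.
apply: opP => F [m e]; rewrite op_add !emulE yxE xyE e1E -{3}[F (m, e)]scale1r -scalerDl.
by rewrite addrAC.
Qed.

Context {T : eqType} (s : seq T) (ks ss : T -> k) (P : E) (z d : bool -> T -> E).
Hypothesis fk : is_fock s ks ss P z d.

Lemma fock_step t : t \notin s -> ks t = kap -> ss t = sig ->
  is_fock (t :: s) ks ss (lift_op true P)
   (fun b u => if u == t then (if b then xiop else xop) else lift_op b (z b u))
   (fun b u => if u == t then (if b then etaop else yop) else lift_op b (d b u)).
Proof.
move=> ts kt st.
have old u : u \in t :: s -> u != t -> u \in s by rewrite inE => /predU1P[->|//]; rewrite eqxx.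
have sgnK (b : bool) (x y : E') : x * y = (-1) ^+ b *: (y * x) -> y * x = (-1) ^+ b *: (x * y).
  by move=> ->; rewrite scalerA -signr_addb addbb expr0 scale1r.
have lift_comm (b b' : bool) (x y : E) (a c : k) : x * y = a *: (y * x) + c *: 1 ->
    (c != 0 -> b = b') ->
    lift_op b x * lift_op b' y = a *: (lift_op b' y * lift_op b x) + c *: 1.
  move=> e bb; rewrite !lift_opM e lift_opD !lift_opZ addbC; congr (_ + _).
  have [->|c0] := eqVneq c 0; first by rewrite !scale0r.
  by rewrite (bb c0) addbb lift_op1.
have lift0 (b b' : bool) (x y : E) (a : k) : x * y = a *: (y * x) ->
    lift_op b x * lift_op b' y = a *: (lift_op b' y * lift_op b x).
  move=> e; have := lift_comm b b' x y a 0; rewrite !scale0r !addr0.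
  by apply=> //; rewrite eqxx.
split.
- move=> b b' u u' us us'; case: (eqVneq u t) => [ut|nu]; case: (eqVneq u' t) => [ut'|nu'].
  + by case: b b' => [] []; rewrite /= ?expr0 ?expr1 ?scale1r ?xi_xi ?scaler0 ?x_xi.
  + by case: b; [rewrite xi_lift | rewrite x_lift scale1r].
  + by rewrite andbC; apply: sgnK; case: b'; [rewrite xi_lift | rewrite x_lift scale1r].
  + by apply: lift0; apply: (fock_zz fk); apply: old.
- move=> b b' u u' us us'; case: (eqVneq u t) => [ut|nu]; case: (eqVneq u' t) => [ut'|nu'].
  + by case: b b' => [] []; rewrite /= ?expr0 ?expr1 ?scale1r ?eta_eta ?scaler0 ?y_eta.
  + by case: b; [rewrite eta_lift | rewrite y_lift scale1r].
  + by rewrite andbC; apply: sgnK; case: b'; [rewrite eta_lift | rewrite y_lift scale1r].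
  + by apply: lift0; apply: (fock_dd fk); apply: old.
- move=> b b' u u' us us'; case: (eqVneq u t) => [ut|nu]; case: (eqVneq u' t) => [ut'|nu'].
  + subst u u'; rewrite eqxx andbT; case: b b' => [] [] /=; rewrite ?expr0 ?expr1 ?scale1r ?scaleN1r.
    * exact: eta_xi.
    * by rewrite mulr0n addr0 x_eta.
    * by rewrite mulr0n addr0 y_xi.
    * exact: y_x.
  + rewrite ut [t == u']eq_sym (negPf nu') andbF mulr0n addr0.
    by case: b; [rewrite eta_lift | rewrite y_lift scale1r].
  + rewrite ut' (negPf nu) andbF mulr0n addr0 andbC; apply: sgnK.
    by case: b'; [rewrite xi_lift | rewrite x_lift scale1r].
  + rewrite -scaler_nat; apply: lift_comm.
      by rewrite scaler_nat; apply: (fock_dz fk); apply: old.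
    by case: (b =P b') => //= _; rewrite mulr0n eqxx.
- move=> b u us; case: eqVneq => [ut|nu]; last by apply: lift0; apply: (fock_Pz fk); apply: old.
  by case: b; apply: sgnK; [rewrite xi_lift | rewrite x_lift scale1r].
- move=> b u us; case: eqVneq => [ut|nu]; last by apply: lift0; apply: (fock_Pd fk); apply: old.
  by case: b; apply: sgnK; [rewrite eta_lift | rewrite y_lift scale1r].
- by rewrite lift_opM (fock_PP fk) lift_op1.
- move=> u us; case: eqVneq => [->|nu]; first by rewrite xpE kt.
  by rewrite lift_opX (fock_zp fk) ?old // lift_opZ lift_op1.
- move=> u us su; case: eqVneq => [ut|nu]; first by apply: ypE; rewrite -st -ut.
  rewrite lift_opX (fock_dp fk) ?old //.
  by rewrite -[0 in LHS](scale0r (0 : E)) lift_opZ scale0r.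
- move=> u us; case: eqVneq => [->|nu]; first by rewrite xypE kt st.
  by rewrite lift_opM lift_opX (fock_zdp fk) ?old // lift_opD lift_opZ lift_op1.
Qed.
End Step.

Lemma fock_exists {T : eqType} (s : seq T) (kap sig : T -> k) : uniq s ->
  exists (V : vectType k) (nz : exists v : V, v != 0) (P : endo nz) (z d : bool -> T -> endo nz),
    is_fock s kap sig P z d.
Proof.
elim: s => [_|t s IH /= /andP[ts us]].
  have nz : exists v : k^o, v != 0 by exists 1; rewrite oner_eq0.
  exists (k^o : vectType k), nz, 1, (fun _ _ => 0), (fun _ _ => 0).
  by split=> //; rewrite mulr1.
have [V [nz [P [z [d fk]]]]] := IH us.
exists ({ffun 'I_p.-1.+1 * bool -> V} : vectType k), (step_nz nz).
by do 3 eexists; apply: (fock_step fk ts).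
Qed.
End Fock.

Lemma expr_sum_comm (A : nzRingType) (p : nat) (hp : p \in [pchar A]) (I : eqType)
    (s : seq I) (F : I -> A) : (forall i j, i \in s -> j \in s -> F i * F j = F j * F i) ->
  (\sum_(i <- s) F i) ^+ p = \sum_(i <- s) F i ^+ p.
Proof.
elim: s => [|i s IH] h.
  by rewrite !big_nil expr0n gtn_eqF // prime_gt0 // (pcharf_prime hp).
rewrite !big_cons -!(pFrobenius_autE hp) pFrobenius_autD_comm; last first.
  rewrite big_seq; apply: commr_sum => j js.
  by apply: h; rewrite ?mem_head // inE js orbT.
congr (_ + _); rewrite pFrobenius_autE IH // => j l js ls.
by apply: h; rewrite inE ?js ?ls orbT.
Qed.

(** * The oscillator representation of q(n) *)

Section FockRepresentation.
Context {k : closedFieldType} (p : nat) (hp : p \in [pchar k]) (hp2 : (2 < p)%N).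
Context {n : nat}.
Local Notation I := 'I_n.+1.
Local Notation Mn := 'M[k]_n.+1.
Context {M : lmodType k} {nz : exists v : M, v != 0}.
Local Notation E := (endo nz).
Context (lam : I -> k).

(* Only in the modes (i, i) have creation operators a nonzero p-th power;     *)
(* this makes X^p - X the scalar lam_i^p - lam_i for X the image of E_ii, and *)
(* X^p = 0 for the image of E_ij with i != j.                                 *)
Definition kap (t : I * I) : k := (t.1 == t.2)%:R.
Definition sig (t : I * I) : k := if t.1 == t.2 then lam t.1 else 0.

Context (P : E) (z d : bool -> I * I -> E).
Hypothesis fk : is_fock p (enum {: I * I}) kap sig P z d.

Lemma quad_bracket a b c e (t u t' u' : I * I) :
  z a t * d b u * (z c t' * d e u') =
  (-1) ^+ ((a (+) b) && (c (+) e)) *: (z c t' * d e u' * (z a t * d b u)) +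
  (((b == c) && (u == t'))%:R *: (z a t * d e u')
   - (-1) ^+ ((a (+) b) && (c (+) e)) *: (((e == a) && (u' == t))%:R *: (z c t' * d b u))).
Proof.
have mem (x : I * I) : x \in enum {: I * I} by rewrite mem_enum.
set s := (-1) ^+ _.
have -> : z a t * d b u * (z c t' * d e u') = z a t * (d b u * z c t') * d e u'.
  by rewrite !mulrA.
have -> : z c t' * d e u' * (z a t * d b u) = z c t' * (d e u' * z a t) * d b u.
  by rewrite !mulrA.
have e1 := fock_dz fk b c (mem u) (mem t').
have e2 := fock_dz fk e a (mem u') (mem t).
rewrite e1 e2.
set x := z a t; set y := d b u; set x' := z c t'; set y' := d e u'.
rewrite -!scaler_nat !mulrDr !mulrDl -!scalerAr -!scalerAl !mulr1.
rewrite !scalerDr -addrA; congr (_ + _); last by rewrite addrC subrK.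
have -> : x * (x' * y) * y' = (x * x') * (y * y') by rewrite !mulrA.
have -> : x' * (x * y') * y = (x' * x) * (y' * y) by rewrite !mulrA.
rewrite (fock_zz fk a c) // (fock_dd fk b e) // -scalerAl -scalerAr !scalerA.
congr (_ *: _); rewrite /s; case: a b c e {s x y x' y' e1 e2} => [] [] [] [] /=;
  by rewrite !(expr0, expr1, mulr1, mul1r, mulrNN, opprK, mulN1r).
Qed.

(** The sum of these over [lb] is the action on superpolynomials in several copies of the natural
    module: the mode (i, l) is the i-th coordinate in copy l, and [beta] exchanges bosons and
    fermions. *)
Definition quad beta i j (lb : I * bool) : E :=
  z (beta (+) lb.2) (i, lb.1) * d lb.2 (j, lb.1).

Definition op beta i j : E := \sum_lb quad beta i j lb.

Lemma op_bracket beta beta' i j i' j' :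
  op beta i j * op beta' i' j' =
  (-1) ^+ (beta && beta') *: (op beta' i' j' * op beta i j) +
  ((j == i')%:R *: op (beta (+) beta') i j'
   - (-1) ^+ (beta && beta') *: ((j' == i)%:R *: op (beta (+) beta') i' j)).
Proof.
rewrite /op mulr_suml.
under eq_bigr => lb _.
  rewrite mulr_sumr.
  under eq_bigr => le _ do rewrite quad_bracket !addbK.
  rewrite big_split sumrB /=; over.
rewrite big_split sumrB /=; congr (_ + (_ - _)).
- rewrite mulr_suml scaler_sumr exchange_big; apply: eq_bigr => le _ /=.
  by rewrite mulr_sumr scaler_sumr.
- rewrite exchange_big scaler_sumr; apply: eq_bigr => -[l e] _ /=.
  rewrite (bigD1 (l, beta' (+) e)) //= big1 ?addr0 => [|[l' b] ne].
    by rewrite eqxx /= xpair_eqE eqxx andbT /quad /= addbA.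
  have -> : (b == beta' (+) e) && ((j, l') == (i', l)) = false.
    by apply: contraNF ne => /andP[/eqP -> /eqP[_ ->]].
  by rewrite scale0r.
- rewrite !scaler_sumr; apply: eq_bigr => -[l b] _ /=.
  rewrite (bigD1 (l, beta (+) b)) //= big1 ?addr0 => [|[l' e] ne].
    by rewrite eqxx /= xpair_eqE eqxx andbT addbA [beta' (+) beta]addbC.
  have -> : (e == beta (+) b) && ((j', l') == (i, l)) = false.
    by apply: contraNF ne => /andP[/eqP -> /eqP[_ ->]].
  by rewrite scale0r scaler0.
Qed.

Definition fock_rep b (A : Mn) : E := \sum_i \sum_j A i j *: op b i j.

Lemma fock_rep_delta b i j : fock_rep b (delta_mx i j) = op b i j.
Proof.
rewrite /fock_rep (bigD1 i) //= [X in _ + X]big1 => [|a ai]; last first.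
  by rewrite big1 // => c _; rewrite mxE (negPf ai) scale0r.
rewrite (bigD1 j) //= big1 => [|a aj]; last by rewrite mxE (negPf aj) andbF scale0r.
by rewrite mxE !eqxx scale1r !addr0.
Qed.

Lemma contract (A B : Mn) (G : I -> I -> E) :
  \sum_i \sum_j \sum_i' \sum_j' (A i j * B i' j') *: ((j == i')%:R *: G i j') =
  \sum_i \sum_j' (A *m B) i j' *: G i j'.
Proof.
apply: eq_bigr => i _.
under [RHS]eq_bigr => j' _ do rewrite mxE scaler_suml.
rewrite [RHS]exchange_big; apply: eq_bigr => j _ /=.
rewrite (bigD1 j) //= [X in _ + X]big1 ?addr0 => [|i' ni].
  by apply: eq_bigr => j' _; rewrite eqxx scale1r.
by rewrite big1 // => j' _; rewrite eq_sym (negPf ni) scale0r scaler0.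
Qed.

Lemma fock_is_rep : is_rep P fock_rep.
Proof.
have repD b : linear (fock_rep b).
  move=> a A B; rewrite /fock_rep scaler_sumr -big_split; apply: eq_bigr => i _ /=.
  rewrite scaler_sumr -big_split; apply: eq_bigr => j _ /=.
  by rewrite !mxE scalerDl scalerA.
have mem (x : I * I) : x \in enum {: I * I} by rewrite mem_enum.
split=> // [b b' A B _ _|b A _|]; last exact: (fock_PP fk).
- have RB C D : fock_rep (b (+) b') (C - (-1) ^+ (b && b') *: D) =
      fock_rep (b (+) b') C - (-1) ^+ (b && b') *: fock_rep (b (+) b') D.
    by rewrite addrC -scaleNr repD scaleNr addrC.
  rewrite RB /fock_rep -!contract.
  have expand (C D : Mn) c c' : (\sum_i \sum_j C i j *: op c i j) *
      (\sum_i \sum_j D i j *: op c' i j) =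
      \sum_i \sum_j \sum_i' \sum_j' (C i j * D i' j') *: (op c i j * op c' i' j').
    rewrite mulr_suml; apply: eq_bigr => i _; rewrite mulr_suml; apply: eq_bigr => j _.
    rewrite mulr_sumr; apply: eq_bigr => i' _; rewrite mulr_sumr; apply: eq_bigr => j' _.
    by rewrite -scalerAl -scalerAr scalerA.
  have swap (F : I -> I -> I -> I -> E) : \sum_i \sum_j \sum_i' \sum_j' F i j i' j' =
      \sum_i' \sum_j' \sum_i \sum_j F i j i' j'.
    have e2 (G : I -> I -> E) : \sum_i \sum_j G i j = \sum_ij G ij.1 ij.2.
      by rewrite pair_bigA.
    rewrite e2 [RHS]e2; under eq_bigr => ij _ do rewrite e2.
    by rewrite exchange_big; apply: eq_bigr => ij _; rewrite e2.
  rewrite !expand [X in _ = _ *: X + _]swap [X in _ = _ + (_ - _ *: X)]swap.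
  rewrite !scaler_sumr -sumrB -big_split; apply: eq_bigr => i _ /=.
  rewrite !scaler_sumr -sumrB -big_split; apply: eq_bigr => j _ /=.
  rewrite !scaler_sumr -sumrB -big_split; apply: eq_bigr => i' _ /=.
  rewrite !scaler_sumr -sumrB -big_split; apply: eq_bigr => j' _ /=.
  rewrite op_bracket scalerDr scalerBr !scalerA; congr (_ *: _ + (_ - _ *: _)); ring.
- rewrite /fock_rep mulr_sumr mulr_suml scaler_sumr; apply: eq_bigr => i _.
  rewrite mulr_sumr mulr_suml scaler_sumr; apply: eq_bigr => j _.
  rewrite -scalerAr -scalerAl scalerA mulrC -scalerA; congr (_ *: _).
  rewrite /op mulr_sumr mulr_suml scaler_sumr; apply: eq_bigr => -[l e] _.
  rewrite /quad /= mulrA (fock_Pz fk) // -scalerAl -mulrA (fock_Pd fk) // -scalerAr scalerA mulrA.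
  by congr (_ *: _); rewrite -signr_addb addbK.
Qed.

(** The summands involve distinct copies or distinct statistics, hence commute pairwise. *)
Lemma op_exp i j : op false i j ^+ p = \sum_lb quad false i j lb ^+ p.
Proof.
have hE : p \in [pchar E] := endo_pchar hp.
rewrite /op -[LHS]/((\sum_(lb <- index_enum _) _) ^+ p).
apply: (expr_sum_comm hE) => -[l b] [l' e] _ _.
have [[<- <-] //|ne] := eqVneq (l, b) (l', e).
rewrite /quad quad_bracket /= !addbb expr0 scale1r -[RHS]addr0; congr (_ + _).
have -> : (b == e) && ((j, l) == (i, l')) = false.
  apply: contraNF ne => /andP[/eqP -> /eqP[_ ->]]; exact: eqxx.
have -> : (e == b) && ((j, l') == (i, l)) = false.
  apply: contraNF ne => /andP[/eqP -> /eqP[_ ->]]; exact: eqxx.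
by rewrite !scale0r scaler0 subr0.
Qed.

Lemma fermion_exp i j l : i != j -> (z true (i, l) * d true (j, l)) ^+ p = 0.
Proof.
move=> ij; have mem (x : I * I) : x \in enum {: I * I} by rewrite mem_enum.
have sq x : x * x = (-1) ^+ 1 *: (x * x) :> E -> x * x = 0.
  rewrite expr1 scaleN1r => /eqP; rewrite -addr_eq0 -mulr2n -scaler_nat.
  by rewrite scaler_eq0 (negPf (two_neq0 hp hp2)) => /eqP.
suff e : (z true (i, l) * d true (j, l)) ^+ 2 = 0.
  by rewrite -(subnKC (ltnW hp2)) exprD e mul0r.
have /sq zz := fock_zz fk true true (mem (i, l)) (mem (i, l)).
have e := fock_dz fk true true (mem (j, l)) (mem (i, l)).
rewrite xpair_eqE eq_sym (negPf ij) mulr0n addr0 expr1 scaleN1r in e.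
by rewrite expr2 mulrA -[z _ _ * _ * _]mulrA e mulrN mulrA zz mul0r mulNr mul0r oppr0.
Qed.

(** In copy l the p-th power is that of the creation operator (i, l) times that of the annihilation
    operator (j, l). The first vanishes for l different from i, the second for l = i, since then j
    differs from l. *)
Lemma fock_nilpotent i j : i != j -> X fock_rep false i j ^+ p = 0.
Proof.
move=> ij; have mem (x : I * I) : x \in enum {: I * I} by rewrite mem_enum.
rewrite /X fock_rep_delta op_exp big1 // => -[l []] _ /=.
  exact: fermion_exp.
have /commr_sym zd : GRing.comm (d false (j, l)) (z false (i, l)).
  have := fock_dz fk false false (mem (j, l)) (mem (i, l)).
  by rewrite xpair_eqE eq_sym (negPf ij) expr0 scale1r addr0.
rewrite /quad /= exprMn_comm //; have [e|ne] := eqVneq i l.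
  by rewrite (fock_dp fk) ?mulr0 // /sig /= -e eq_sym (negPf ij).
by rewrite (fock_zp fk) // /kap /= (negPf ne) scale0r mul0r.
Qed.

(** Each number operator equals its own p-th power, except the bosonic one of the mode (i, i),
    shifted by lam_i. *)
Lemma fock_torus i : X fock_rep false i i ^+ p =
  X fock_rep false i i + (lam i ^+ p - lam i) *: 1.
Proof.
have mem (x : I * I) : x \in enum {: I * I} by rewrite mem_enum.
rewrite /X fock_rep_delta op_exp /op.
pose w (lb : I * bool) : k := if lb == (i, false) then lam i ^+ p - lam i else 0.
have -> : (lam i ^+ p - lam i) *: 1 = \sum_lb w lb *: (1 : E).
  rewrite (bigD1 (i, false)) //= big1 /w ?eqxx ?addr0 // => lb /negPf ->.
  by rewrite scale0r.
rewrite -big_split; apply: eq_bigr => -[l []] _ /=; rewrite /quad /w /=.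
  have -> : ((l, true) == (i, false)) = false by rewrite xpair_eqE andbF.
  rewrite scale0r addr0.
  have sq x : x * x = (-1) ^+ 1 *: (x * x) :> E -> x * x = 0.
    rewrite expr1 scaleN1r => /eqP; rewrite -addr_eq0 -mulr2n -scaler_nat.
    by rewrite scaler_eq0 (negPf (two_neq0 hp hp2)) => /eqP.
  have /sq zz := fock_zz fk true true (mem (i, l)) (mem (i, l)).
  have e := fock_dz fk true true (mem (i, l)) (mem (i, l)).
  rewrite !eqxx mulr1n expr1 scaleN1r in e; set N := z _ _ * d _ _.
  have NN : N * N = N.
    by rewrite /N mulrA -[z _ _ * _ * _]mulrA e mulrDr mulrN mulrA zz mul0r oppr0 add0r mulr1.
  have : (0 < p)%N := ltn_trans (isT : (0 < 2)%N) hp2.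
  case: (p) => // m _; elim: m => [|m IH]; first by rewrite expr1.
  by rewrite exprS IH NN.
rewrite (fock_zdp fk) //; congr (_ + _ *: _); rewrite xpair_eqE eqxx andbT /kap /sig /=.
rewrite eq_sym; case: eqP => [_|_]; first by rewrite mul1r.
by rewrite mul0r expr0n gtn_eqF ?subr0 // (ltn_trans _ hp2).
Qed.
End FockRepresentation.

(** * Choice of generic parameters *)

Section GenericParameters.
Context {k : closedFieldType} (p : nat) (hp : p \in [pchar k]).

Lemma common_nonroot (s : seq {poly k}) : 0 \notin s ->
  exists x, forall q, q \in s -> q.[x] != 0.
Proof.
move=> s0; have /closed_nonrootP[x] : \prod_(q <- s) q != 0.
  by rewrite prodf_seq_neq0; apply/allP => q qs; apply: contraNneq s0 => <-.
rewrite /root horner_prod prodf_seq_neq0 => /allP h; exists x => q /h.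
by [].
Qed.

Lemma artin_schreier_size (c : k) : size ('X^p - 'X - c%:P) = p.+1.
Proof.
have p1 := prime_gt1 (pcharf_prime hp).
have s1 : (size (- ('X : {poly k}) - c%:P)%R < p.+1)%N.
  apply: leq_ltn_trans (size_polyD _ _) _; rewrite !size_polyN size_polyX size_polyC gtn_max.
  by case: eqP => _ /=; lia.
by rewrite -addrA size_polyDl size_polyXn.
Qed.

Lemma artin_schreier_neq0 (c : k) : 'X^p - 'X - c%:P != 0.
Proof. by rewrite -size_poly_eq0 artin_schreier_size. Qed.

(** Induction on [m]. The finite list [T] contains every value that the sum of the inverses can take
    as the roots mu_i vary, so that the next parameter need only avoid finitely many values. *)
Lemma generic_sequence m : exists (lam : nat -> k) (T : seq k),
  let c i := lam i ^+ p - lam i in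
  [/\ forall i, (i < m)%N -> c i != 0,
      forall i j, (i < m)%N -> (j < m)%N -> i != j -> (c i != c j) && (c i != - c j)
    & forall mu : nat -> k, (forall i, (i < m)%N -> mu i ^+ p = mu i + c i) ->
        \sum_(i < m) (mu i)^-1 \in T /\
        forall l, (l < m)%N -> \sum_(i < l.+1) (mu i)^-1 != 0].
Proof.
(* F lists the prime field: mu_i lies in lam_i + F, so that finitely many     *)
(* values of lam_m are to be avoided at each step.                            *)
have [F hF] := closed_field_poly_normal ('X^p - 'X - 0%:P : {poly k}).
elim: m => [|m [lam [T [c0 cs ct]]]].
  by exists (fun=> 0), [:: 0]; split=> // mu _; split=> //; rewrite big_ord0 mem_head.
pose c i := lam i ^+ p - lam i.
(* The last family excludes s + 1/(x + f) = 0. The convention that 0 has inverse 0 lets it cover s =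
   0 too, where it excludes x + f = 0. *)
pose avoided := 'X^p - 'X - 0%:P :: [seq 'X^p - 'X - (c i)%:P | i <- iota 0 m]
  ++ [seq 'X^p - 'X - (- c i)%:P | i <- iota 0 m] ++ [seq 'X - (- s^-1 - f)%:P | s <- T, f <- F].
have [|x hx] := @common_nonroot avoided.
  rewrite inE negb_or eq_sym artin_schreier_neq0 !mem_cat !negb_or /=; apply/and3P; split.
  - by apply/mapP => -[i _ /esym/eqP]; rewrite (negPf (artin_schreier_neq0 _)).
  - by apply/mapP => -[i _ /esym/eqP]; rewrite (negPf (artin_schreier_neq0 _)).
  - by apply/allpairsP => -[[s f] [_ _ /esym/eqP]]; rewrite polyXsubC_eq0.
have x0 : x ^+ p - x != 0.
  by have := hx _ (mem_head _ _); rewrite !hornerE subr0.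
have x1 i : (i < m)%N -> (c i != x ^+ p - x) && (c i != - (x ^+ p - x)).
  move=> im; have h1 : 'X^p - 'X - (c i)%:P \in avoided.
    by rewrite inE mem_cat (map_f (fun i => 'X^p - 'X - (c i)%:P)) ?orbT // mem_iota.
  have h2 : 'X^p - 'X - (- c i)%:P \in avoided.
    by rewrite inE !mem_cat (map_f (fun i => 'X^p - 'X - (- c i)%:P)) ?orbT // mem_iota.
  have := hx _ h2; have := hx _ h1; rewrite !hornerE subr_eq0 eq_sym => -> /=.
  by apply: contraNneq => ->; rewrite opprK subrr.
pose lam' i := if i == m then x else lam i.
have old i : (i < m)%N -> lam' i = lam i by rewrite /lam' => im; rewrite ltn_eqF.
have new : lam' m = x by rewrite /lam' eqxx.
have cases i : (i < m.+1)%N -> i = m \/ (i < m)%N.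
  by rewrite ltnS leq_eqVlt => /predU1P.
exists lam', [seq s + (x + f)^-1 | s <- T, f <- F]; split.
- by move=> i /cases[->|im]; rewrite ?new ?old ?c0.
- move=> i j /cases[->|im] /cases[->|jm]; rewrite ?eqxx ?new ?old //; last exact: cs.
    move=> _; have /andP[h1 h2] := x1 _ jm; rewrite eq_sym h1 /=.
    by apply: contraNneq h2 => ->; rewrite opprK.
  by move=> _; apply: x1.
- move=> mu hmu; have [|tin tn] := ct mu.
    by move=> i im; rewrite hmu ?old // ltnW.
  have fin : mu m - x \in F.
    have : root ('X^p - 'X - 0%:P) (mu m - x).
      have FB a b : (a - b) ^+ p = a ^+ p - b ^+ p := raddfB (pFrobenius_aut hp) a b.
      by rewrite /root !hornerE subr0 FB hmu // new; apply/eqP; ring.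
    by rewrite hF rootZ ?root_prod_XsubC // lead_coef_eq0 artin_schreier_neq0.
  have e : \sum_(i < m.+1) (mu i)^-1 = \sum_(i < m) (mu i)^-1 + (x + (mu m - x))^-1.
    by rewrite big_ord_recr /= [x + _]addrC subrK.
  split; first by rewrite e; apply/allpairsP; exists (\sum_(i < m) (mu i)^-1, mu m - x).
  move=> l /cases[->|/tn //]; rewrite e.
  set s := \sum_(i < m) _ in tin *; set f := mu m - x in fin *.
  have : 'X - (- s^-1 - f)%:P \in avoided.
    by rewrite inE !mem_cat; rewrite (allpairs_f (fun s f => 'X - (- s^-1 - f)%:P)) ?orbT.
  move=> /hx; rewrite hornerXsubC; apply: contraNneq => sf.
  have -> : s = - (x + f)^-1 by apply/eqP; rewrite -addr_eq0 sf.
  by rewrite invrN invrK; apply/eqP; ring.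
Qed.

Lemma generic_parameters n : exists lam : 'I_n -> k,
  let c i := lam i ^+ p - lam i in
  [/\ forall i, c i != 0,
      forall i j, i != j -> (c i != c j) && (c i != - c j)
    & forall mu : 'I_n -> k, (forall i, mu i ^+ p = mu i + c i) ->
        forall m : 'I_n, \sum_(i : 'I_n | (i <= m)%N) (mu i)^-1 != 0].
Proof.
have [lam [T [c0 cs ct]]] := generic_sequence n.
exists (fun i => lam i); split=> [i|i j|mu hmu m]; [exact: c0| |].
  by rewrite -val_eqE => ij; apply: cs.
pose mu' i : k := if insub i is Some j then mu j else 0.
have mu'E (i : 'I_n) : mu' i = mu i by rewrite /mu' valK.
have [|_ /(_ m (ltn_ord m))] := ct mu'.
  by move=> i im; have := hmu (Ordinal im); rewrite -!mu'E.
rewrite (big_ord_widen n (fun i => (mu' i)^-1)) //.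
by under eq_bigr => i _ do rewrite mu'E.
Qed.
End GenericParameters.

(** * Supermodules and representations *)

Section QueerElements.
Context {k : closedFieldType} {n : nat}.
Local Notation Mn := 'M[k]_n.+1.
Implicit Types (A B : Mn).

Definition queer_mx (b : bool) A : 'M[k]_(n.+1 + n.+1) :=
  if b then block_mx 0 A A 0 else block_mx A 0 0 A.

Lemma queer_mx_linear b : linear (queer_mx b).
Proof.
by case: b => a A B; rewrite /queer_mx scale_block_mx add_block_mx !scaler0 !addr0.
Qed.

Lemma queer_mxM b b' A B : queer_mx b A *m queer_mx b' B = queer_mx (b (+) b') (A *m B).
Proof.
by case: b b' => [] []; rewrite /queer_mx /= mulmx_block !(mul0mx, mulmx0, addr0, add0r).
Qed.

Lemma queer_mx_part b A : queer_mx b A \in gl_part b.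
Proof.
apply/gl_partP; case: b; rewrite /hpart /queer_mx;
  by rewrite ?block_mxKul ?block_mxKur ?block_mxKdl ?block_mxKdr.
Qed.

Lemma queer_mx_queer b A : queer_mx b A \in queer k n.+1.
Proof. by case: b; apply/queerP; [exists 0, A | exists A, 0]. Qed.

Lemma queer_mx_sbr b b' A B : sbr (queer_mx b A) (queer_mx b' B) =
  queer_mx (b (+) b') (A *m B - (-1) ^+ (b && b') *: (B *m A)).
Proof.
have := queer_mx_linear (b (+) b') (- (-1) ^+ (b && b')) (B *m A) (A *m B).
rewrite (sbr_homog (queer_mx_part _ _) (queer_mx_part _ _)) !queer_mxM.
by rewrite [b' (+) b]addbC !scaleNr => e; rewrite addrC -e addrC.
Qed.

Lemma queer_mx_split X : X \in queer k n.+1 -> exists A B, X = queer_mx false A + queer_mx true B.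
Proof.
by move=> /queerP[A [B ->]]; exists A, B; rewrite add_block_mx !(addr0, add0r).
Qed.

(** The odd part of a bracket in q(n) is a sum of ordinary commutators. *)
Lemma queer'_trace X : X \in queer' k n.+1 -> X \in queer k n.+1 /\ \tr (ursubmx X) = 0.
Proof.
have gen Y : Y \in [seq sbr X Y | X <- vbasis (queer k n.+1), Y <- vbasis (queer k n.+1)] ->
    Y \in queer k n.+1 /\ \tr (ursubmx Y) = 0.
  move=> /allpairsP[[X1 X2] /= [/vbasis_mem q1 /vbasis_mem q2 ->]]; split; first exact: sbr_queer.
  have [A [B ->]] := queer_mx_split q1; have [C [D ->]] := queer_mx_split q2.
  have sDl Z T U : sbr (Z + T) U = sbr Z U + sbr T U := linearD (sbrr U) Z T.
  have sDr Z T U : sbr U (Z + T) = sbr U Z + sbr U T := linearD (sbr U) Z T.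
  rewrite sDl !sDr !queer_mx_sbr /=.
  rewrite !expr0 !scale1r expr1 !scaleN1r.
  rewrite !add_block_mx block_mxKur !(addr0, add0r) !raddfD /= !raddfN /=.
  by rewrite ![\tr (A *m _)]mxtrace_mulC ![\tr (B *m _)]mxtrace_mulC !subrr addr0.
move: gen; set s := [seq _ | _ <- _, _ <- _] => gen qX.
have {}qX : X \in <<in_tuple s>>%VS by [].
rewrite (coord_span qX); split.
  by apply: memv_suml => i _; apply: memvZ; apply: (gen _ _).1; apply: mem_nth.
have lin a Y Z : \tr (ursubmx (a *: Y + Z)) = a * \tr (ursubmx Y) + \tr (ursubmx Z) :> k.
  rewrite -mxtraceZ -mxtraceD; congr (\tr _); apply/matrixP => i j; by rewrite !mxE.
have tr0 : \tr (ursubmx (0 : 'M[k]_(n.+1 + n.+1))) = 0.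
  by rewrite /mxtrace big1 // => i _; rewrite !mxE.
elim/big_ind: _ => [|Y Z hY hZ|i _].
- exact: tr0.
- by rewrite -[Y]scale1r lin hY hZ mulr0 addr0.
- by rewrite -[_ *: _]addr0 lin tr0 (gen _ _).2 ?mulr0 ?addr0 //; apply: mem_nth.
Qed.

Lemma traceless_ind (K : Mn -> Prop) : (forall a A B, K A -> K B -> K (a *: A + B)) -> K 0 ->
  (forall i j, i != j -> K (delta_mx i j)) ->
  (forall i j, i != j -> K (delta_mx i i - delta_mx j j)) ->
  forall A, \tr A = 0 -> K A.
Proof.
move=> KL K0 Kij Kii A trA.
have KD B C : K B -> K C -> K (B + C) by move=> ? ?; rewrite -[B]scale1r; apply: KL.
have KZ a B : K B -> K (a *: B) by move=> ?; rewrite -[_ *: _]addr0; apply: KL.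
have -> : A = \sum_i (\sum_(j | j != i) A i j *: delta_mx i j + A i i *: (delta_mx i i - delta_mx ord0 ord0)).
  rewrite {1}[A]matrix_sum_delta big_split /=.
  under [X in _ = _ + X]eq_bigr => i _ do rewrite scalerBr.
  rewrite sumrB -scaler_suml -/(\tr A) trA scale0r subr0 -big_split; apply: eq_bigr => i _ /=.
  by rewrite (bigD1 i) //= addrC.
apply: (big_ind K) => // i _; apply: (KD).
  by apply: (big_ind K) => // j ij; apply: KZ; apply: Kij; rewrite eq_sym.
by apply: KZ; have [->|] := eqVneq i ord0; [rewrite subrr | apply: Kii].
Qed.

Context (two : 2%:R != 0 :> k).

(** An even element is the bracket of the odd identity with half of its odd counterpart, since odd
    elements bracket by the anticommutator; on the odd side, brackets of elementary matrices produce
    generators of the traceless ones. *)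
Lemma queer_mx_queer' b A : traceless b A -> queer_mx b A \in queer' k n.+1.
Proof.
case: b => /= [/eqP|_]; last first.
  have := mem_commutator (queer_mx_queer true 1%:M) (queer_mx_queer true (2%:R^-1 *: A)).
  rewrite queer_mx_sbr /= mul1mx mulmx1 expr1 scaleN1r opprK -scalerDl.
  by rewrite -[_ + _]mulr2n -[_^-1 *+ 2]mulr_natl mulfV // scale1r.
move: A; apply: (@traceless_ind (fun A => queer_mx true A \in queer' k n.+1)).
- by move=> a A B qA qB; rewrite (queer_mx_linear true); apply: memvD => //; apply: memvZ.
- by rewrite /queer_mx block_mx0 mem0v.
- move=> i j ij.
  have := mem_commutator (queer_mx_queer false (delta_mx i i)) (queer_mx_queer true (delta_mx i j)).
  rewrite queer_mx_sbr /= mul_delta_mx mul_delta_mx_0 1?eq_sym //.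
  by rewrite scaler0 subr0.
- move=> i j ij.
  have := mem_commutator (queer_mx_queer false (delta_mx i j)) (queer_mx_queer true (delta_mx j i)).
  by rewrite queer_mx_sbr /= !mul_delta_mx expr0 scale1r.
Qed.

Lemma queer'_split X : X \in queer' k n.+1 ->
  X = queer_mx false (ulsubmx X) + queer_mx true (ursubmx X) /\ traceless true (ursubmx X).
Proof.
move=> /queer'_trace[/queerP[A [B ->]]]; rewrite /traceless block_mxKul block_mxKur => /eqP tB.
by split=> //; rewrite add_block_mx !(addr0, add0r).
Qed.

Lemma queer'_homog i X : X \in queer' k n.+1 -> X \in gl_part i ->
  exists2 A, traceless i A & X = queer_mx i A.
Proof.
move=> /queer'_split[e tB]; rewrite e => /gl_partP <-.
have hD (Y Z : 'M[k]_(n.+1 + n.+1)) : hpart i (Y + Z) = hpart i Y + hpart i Z := raddfD (hpart i) Y Z.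
have p0 b (A : Mn) : hpart i (queer_mx b A) = if i == b then queer_mx b A else 0.
  rewrite -{1}(gl_partP _ _ (queer_mx_part b A)) hpart_hpart.
  by case: eqP => // ->; apply/gl_partP/queer_mx_part.
rewrite hD !p0; case: i {p0 hD}; rewrite /= ?addr0 ?add0r.
  by exists (ursubmx X).
by exists (ulsubmx X).
Qed.
End QueerElements.

(** * From supermodules to representations *)

Section SupermoduleRep.
Context {k : closedFieldType} {n : nat} (two : 2%:R != 0 :> k).
Context (S : supermodule (queer' k n.+1)).
Local Notation M := (sm_space S).
Context (nz : exists v : M, v != 0).
Local Notation E := (endo nz).
Local Notation Mn := 'M[k]_n.+1.

Definition parity_op : E.
Proof.
exists (fun v : M => ((v.1, - v.2) : M)) => a v w.
by congr pair => /=; rewrite opprD scalerN.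
Defined.

Definition sm_op (b : bool) (A : Mn) : E.
Proof.
exists (fun v : M => sm_act (vsproj (queer' k n.+1) (queer_mx b A)) v : M).
exact: sm_act_linear_r.
Defined.

Lemma sm_opE b A v : sm_op b A v = sm_act (vsproj (queer' k n.+1) (queer_mx b A)) v.
Proof. by []. Qed.

Lemma parity_homog (b : bool) (v : M) : homog b v -> parity_op v = (-1) ^+ b *: v.
Proof.
case: v => v0 v1; case: b => /= ->; rewrite ?expr0 ?scale1r ?expr1 ?scaleN1r.
  by congr pair; rewrite /= oppr0.
by congr pair; rewrite /= oppr0.
Qed.

Lemma homog_split (v : M) : exists v0 v1 : M, [/\ homog false v0, homog true v1 & v = v0 + v1].
Proof.
case: v => v0 v1; exists (v0, 0), (0, v1); split=> //.
by congr pair; rewrite /= ?addr0 ?add0r.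
Qed.

Lemma sm_is_rep : is_rep parity_op sm_op.
Proof.
have act_part b A : traceless b A -> vsval (vsproj (queer' k n.+1) (queer_mx b A)) \in gl_part b.
  by move=> tA; rewrite vsprojK ?queer_mx_part ?queer_mx_queer'.
split.
- move=> b a A B; apply: endoP => v.
  by rewrite eaddE escaleE !sm_opE queer_mx_linear linearP sm_act_linear_l.
- move=> b b' A B tA tB; apply: endoP => v.
  have := sm_act_sbr v (act_part b A tA) (act_part b' B tB).
  rewrite /sbr_in !vsprojK ?queer_mx_queer' // queer_mx_sbr.
  by rewrite eaddE escaleE !emulE !sm_opE => ->; rewrite addrC subrK.
- move=> b A tA; apply: endoP => v; have [v0 [v1 [h0 h1 ->]]] := homog_split v.
  rewrite !eD !escaleE !emulE.
  have a0 : homog (b (+) false) (sm_op b A v0) by apply: sm_act_homog => //; apply: act_part.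
  have a1 : homog (b (+) true) (sm_op b A v1) by apply: sm_act_homog => //; apply: act_part.
  rewrite (parity_homog a0) (parity_homog a1) (parity_homog h0) (parity_homog h1) !eZ.
  by rewrite !signr_addb -!scalerA.
- by apply: endoP => -[v0 v1]; rewrite emulE e1E; congr pair; rewrite /= opprK.
Qed.

(** A subspace stable under the parity operator contains v + Pv and v - Pv, hence both homogeneous
    components of v, as 2 is invertible. *)
Lemma sm_irreducible : irreducible S -> irreducible_rep parity_op sm_op.
Proof.
case=> _ irr W [sW PW RW]; apply: irr; split; [by case: sW | exact: sW.2| |].
- move=> v Wv; have W2 u : W (2%:R *: u) -> W u.
    by move=> /(subZ sW 2%:R^-1); rewrite scalerA mulVf // scale1r.
  split; apply: W2.
    suff -> : 2%:R *: ((v.1, 0) : M) = v + parity_op v by apply: (subD sW) => //; apply: PW.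
    by congr pair; rewrite /= ?scaler0 ?subrr // scaler_nat.
  suff -> : 2%:R *: ((0, v.2) : M) = v - parity_op v by apply: (subB sW) => //; apply: PW.
  by congr pair; rewrite /= ?scaler0 ?subrr ?opprK // scaler_nat.
- move=> x v Wv; have [e t] := queer'_split (subvsP x).
  have -> : x = vsproj (queer' k n.+1) (queer_mx false (ulsubmx (vsval x)))
      + vsproj (queer' k n.+1) (queer_mx true (ursubmx (vsval x))).
    by rewrite -[LHS]vsvalK {1}e linearD.
  rewrite -[X in X + _]scale1r sm_act_linear_l scale1r.
  by apply: (subD sW); [apply: (RW false) | apply: (RW true)].
Qed.
End SupermoduleRep.

Lemma irreducible_nz (k : fieldType) m n (g : {vspace 'M[k]_(m + n)}) (S : supermodule g) :
  irreducible S -> exists v : sm_space S, v != 0.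
Proof. by case=> -[v /eqP v0] _; exists v. Qed.

Theorem irreducible_dim_le (k : closedFieldType) (p n : nat) (hp : p \in [pchar k])
    (hp2 : (2 < p)%N) (S : supermodule (queer' k n.+1)) :
  irreducible S -> exists2 d, has_dim (sm_space S) d & (d <= irr_dim p n.+1)%N.
Proof.
move=> irr; have nz := irreducible_nz irr; have two := two_neq0 hp hp2.
by apply: (upper_bound hp hp2 (sm_is_rep two nz)); apply: sm_irreducible.
Qed.

HB.instance Definition _ (k : fieldType) (M : lmodType k) (nz : exists v : M, v != 0) (x : endo nz) :=
  GRing.isLinear.Build k M M _ (efun x) (efun_linear x).

(** * From submodules of a finite-dimensional representation to supermodules *)

Section FiniteDimension.
Context {k : closedFieldType} {V : vectType k} {nz : exists v : V, v != 0}.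
Context {n : nat} (two : 2%:R != 0 :> k).
Local Notation E := (endo nz).

Lemma subspace_vspace (K : V -> Prop) : subspace K ->
  exists U : {vspace V}, forall v, v \in U <-> K v.
Proof.
move=> sK; pose Q m := `[< exists2 U : {vspace V}, (forall v, v \in U -> K v) & \dim U = m >].
have Q0 : exists m, Q m.
  exists 0%N; apply/asboolP; exists 0%VS; last exact: dimv0.
  by move=> v; rewrite memv0 => /eqP ->; case: sK.
have Qb m : Q m -> (m <= dim V)%N.
  by move=> /asboolP[U _ <-]; rewrite -dimvf dimvS // subvf.
have [m /asboolP[U UK dU] mx] := ex_maxnP Q0 Qb.
exists U => v; split=> [/UK //|Kv].
have : Q (\dim (U + <[v]>)).
  apply/asboolP; exists (U + <[v]>)%VS => // _ /memv_addP[u uU [_ /vlineP[a ->] ->]].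
  by apply: (subD sK); [apply: UK | apply: (subZ sK)].
move=> /mx; rewrite -dU => le; have e : U = (U + <[v]>)%VS.
  by apply/eqP; rewrite eqEdim addvSl.
by rewrite e; apply: subvP (addvSr _ _) _ (memv_line v).
Qed.

(** A nonzero submodule of least dimension; [subspace_vspace] turns the competing predicates into
    subspaces with a dimension. *)
Lemma minimal_submodule (P : E) (R : bool -> 'M[k]_n.+1 -> E) :
  exists W : {vspace V}, [/\ submodule P R (fun v => v \in W), nontrivial (fun v => v \in W)
    & forall K, submodule P R K -> (forall v, K v -> v \in W) ->
        (forall v, K v -> v = 0) \/ (forall v, v \in W -> K v)].
Proof.
pose Q m := `[< exists W : {vspace V}, [/\ submodule P R (fun v => v \in W),
  nontrivial (fun v => v \in W) & \dim W = m] >].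
have Q0 : exists m, Q m.
  exists (\dim {:V}); apply/asboolP; exists {:V}%VS; split=> //.
    split=> [|v _|b A _ v _]; rewrite ?memvf //.
    by split=> [|a u v _ _]; rewrite memvf.
  by have [v v0] := nz; exists v; rewrite ?memvf.
have [m /asboolP[W [sW nW dW]] mn] := ex_minnP Q0.
exists W; split=> // K sK KW; have [U UK] := subspace_vspace (let: And3 h _ _ := sK in h).
have UW : (U <= W)%VS by apply/subvP => v /UK; apply: KW.
have [U0|U0] := eqVneq U 0%VS.
  by left=> v /UK; rewrite U0 memv0 => /eqP.
right=> v vW; apply/UK; suff <- : W = U by [].
apply/eqP; rewrite eq_sym eqEdim UW dW; apply: mn; apply/asboolP; exists U; split=> //.
  have [hs hP hR] := sK; split.
  - by split=> [|a u w uU wU]; [rewrite mem0v | apply/memvD/wU/memvZ].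
  - by move=> u /UK /hP /UK.
  - by move=> b A tA u /UK /(hR b A tA) /UK.
exists (vpick U); [exact: memv_pick | by rewrite vpick0].
Qed.

Context (P : E) (R : bool -> 'M[k]_n.+1 -> E) (rep : is_rep P R).
Context (W : {vspace V}) (subW : submodule P R (fun v => v \in W)).

Lemma half2 (v : V) : 2%:R^-1 *: (v + v) = v.
Proof. by rewrite -mulr2n -scaler_nat scalerA mulVf // scale1r. Qed.

(** The eigenspaces of the parity in [W], which supply the two homogeneous spaces that a
    [supermodule] is made of. *)
Definition graded_part (b : bool) : {vspace V} :=
  (W :&: lker (linfun (P - (-1) ^+ b *: 1 : E)))%VS.

Lemma graded_partP b v : v \in graded_part b <-> v \in W /\ P v = (-1) ^+ b *: v.
Proof.
have e : linfun (P - (-1) ^+ b *: 1 : E) v = P v - (-1) ^+ b *: v by rewrite lfunE.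
rewrite memv_cap memv_ker e subr_eq0.
by split=> [/andP[-> /eqP]|[-> ->]]; rewrite ?eqxx.
Qed.

Definition component (b : bool) (v : V) : V := 2%:R^-1 *: (v + (-1) ^+ b *: P v).

Lemma component_linear b : linear (component b).
Proof.
move=> a u v; rewrite /component eD eZ !scalerDr !scalerA addrACA.
by congr (_ + _ + (_ + _)); congr (_ *: _); ring.
Qed.

Lemma component_part b v : v \in W -> component b v \in graded_part b.
Proof.
case: subW => sW PW _ vW; apply/graded_partP; split.
  by apply: memvZ; apply: memvD => //; apply: memvZ; apply: PW.
rewrite /component eZ eD eZ -[P (P v)]emulE (rep_involution rep) e1E scalerA mulrC -scalerA.
by congr (_ *: _); rewrite scalerDr scalerA -signr_addb addbb expr0 scale1r addrC.
Qed.

Lemma component_sum v : component false v + component true v = v.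
Proof.
by rewrite -scalerDr expr0 scale1r expr1 scaleN1r addrACA subrr addr0 half2.
Qed.

Lemma component_graded b b' v : v \in graded_part b' -> component b v = if b == b' then v else 0.
Proof.
move=> /graded_partP[_ e]; rewrite /component e scalerA -signr_addb.
case: b b' {e} => [] []; rewrite /= ?expr0 ?expr1 ?scale1r ?scaleN1r ?half2 //.
  by rewrite subrr scaler0.
by rewrite subrr scaler0.
Qed.

Local Notation M := (subvs_of (graded_part false) * subvs_of (graded_part true))%type.

Definition to_module (v : V) : M :=
  (vsproj _ (component false v), vsproj _ (component true v)).
Definition of_module (m : M) : V := vsval m.1 + vsval m.2.

Lemma of_module_linear : linear of_module.
Proof. by move=> a m m'; rewrite /of_module !linearP scalerDr addrACA. Qed.

Lemma of_module0 : of_module 0 = 0.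
Proof.
by have := of_module_linear (-1) 0 0; rewrite scaler0 addr0 => {1}->; rewrite scaleN1r addNr.
Qed.

Lemma to_module_linear : linear to_module.
Proof. by move=> a u v; rewrite /to_module !component_linear !linearP. Qed.

Lemma of_moduleW m : of_module m \in W.
Proof.
by apply: memvD; [have /graded_partP[] := subvsP m.1 | have /graded_partP[] := subvsP m.2].
Qed.

Lemma to_moduleK v : v \in W -> of_module (to_module v) = v.
Proof.
by move=> vW; rewrite /of_module !vsprojK ?component_part // component_sum.
Qed.

Lemma of_moduleK m : to_module (of_module m) = m.
Proof.
case: m => a b; rewrite /to_module /of_module /=.
rewrite -[vsval a]scale1r !component_linear.
rewrite !(component_graded _ (subvsP a)) !(component_graded _ (subvsP b)) /=.
by rewrite !scale1r addr0 add0r !vsvalK.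
Qed.

Lemma of_module_homog (b : bool) (m : M) : homog b m -> P (of_module m) = (-1) ^+ b *: of_module m.
Proof.
case: m => u v; have /graded_partP[_ hu] := subvsP u; have /graded_partP[_ hv] := subvsP v.
by rewrite /of_module; case: b => /= ->; rewrite linear0 ?add0r ?addr0.
Qed.

Lemma to_module_homog (b : bool) v : P v = (-1) ^+ b *: v -> homog b (to_module v).
Proof.
move=> e; rewrite /to_module /component e.
case: b {e} => /=; rewrite ?expr0 ?expr1 !scale1r ?scaleN1r ?subrr ?scaler0 ?linear0 //.
Qed.

Definition queer_op (x : subvs_of (queer' k n.+1)) : E :=
  R false (ulsubmx (vsval x)) + R true (ursubmx (vsval x)).

Lemma queer_op_linear : linear queer_op.
Proof.
move=> a x y; have lin (b : bool) X Y : R b (a *: X + Y) = a *: R b X + R b Y.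
  exact: (rep_linear rep).
rewrite /queer_op scalerDr -addrACA -!lin; congr (R _ _ + R _ _).
  by apply/matrixP => i j; rewrite linearP !mxE.
by apply/matrixP => i j; rewrite linearP !mxE.
Qed.

Lemma queer_opE (b : bool) A x : vsval x = queer_mx b A -> queer_op x = R b A.
Proof.
rewrite /queer_op => ->; case: b; rewrite /queer_mx block_mxKul block_mxKur.
  by rewrite (R0 rep) add0r.
by rewrite (R0 rep) addr0.
Qed.

Lemma queer_opW x v : v \in W -> queer_op x v \in W.
Proof.
case: subW => _ _ RW vW; have [_ t] := queer'_split (subvsP x).
by rewrite eaddE; apply: memvD; [apply: (RW false) | apply: (RW true)].
Qed.

Definition module_act (x : subvs_of (queer' k n.+1)) (m : M) : M :=
  to_module (queer_op x (of_module m)).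

Definition rep_supermodule : supermodule (queer' k n.+1).
Proof.
apply: (@Supermodule k _ _ _ (subvs_of (graded_part false)) (subvs_of (graded_part true)) module_act).
- by move=> m a x y; rewrite /module_act queer_op_linear eaddE escaleE to_module_linear.
- by move=> x a u v; rewrite /module_act of_module_linear eD eZ to_module_linear.
- move=> i j x m xi mj; apply: to_module_homog.
  have [A tA e] := queer'_homog (subvsP x) xi; rewrite (queer_opE e).
  have := congr1 (fun u : E => u (of_module m)) (rep_parity rep tA).
  by rewrite escaleE !emulE (of_module_homog mj) eZ scalerA -signr_addb.
- move=> i j x y m xi yj.
  have [A tA eA] := queer'_homog (subvsP x) xi; have [B tB eB] := queer'_homog (subvsP y) yj.
  have e : vsval (sbr_in x y) = queer_mx (i (+) j) (A *m B - (-1) ^+ (i && j) *: (B *m A)).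
    by rewrite /sbr_in vsprojK ?sbr_queer' ?subvsP // eA eB queer_mx_sbr.
  rewrite /module_act (queer_opE e) !to_moduleK ?queer_opW ?of_moduleW //.
  rewrite (queer_opE eA) (queer_opE eB).
  have := congr1 (fun u : E => u (of_module m)) (rep_bracket rep tA tB).
  rewrite eaddE escaleE !emulE => ->.
  by rewrite to_module_linear [RHS]addrC addKr.
Defined.

Lemma rep_supermodule_irreducible : nontrivial (fun v => v \in W) ->
  (forall K, submodule P R K -> (forall v, K v -> v \in W) ->
     (forall v, K v -> v = 0) \/ (forall v, v \in W -> K v)) ->
  irreducible rep_supermodule.
Proof.
case: subW => sW PW RW [w wW w0] minW.
have to0 : to_module 0 = 0.
  by have := to_module_linear (-1) 0 0; rewrite scaler0 addr0 => {1}->; rewrite scaleN1r addNr.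
split.
  exists (to_module w) => /(congr1 of_module); rewrite to_moduleK // => e.
  by move/eqP: w0; apply; rewrite e; exact: of_module0.
move=> U [U0 Ulin Ugr Uact].
have UN m : U m -> U ((m.1, - m.2) : M).
  move=> Um; have [h0 h1] := Ugr m Um; have := Ulin (-1) _ _ h1 h0.
  by congr U; congr pair; rewrite /= ?scaler0 ?add0r ?addr0 ?scaleN1r.
have parity v : v \in W -> to_module (P v) = ((to_module v).1, - (to_module v).2).
  move=> vW; rewrite /to_module /component -[P (P v)]emulE (rep_involution rep) e1E /=.
  rewrite expr0 !scale1r expr1 !scaleN1r; congr pair; first by rewrite [P v + v]addrC.
  by rewrite -raddfN -scalerN opprB.
have act b A v : traceless b A -> v \in W ->
    to_module (R b A v) = module_act (vsproj _ (queer_mx b A)) (to_module v).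
  move=> tA vW; rewrite /module_act to_moduleK //; congr (to_module (_ v)).
  by rewrite (@queer_opE b A) // vsprojK ?queer_mx_queer'.
have [||h|h] := minW (fun v => v \in W /\ U (to_module v)).
- split.
  + split; first by split; [apply: mem0v | rewrite to0].
    move=> a u v [uW Uu] [vW Uv]; split; first by apply: sW.2.
    by rewrite to_module_linear; apply: Ulin.
  + by move=> v [vW Uv]; split; [apply: PW | rewrite parity //; apply: UN].
  + move=> b A tA v [vW Uv]; split; first exact: (RW b A tA).
    by rewrite act //; apply: Uact.
- by move=> v [].
- left=> m Um; have := h (of_module m); rewrite of_moduleK => e.
  by rewrite -[m]of_moduleK e //; split=> //; apply: of_moduleW.
- by right=> m; have := h _ (of_moduleW m); rewrite of_moduleK => -[].
Qed.

Lemma rep_supermodule_dim_ge D : dim_ge (fun v => v \in W) D ->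
  dim_ge (M := sm_space rep_supermodule) (fun=> True) D.
Proof.
case=> J [b [cJ bW fb]]; exists J, (fun j => to_module (b j)); split=> // c e; apply: fb.
transitivity (of_module (\sum_j c j *: to_module (b j))); last by rewrite e of_module0.
have oD : {morph of_module : x y / x + y}.
  by move=> x y; rewrite -[x]scale1r of_module_linear !scale1r.
rewrite (big_morph of_module oD of_module0); apply: eq_bigr => j _.
by rewrite -[c j *: to_module _]addr0 of_module_linear of_module0 addr0 to_moduleK.
Qed.
End FiniteDimension.

(** A minimal submodule of the Fock representation is irreducible, so the upper bound applies to it,
    while [lower_bound] applies to it as a submodule. *)
Theorem irreducible_exists (k : closedFieldType) (p n : nat) (hp : p \in [pchar k])
    (hp2 : (2 < p)%N) : exists S : supermodule (queer' k n.+1),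
  irreducible S /\ has_dim (sm_space S) (irr_dim p n.+1).
Proof.
have two := two_neq0 hp hp2.
have [lam [c0 cs ct]] := generic_parameters hp n.+1.
have [V [nz [P [z [d fk]]]]] := fock_exists hp kap (sig lam) (enum_uniq {: 'I_n.+1 * 'I_n.+1}).
have rep := fock_is_rep fk.
have [W [subW ntW minW]] := minimal_submodule P (fock_rep z d).
exists (rep_supermodule two rep subW).
have irr := rep_supermodule_irreducible two rep subW ntW minW; split=> //.
have lb := lower_bound hp hp2 rep (fock_nilpotent hp hp2 fk) (fock_torus hp hp2 fk) c0 cs ct subW ntW.
have [D hD le] := irreducible_dim_le hp hp2 irr.
suff <- : D = irr_dim p n.+1 by [].
by apply/eqP; rewrite eqn_leq le (has_dim_ge hD) //; apply: rep_supermodule_dim_ge.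
Qed.

(** * Centralizers and linear forms *)

Section Centralizer.
Context {k : closedFieldType} {n : nat}.
Local Notation Mn := 'M[k]_n.

Definition upper_triangular (A : Mn) := forall i j : 'I_n, (j < i)%N -> A i j = 0.

Lemma upper_mul_le (A B : Mn) (i j : 'I_n) : upper_triangular A -> upper_triangular B -> (j <= i)%N ->
  (A *m B) i j = if i == j then A i i * B i i else 0.
Proof.
move=> uA uB ji; have [<-|ij] := eqVneq i j.
  rewrite mxE (bigD1 i) //= big1 ?addr0 // => l li.
  have [lt|] := ltnP l i; first by rewrite uA ?mul0r.
  rewrite leq_eqVlt => /predU1P[/val_inj e|lt]; first by rewrite e eqxx in li.
  by rewrite uB ?mulr0.
have {}ji : (j < i)%N by rewrite ltn_neqAle ji eq_sym andbT.
rewrite mxE big1 // => l _.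
have [lt|le] := ltnP l i; first by rewrite uA ?mul0r.
by rewrite uB ?mulr0 // (leq_trans ji le).
Qed.

(* Commutation with an upper triangular matrix maps upper triangular matrices *)
(* to strictly upper triangular ones, so its kernel has dimension at least n. *)
Lemma upper_centralizer_dim (T : Mn) : upper_triangular T ->
  exists2 U : {vspace Mn}, (n <= \dim U)%N & forall A, A \in U -> T *m A = A *m T.
Proof.
move=> uT; have [|N NP] := @subspace_vspace _ _ (fun A : Mn => forall i j : 'I_n, (j <= i)%N -> A i j = 0).
  split=> [i j _|a A B hA hB i j ji]; first by rewrite mxE.
  by rewrite !mxE hA // hB // mulr0 addr0.
pose D := limg (linfun (@diag_mx k n)).
have DP A : A \in D -> exists d, A = diag_mx d by move=> /memv_imgP[d _ ->]; exists d; rewrite lfunE.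
have dD : \dim D = n.
  rewrite /D limg_dim_eq ?dimvf; first exact: mul1n.
  apply/eqP; rewrite -subv0; apply/subvP => d; rewrite memv_cap memvf memv_ker lfunE memv0 /=.
  move=> /eqP/matrixP e; apply/eqP/rowP => i; have := e i i; rewrite !mxE eqxx mulr1n.
  by move=> ->.
have dU : (\dim (N + D) = \dim N + n)%N.
  rewrite dimv_disjoint_sum ?dD //; apply/eqP; rewrite -subv0; apply/subvP => A.
  rewrite memv_cap => /andP[/NP hN /DP[d e]]; rewrite memv0; apply/eqP/matrixP => i j.
  rewrite mxE; have [ji|ij] := leqP j i; first exact: hN.
  by rewrite e mxE -val_eqE /= ltn_eqF.
have UP A : A \in (N + D)%VS -> upper_triangular A.
  move=> /memv_addP[B /NP hB [_ /DP[d ->] ->]] i j ji.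
  by rewrite !mxE hB 1?ltnW // -val_eqE /= gtn_eqF // addr0.
have lin : linear (fun A => T *m A - A *m T).
  by move=> a A B; rewrite mulmxDr mulmxDl -scalemxAr -scalemxAl scalerBr opprD addrACA.
pose f := GRing.isLinear.Build k Mn Mn _ _ lin.
pose F : {linear Mn -> Mn} := HB.pack (fun A : Mn => T *m A - A *m T) f.
exists ((N + D) :&: lker (linfun F))%VS.
  have := limg_ker_dim (linfun F) (N + D); rewrite dU.
  have /dimvS : (linfun F @: (N + D) <= N)%VS.
    apply/subvP => _ /memv_imgP[A /UP uA ->]; rewrite lfunE /=; apply/NP => i j ji.
    rewrite mxE [X in _ + X]mxE !upper_mul_le //.
    by case: eqP => _; rewrite ?subrr // mulrC subrr.
  by move=> le e; rewrite -(leq_add2l (\dim N)) -e addnC leq_add2r.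
move=> A; rewrite memv_cap => /andP[_]; rewrite memv_ker lfunE /= subr_eq0.
by move/eqP.
Qed.

(** Centralizers of conjugate matrices are conjugate, so the triangular case suffices. *)
Lemma centralizer_dim (C : Mn) :
  exists2 U : {vspace Mn}, (n <= \dim U)%N & forall A, A \in U -> C *m A = A *m C.
Proof.
have [g gu gt] := upper_trigonalize C.
have [|U dU hU] := @upper_centralizer_dim (invmx g *m C *m g); first by move=> i j; apply: gt.
have lin : linear (fun A => g *m A *m invmx g).
  by move=> a A B; rewrite mulmxDr mulmxDl -scalemxAr -scalemxAl.
pose f := GRing.isLinear.Build k Mn Mn _ _ lin.
pose F : {linear Mn -> Mn} := HB.pack (fun A : Mn => g *m A *m invmx g) f.
exists (linfun F @: U)%VS.
  rewrite limg_dim_eq //; apply/eqP; rewrite -subv0; apply/subvP => A.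
  rewrite memv_cap memv_ker lfunE /= memv0 => /andP[_ /eqP e].
  by rewrite -[A](mulKmx gu) -[g *m A](mulmxKV gu) e mul0mx mulmx0.
move=> _ /memv_imgP[A /hU e ->]; rewrite lfunE /=.
have -> : C *m (g *m A *m invmx g) = g *m (invmx g *m C *m g *m A) *m invmx g.
  by rewrite !mulmxA mulmxV // mul1mx.
by rewrite e !mulmxA mulmxK.
Qed.
End Centralizer.

HB.instance Definition _ (k : closedFieldType) n b :=
  GRing.isLinear.Build k 'M[k]_n.+1 'M[k]_(n.+1 + n.+1) _ (@queer_mx k n b) (queer_mx_linear b).

Arguments queer_mx : simpl never.

(** * The centralizer of a linear form and the Kac-Weisfeiler value *)

Section KacWeisfeiler.
Context {k : closedFieldType} (p : nat) (hp : p \in [pchar k]) (hp2 : (2 < p)%N) {n : nat}.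
Local Notation Mn := 'M[k]_n.+1.
Local Notation g := (queer' k n.+1).
Local Notation theta_type := 'Hom(subvs_of (gpart g false), k^o).
Let two := two_neq0 hp hp2.

Lemma queer_mx_inj b : injective (@queer_mx k n b).
Proof.
move=> A B e; have := congr1 (fun X => if b then ursubmx X else ulsubmx X) e.
by case: b {e}; rewrite /queer_mx ?block_mxKur ?block_mxKul.
Qed.

Lemma queer_mx_dim b (U : {vspace Mn}) : \dim (linfun (queer_mx b) @: U) = \dim U.
Proof.
apply: limg_dim_eq; apply/eqP; rewrite -subv0; apply/subvP => A.
rewrite memv_cap memv_ker lfunE memv0 => /andP[_ /eqP e].
by apply/eqP/(@queer_mx_inj b); rewrite e linear0.
Qed.

Lemma dim_even_part : \dim (gpart g false) = (n.+1 ^ 2)%N.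
Proof.
have -> : gpart g false = limg (linfun (queer_mx false)).
  apply/vspaceP => X; rewrite memv_cap; apply/andP/memv_imgP => [[gX X0]|[A _ ->]].
    by have [A _ ->] := queer'_homog gX X0; exists A; rewrite ?memvf ?lfunE.
  by rewrite lfunE queer_mx_part queer_mx_queer'.
by rewrite queer_mx_dim dimvf -mulnn.
Qed.

Lemma dim_odd_part : \dim (gpart g true) = (n.+1 ^ 2 - 1)%N.
Proof.
pose tr : 'Hom(Mn, k^o) := linfun (@mxtrace k n.+1 : Mn -> k^o).
have -> : gpart g true = (linfun (queer_mx true) @: lker tr)%VS.
  apply/vspaceP => X; rewrite memv_cap; apply/andP/memv_imgP => [[gX X1]|[A]].
    have [A tA ->] := queer'_homog gX X1; exists A; rewrite ?lfunE //.
    by rewrite memv_ker lfunE.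
  by rewrite memv_ker lfunE => tA ->; rewrite lfunE queer_mx_part queer_mx_queer'.
have e := limg_ker_dim tr fullv; rewrite capfv dimvf in e.
rewrite queer_mx_dim -mulnn -[(n.+1 * n.+1)%N]/(dim Mn) -e.
suff -> : limg tr = fullv by rewrite dimvf /= addnK.
apply/vspaceP => a; rewrite memvf; apply/memv_imgP; exists (a *: delta_mx 0 0); rewrite ?memvf //.
rewrite lfunE /= mxtraceZ; have := mxtrace_delta_mul 0 0 (1%:M : Mn).
by rewrite mulmx1 mxE => ->; rewrite mulr1.
Qed.

Lemma theta_ext_odd (theta : theta_type) A : theta_ext theta (queer_mx true A) = 0.
Proof. by rewrite /theta_ext /hpart /queer_mx block_mxKul block_mxKdr block_mx0 !linear0. Qed.

Lemma theta_ext_trace (theta : theta_type) :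
  exists C : Mn, forall A, theta_ext theta (queer_mx false A) = \tr (C *m A).
Proof.
exists (\matrix_(i, j) theta_ext theta (queer_mx false (delta_mx j i))) => A.
rewrite {1}[A]matrix_sum_delta !linear_sum /=.
under eq_bigr => i _ do rewrite !linear_sum.
rewrite exchange_big; apply: eq_bigr => j _ /=.
rewrite mxE; apply: eq_bigr => i _.
by rewrite mxE !linearZ /= mulrC.
Qed.

Lemma trace_theta (C : Mn) : exists theta : theta_type,
  forall A, theta_ext theta (queer_mx false A) = \tr (C *m A).
Proof.
have lin : linear (fun x : subvs_of (gpart g false) => \tr (C *m ulsubmx (vsval x)) : k^o).
  move=> a x y; set tx := \tr (C *m ulsubmx (vsval x)); set ty := \tr (C *m ulsubmx (vsval y)).
  rewrite -[RHS]/(a * tx + ty) -mxtraceZ -mxtraceD scalemxAr -mulmxDr.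
  by congr (\tr (_ *m _)); apply/matrixP => i j; rewrite linearP !mxE.
pose f := GRing.isLinear.Build k (subvs_of (gpart g false)) k^o _ _ lin.
pose F : {linear subvs_of (gpart g false) -> k^o} := HB.pack
  (fun x : subvs_of (gpart g false) => \tr (C *m ulsubmx (vsval x)) : k^o) f.
exists (linfun F) => A; rewrite /theta_ext.
rewrite (gl_partP _ _ (queer_mx_part _ _)) lfunE /= vsprojK ?block_mxKul //.
by rewrite memv_cap queer_mx_part queer_mx_queer'.
Qed.

Context (theta : theta_type) (C : Mn).
Hypothesis thetaC : forall A, theta_ext theta (queer_mx false A) = \tr (C *m A).

Lemma theta_cent_even A : C *m A = A *m C -> queer_mx false A \in gpart (theta_cent theta) false.
Proof.
move=> cA; rewrite memv_cap queer_mx_part andbT; apply/theta_centP.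
split=> [|Y /queer'_split[-> _]]; first exact: queer_mx_queer'.
have -> Z T U : sbr U (Z + T) = sbr U Z + sbr U T := linearD (sbr U) Z T.
rewrite !queer_mx_sbr linearD /= theta_ext_odd addr0 thetaC expr0 scale1r mulmxBr !mulmxA cA.
by rewrite raddfB /= -[X in _ - X]mxtrace_mulC mulmxA subrr.
Qed.

Lemma theta_cent_evenP X : X \in gpart (theta_cent theta) false ->
  exists2 A, X = queer_mx false A & C *m A = A *m C.
Proof.
rewrite memv_cap => /andP[/theta_centP[gX cX] X0].
have [A _ e] := queer'_homog gX X0; exists A => //; apply/matrixP => i j.
have := cX (queer_mx false (delta_mx j i)) (queer_mx_queer' two (isT : traceless false _)).
rewrite e queer_mx_sbr thetaC expr0 scale1r mulmxBr !mulmxA raddfB /=.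
rewrite [\tr (C *m A *m _)]mxtrace_mulC -[C *m _ *m _]mulmxA [\tr (C *m _)]mxtrace_mulC -mulmxA.
by rewrite !mxtrace_delta_mul => /eqP; rewrite subr_eq0 => /eqP.
Qed.

(** The condition is that CB + BC be orthogonal, for the trace form, to all traceless matrices,
    whose orthogonal is the scalars. *)
Lemma theta_cent_oddP X : X \in gpart (theta_cent theta) true ->
  exists B, [/\ X = queer_mx true B, \tr B = 0 & exists a, C *m B + B *m C = a%:M].
Proof.
rewrite memv_cap => /andP[/theta_centP[gX cX] X1].
have [B /eqP tB e] := queer'_homog gX X1; exists B; split=> //.
have h D : \tr D = 0 -> \tr (D *m (C *m B + B *m C)) = 0.
  move=> tD; have := cX (queer_mx true D) (queer_mx_queer' two (introT eqP tD : traceless true D)).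
  rewrite e queer_mx_sbr thetaC expr1 scaleN1r opprK mulmxDr raddfD /=.
  rewrite mulmxDr raddfD /= => <-; congr (_ + _).
    by rewrite [C *m (B *m D)]mulmxA [RHS]mxtrace_mulC.
  by rewrite [RHS]mxtrace_mulC -mulmxA.
set S := C *m B + B *m C in h *; exists (S 0 0).
apply/matrixP => i j; rewrite [RHS]mxE; have [->|ij] := eqVneq i j; last first.
  rewrite mulr0n -mxtrace_delta_mul; apply: h.
  have := mxtrace_delta_mul j i (1%:M : Mn); rewrite mulmx1 => ->.
  by rewrite mxE (negPf ij).
have := h (delta_mx j j - delta_mx 0 0); rewrite mulmxBl !raddfB /= !mxtrace_delta_mul mulr1n.
have -> : \tr (delta_mx j j : Mn) = \tr (delta_mx 0 0 : Mn).
  have t1 i' := mxtrace_delta_mul i' i' (1%:M : Mn).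
  by have := t1 j; have := t1 0; rewrite !mulmx1 => -> ->; rewrite !mxE !eqxx.
by rewrite subrr => /(_ erefl)/eqP; rewrite subr_eq0 => /eqP.
Qed.

Lemma b_even_le : (b_theta theta false <= n.+1 * n)%N.
Proof.
rewrite /b_theta dim_even_part; have [U dU hU] := centralizer_dim C.
have /dimvS : (linfun (queer_mx false) @: U <= gpart (theta_cent theta) false)%VS.
  by apply/subvP => _ /memv_imgP[A /hU cA ->]; rewrite lfunE; apply: theta_cent_even.
rewrite queer_mx_dim => le; rewrite -mulnn [X in (X - _)%N]mulnS leq_subLR leq_add2r.
exact: leq_trans dU le.
Qed.

End KacWeisfeiler.

Section MaximalValue.
Context {k : closedFieldType} (p : nat) (hp : p \in [pchar k]) (hp2 : (2 < p)%N) (n : nat).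
Local Notation Mn := 'M[k]_n.+1.
Local Notation g := (queer' k n.+1).
Local Notation theta_type := 'Hom(subvs_of (gpart g false), k^o).

Lemma kw_value_le (theta : theta_type) : (kw_value p theta <= irr_dim p n.+1)%N.
Proof.
have [C hC] := theta_ext_trace theta; have p0 := prime_gt0 (pcharf_prime hp).
apply: leq_mul; apply: leq_pexp2l => //.
  by rewrite subn1; apply/half_leq/(b_even_le hp hp2 hC).
by apply: uphalf_leq; rewrite /b_theta (dim_odd_part hp hp2) leq_subr.
Qed.

(* Parameters lam_i with generic lam_i^p - lam_i will do. *)
Lemma generic_diagonal : exists c : 'I_n.+1 -> k,
  [/\ forall i, c i != 0, forall i j, i != j -> (c i != c j) && (c i + c j != 0)
    & \sum_i (c i)^-1 != 0].
Proof.
have [lam [c0 cs ct]] := generic_parameters hp n.+1.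
have neg x : (- x) ^+ p = - x ^+ p :> k by rewrite exprNn -signr_odd (p_odd hp hp2) expr1 mulN1r.
exists lam; split.
- by move=> i; apply: contraNneq (c0 i) => ->; rewrite expr0n gtn_eqF ?subrr // (ltn_trans _ hp2).
- move=> i j ij; have /andP[h1 h2] := cs i j ij; apply/andP; split.
    by apply: contraNneq h1 => ->.
  by apply: contraNneq h2 => /eqP; rewrite addr_eq0 => /eqP ->; rewrite neg -opprB opprK addrC.
- have := ct lam _ ord_max; rewrite (eq_bigl xpredT); first by apply=> i; rewrite addrC subrK.
  by move=> i; rewrite -ltnS ltn_ord.
Qed.

(** For C diagonal with entries c_i, commuting matrices are diagonal. An odd B in the centralizer
    satisfies (c_i + c_j) B_ij = 0 off the diagonal and B_ii = a/(2 c_i) on it; trace 0 then forces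
    a = 0, as the sum of the 1/c_i is nonzero. *)
Lemma kw_value_generic : exists theta : theta_type, kw_value p theta = irr_dim p n.+1.
Proof.
have two := two_neq0 hp hp2; have [c [c0 cs csum]] := generic_diagonal.
pose C : Mn := diag_mx (\row_i c i).
have CE (A : Mn) i j : (C *m A) i j = c i * A i j by rewrite mul_diag_mx !mxE.
have EC (A : Mn) i j : (A *m C) i j = A i j * c j by rewrite mul_mx_diag !mxE.
have [theta hC] := trace_theta hp hp2 C; exists theta.
have even : b_theta theta false = (n.+1 * n)%N.
  apply/eqP; rewrite eqn_leq (b_even_le hp hp2 hC) /b_theta (dim_even_part hp hp2) /=.
  have sub : (gpart (theta_cent theta) false <=
      linfun (queer_mx false) @: limg (linfun (@diag_mx k n.+1)))%VS.
    apply/subvP => X /(theta_cent_evenP hp hp2 hC)[A -> /matrixP cA].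
    rewrite -(lfunE (queer_mx false)) memv_img //; apply/memv_imgP.
    exists (\row_i A i i); rewrite ?memvf // lfunE /=; apply/matrixP => i j.
    rewrite !mxE; have [->|ij] := eqVneq i j; first by rewrite mulr1n.
    have := cA i j; rewrite CE EC [c i * _]mulrC => /eqP; rewrite -subr_eq0 -mulrBr mulf_eq0 subr_eq0.
    by have /andP[/negPf -> _] := cs i j ij; rewrite orbF => /eqP ->; rewrite mulr0n.
  have := dimvS sub; rewrite queer_mx_dim => le1.
  have := limg_ker_dim (linfun (@diag_mx k n.+1)) fullv; rewrite dimvf => e.
  have le2 : (\dim (limg (linfun (@diag_mx k n.+1))) <= n.+1)%N.
    by rewrite -[X in (_ <= X)%N]mul1n -[(1 * n.+1)%N]/(dim 'rV[k]_n.+1) -e leq_addl.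
  rewrite -mulnn [X in (_ <= X - _)%N]mulnS leq_subRL ?leq_add2r; first exact: leq_trans le1 le2.
  by rewrite (leq_trans (leq_trans le1 le2)) // leq_addr.
have odd : b_theta theta true = (n.+1 ^ 2 - 1)%N.
  rewrite /b_theta (dim_odd_part hp hp2).
  suff -> : gpart (theta_cent theta) true = 0%VS by rewrite dimv0 subn0.
  apply/eqP; rewrite -subv0; apply/subvP => X /(theta_cent_oddP hp hp2 hC)[B [-> tB [a /matrixP aB]]].
  have eB i j : B i j * (c i + c j) = a *+ (i == j).
    by have := aB i j; rewrite mxE CE EC mxE mulrDr [c i * _]mulrC.
  have off i j : i != j -> B i j = 0.
    move=> ij; have := eB i j; rewrite (negPf ij) mulr0n => /eqP.
    by rewrite mulf_eq0; have /andP[_ /negPf ->] := cs i j ij; rewrite orbF => /eqP.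
  have di i : B i i = a / 2%:R * (c i)^-1.
    have := eB i i; rewrite eqxx mulr1n => <-; field.
    by rewrite two c0.
  have a0 : a / 2%:R = 0.
    move: tB; rewrite /mxtrace; under eq_bigr => i _ do rewrite di.
    by rewrite -mulr_sumr => /eqP; rewrite mulf_eq0 (negPf csum) orbF => /eqP.
  suff -> : B = 0 by rewrite memv0 linear0.
  apply/matrixP => i j; rewrite mxE; have [<-|/off //] := eqVneq i j.
  by rewrite di a0 mul0r.
by rewrite /kw_value even odd /irr_dim subSS subn0.
Qed.
End MaximalValue.

Theorem proposition5p3 (k : closedFieldType) (p : nat) (hp : p \in [pchar k])
    (hp2 : (2 < p)%N) (n : nat) (hn : (1 <= n)%N) :
  let N := (p ^ (n * (n - 1))./2 * 2 ^ uphalf (n ^ 2 - 1))%N in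
  [/\ is_max_irr_dim (queer' k n) N,
      is_max_kw_value p (queer' k n) N
    & super_KW1 p (queer' k n)].
Proof.
case: n hn => // n _ N.
have irr : is_max_irr_dim (queer' k n.+1) N.
  by split; [apply: irreducible_exists hp hp2 | apply: irreducible_dim_le hp hp2].
have kw : is_max_kw_value p (queer' k n.+1) N.
  by split; [apply: kw_value_generic hp hp2 n | move=> theta; apply: kw_value_le].
by split=> //; exists N.
Qed.
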